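(* Let $(\Omega,\mu)$ be a complete measure space with $\mu(\Omega)=\infty$, and let $E$ be a fully symmetric space on $(\Omega,\mu)$ with $\mathbf 1=\chi_\Omega\notin E$. Assume that either (a) $E\subset\mathcal L^0_h$ and $T$ is a Dunford-Schwartz operator, or (b) $E\subset\mathcal L^0$ and $T$ is a positive Dunford-Schwartz operator. Then for every $f\in E$ and every bounded Besicovitch sequence $\{\beta_k\}_{k=0}^\infty$ the weighted averages $$\frac1n\sum_{k=0}^{n-1}\beta_kT^k(f)$$ converge almost everywhere to some $\widehat f\in E$.
   Context: $\mathcal L^0$ (respectively, $\mathcal L^0_h$) is the linear space of equivalence classes of a.e. finite complex-valued (respectively, real-valued) measurable functions on $\Omega$, and $\mathcal L^p$, $1\le p\le\infty$, is the $L^p$-space on $(\Omega,\mu)$ with its standard norm $\|\cdot\|_p$. In case (a) the spaces $\mathcal L^1$, $\mathcal L^\infty$, $E$ consist of real-valued functions, in case (b) of complex-valued functions. For $f\in\mathcal L^1+\mathcal L^\infty$ the non-increasing rearrangement is $\mu_t(f)=\inf\{\lambda>0:\mu\{|f|>\lambda\}\le t\}$, $t>0$. A Banach space $(E,\|\cdot\|_E)$ with $E\subset\mathcal L^1+\mathcal L^\infty$ is called fully symmetric if $f\in E$, $g\in\mathcal L^1+\mathcal L^\infty$ and $\int_0^s\mu_t(g)\,dt\le\int_0^s\mu_t(f)\,dt$ for all $s>0$ imply $g\in E$ and $\|g\|_E\le\|f\|_E$. A linear operator $T:\mathcal L^1+\mathcal L^\infty\to\mathcal L^1+\mathcal L^\infty$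 is a Dunford-Schwartz operator if $\|T(f)\|_1\le\|f\|_1$ for all $f\in\mathcal L^1$ and $\|T(f)\|_\infty\le\|f\|_\infty$ for all $f\in\mathcal L^\infty$. It is positive if it maps nonnegative functions to nonnegative functions. A function $P:\mathbb Z\to\mathbb C$ is a trigonometric polynomial if $P(k)=\sum_{j=1}^s z_j\lambda_j^k$, $k\in\mathbb Z$, for some $s\in\mathbb N$, $z_1,\dots,z_s\in\mathbb C$ and $\lambda_1,\dots,\lambda_s\in\mathbb C$ with $|\lambda_j|=1$. A sequence $\{\beta_k\}_{k=0}^\infty\subset\mathbb C$ is a bounded Besicovitch sequence if (i) $|\beta_k|\le C<\infty$ for all $k$ and (ii) for every $\epsilon>0$ there is a trigonometric polynomial $P$ with $\limsup_n\frac1n\sum_{k=0}^{n-1}|\beta_k-P(k)|<\epsilon$.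
   Formalization: In case (a) with complex β_k the limit is taken in E+iE: f̂=g+ih with g,h∈E, and h=0 (so f̂∈E) when all β_k are real. The literal claim f̂∈E fails for T the identity, β_k=i and f≠0, since E is real-valued. *)

(* Defs.v *)
From HB Require Import structures.
From mathcomp Require Import all_boot all_order all_algebra.
From mathcomp Require Import complex.
From mathcomp Require Import all_classical all_reals all_analysis.

Set Implicit Arguments.
Unset Strict Implicit.
Unset Printing Implicit Defensive.

Import Order.TTheory GRing.Theory Num.Theory.
Import numFieldNormedType.Exports.
Import ComplexField.Normc.

Local Open Scope classical_set_scope.
Local Open Scope ring_scope.

(* The scalar field [K] of a function space is given together with its
   embedding [iota] into R[i]: it is [real_complex R : R -> R[i]] for spaces of
   real-valued functions and [idfun] for spaces of complex-valued functions.
   Elements of L^0 are represented by functions [Omega -> K]; equality of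
   classes is equality mu-almost everywhere, and a space of classes is a set of
   functions saturated for it. *)
Section FunctionSpaces.
Context (d : measure_display) (Omega : measurableType d) (R : realType).
Variables (mu : {measure set Omega -> \bar R}).
Variables (K : numFieldType) (iota : {rmorphism K -> R[i]}).
Implicit Types (f g h : Omega -> K) (E : set (Omega -> K)).
Implicit Types (N : (Omega -> K) -> R) (T : (Omega -> K) -> (Omega -> K)).

Definition modulus f (x : Omega) : R := normc (iota (f x)).

Definition measurable_scalar_fun f : Prop :=
  measurable_fun setT (fun x => complex.Re (iota (f x))) /\
  measurable_fun setT (fun x => complex.Im (iota (f x))).

Definition Lp_norm (p : \bar R) f : \bar R :=
  ('N[mu]_p[EFin \o modulus f])%E.

Definition Lp (p : \bar R) f : Prop :=
  measurable_scalar_fun f /\ (Lp_norm p f < +oo)%E.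

Definition L1Linfty f : Prop :=
  exists g h, [/\ Lp 1%E g, Lp +oo%E h & f = (fun x => g x + h x)].

Definition rearrangement f (t : R) : \bar R :=
  ereal_inf [set l%:E | l in
    [set l : R | 0 < l /\ (mu [set x | l < modulus f x]%R <= t%:E)%E]].

Definition hlp_majorized g f : Prop :=
  forall s : R, 0 < s ->
  (\int[lebesgue_measure]_(t in `]0%R, s]) rearrangement g t
    <= \int[lebesgue_measure]_(t in `]0%R, s]) rearrangement f t)%E.

(* Only the values of [N] on [E] are meaningful. *)
Record banach_function_space E N : Prop := BanachFunctionSpace {
  bfs_sub : forall f, E f -> L1Linfty f;
  bfs_ae : forall f g, E f -> L1Linfty g -> f = g %[ae mu] ->
    E g /\ N g = N f;
  bfs_0 : E (fun=> 0);
  bfs_linear : forall (a : K) f g, E f -> E g -> E (fun x => a * f x + g x);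
  bfs_normD : forall f g, E f -> E g -> N (fun x => f x + g x) <= N f + N g;
  bfs_normZ : forall (a : K) f, E f ->
    N (fun x => a * f x) = normc (iota a) * N f;
  bfs_norm_eq0 : forall f, E f -> N f = 0 -> f = (fun=> 0) %[ae mu];
  bfs_complete : forall u : nat -> Omega -> K,
    (forall n, E (u n)) ->
    (forall e : R, 0 < e -> exists n0, forall m n,
       (n0 <= m)%N -> (n0 <= n)%N -> N (fun x => u m x - u n x) < e) ->
    exists2 f, E f & N (fun x => u n x - f x) @[n --> \oo] --> (0 : R)
}.

Definition fully_symmetric E N : Prop :=
  banach_function_space E N /\
  forall f g, E f -> L1Linfty g -> hlp_majorized g f -> E g /\ N g <= N f.

(* An operator on L^1 + L^oo acts on representatives; its values outside
   L^1 + L^oo are irrelevant. *)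
Record dunford_schwartz T : Prop := DunfordSchwartz {
  ds_stable : forall f, L1Linfty f -> L1Linfty (T f);
  ds_ae : forall f g, L1Linfty f -> L1Linfty g ->
    f = g %[ae mu] -> T f = T g %[ae mu];
  ds_linear : forall (a : K) f g, L1Linfty f -> L1Linfty g ->
    T (fun x => a * f x + g x) = (fun x => a * T f x + T g x) %[ae mu];
  ds_L1 : forall f, Lp 1%E f -> (Lp_norm 1%E (T f) <= Lp_norm 1%E f)%E;
  ds_Linfty : forall f, Lp +oo%E f ->
    (Lp_norm +oo%E (T f) <= Lp_norm +oo%E f)%E
}.

(* For K = R[i], [0 <= z] says that z is a nonnegative real. *)
Definition positive_operator T : Prop :=
  forall f, L1Linfty f ->
  {ae mu, forall x, 0 <= f x} -> {ae mu, forall x, 0 <= T f x}.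

Definition weighted_average (beta : nat -> R[i]) T f (n : nat) (x : Omega) :
    R[i] :=
  n%:R^-1 * \sum_(k < n) beta k * iota (iter k T f x).

End FunctionSpaces.

(* The ascription to numFieldType selects the topology of R[i] induced by its
   modulus. *)
Definition cvg_ae (d : measure_display) (Omega : measurableType d)
    (R : realType) (mu : {measure set Omega -> \bar R})
    (u : nat -> Omega -> R[i]) (l : Omega -> R[i]) : Prop :=
  {ae mu, forall x, (u n x : (R[i] : numFieldType)) @[n --> \oo]
                      --> (l x : (R[i] : numFieldType))}.

Section Besicovitch.
Variable R : realType.

Definition trigonometric_polynomial (P : int -> R[i]) : Prop :=
  exists (s : nat) (z lambda : 'I_s -> R[i]),
    (forall j, normc (lambda j) = 1) /\
    forall k : int, P k = \sum_(j < s) z j * lambda j ^ k.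

Definition bounded_besicovitch (beta : nat -> R[i]) : Prop :=
  (exists C : R, forall k, normc (beta k) <= C) /\
  forall e : R, 0 < e ->
    exists2 P, trigonometric_polynomial P &
      (limn_esup (fun n : nat =>
         (n%:R^-1 * \sum_(k < n) normc (beta k - P (k%:Z)))%:E) < e%:E)%E.

End Besicovitch.

(* Main.v *)
(* Everything reduces to real functions: a positive T commutes with real parts.
   Since 1 is not in E, the level sets {|f| > l} of f in E have finite measure,
   so f = g + h with g in L^1 and |h| <= e, and the averages of h stay below
   C e.  For g in L^1 we use a Banach principle: Chacon's filling scheme gives a
   weak type (1,1) inequality for averages with arbitrary bounded weights,
   without positivity of T, and bounded integrable g are handled by approximating
   the weights by trigonometric polynomials.  For the weights lambda^k, the
   operator lambda T is a contraction of L^2, F. Riesz's argument shows that the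
   averages are Cauchy in L^2, and the weak type (2,2) inequality upgrades this to
   almost everywhere convergence.  Finally Fatou's lemma applied to the
   decomposition of f at the level mu_s(f) shows that the limit is majorized, in
   the sense of Hardy-Littlewood-Polya, by C f, hence lies in E. *)
Require Import Defs.
From HB Require Import structures.
From mathcomp Require Import all_boot all_order all_algebra.
From mathcomp Require Import complex.
From mathcomp Require Import all_classical all_reals all_analysis.
From mathcomp Require Import ess_sup_inf measurable_realfun.
From mathcomp Require Import ring lra.

Set Implicit Arguments.
Unset Strict Implicit.
Unset Printing Implicit Defensive.

Import Order.TTheory GRing.Theory Num.Theory.
Import numFieldNormedType.Exports.

Local Open Scope classical_set_scope.
Local Open Scope ring_scope.

(** * Real function spaces and operators *)

(** In case (a) T need not preserve order, so Hopf's argument for the maximal theorem is not at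
    hand. The filling scheme asks only for norm contraction, and its exceptional set depends on the
    function and the level but not on the weights: one set serves the real and the imaginary parts
    of all weights at once. One quantity recurs, the integral of (|f| - a)^+. Truncating at a shows
    that T does not increase it, which replaces interpolation in the L2 estimate. It also controls
    majorization: the integral of mu_t(m) over (0, s] is the minimum over b >= 0 of s b plus the
    integral of (m - b)^+, attained at b = mu_s(m). So one Fatou estimate, at one level for each s,
    compares the limit with C f. A second obstacle shapes the statements: operators act on
    representatives, hence every identity for T holds only off a null set. Such identities are
    collected countably many at a time, and combinations of iterates are encoded by polynomials so
    that algebra on them is exact. *)

Section RealSpaces.
Context (d : measure_display) (Omega : measurableType d) (R : realType).
Context (mu : {measure set Omega -> \bar R}).
Implicit Types (f g h : Omega -> R) (c : R).

Definition norm1 f : \bar R := (\int[mu]_x (`|f x|%:E))%E.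

Definition L1 f : Prop := measurable_fun setT f /\ (norm1 f < +oo)%E.

Definition Loo c f : Prop :=
  measurable_fun setT f /\ {ae mu, forall x, `|f x| <= c}.

Definition L1Loo f : Prop :=
  exists g h c, [/\ L1 g, Loo c h & f = (fun x => g x + h x)].

Lemma modulus_real f : modulus (real_complex R) f = fun x => `|f x|.
Proof.
apply/funext => x; rewrite /modulus /ComplexField.Normc.normc /=.
by rewrite expr0n addr0 sqrtr_sqr.
Qed.

Lemma measurable_scalar_real f :
  measurable_scalar_fun (real_complex R) f <-> measurable_fun setT f.
Proof.
split; first by case.
by move=> mf; split => //=; exact: measurable_cst.
Qed.

Lemma Lp1_norm f : Lp_norm mu (real_complex R) 1%E f = norm1 f.
Proof.
rewrite /Lp_norm Lnorm1 modulus_real /norm1.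
by apply: eq_integral => x _ /=; rewrite normr_id.
Qed.

Lemma Lp1_L1 f : Lp mu (real_complex R) 1%E f <-> L1 f.
Proof. by rewrite /Lp /L1 Lp1_norm measurable_scalar_real. Qed.

Context (mu_gt0 : (0 < mu [set: Omega])%E).

(** The norm at p = +oo is defined by a test on [0 < mu setT], with value 0 otherwise; under
    [mu_gt0] it is the essential supremum. *)
Lemma Lpoo_norm_le f c :
  (Lp_norm mu (real_complex R) +oo%E f <= c%:E)%E <->
  {ae mu, forall x, `|f x| <= c}.
Proof.
rewrite /Lp_norm unlock /Lnorm mu_gt0 modulus_real; split.
  move=> /ess_supP; apply: filterS => x /=.
  by rewrite normr_id lee_fin.
move=> fc; apply/ess_supP; move: fc; apply: filterS => x /=.
by rewrite normr_id lee_fin.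
Qed.

Lemma Lpoo_Loo f : Lp mu (real_complex R) +oo%E f <-> exists c, Loo c f.
Proof.
rewrite /Lp measurable_scalar_real; split.
  move=> [mf fy]; exists (fine (Lp_norm mu (real_complex R) +oo%E f)).
  split => //; apply/Lpoo_norm_le; rewrite fineK //.
  by rewrite ge0_fin_numE // Lnorm_ge0.
move=> [c [mf /Lpoo_norm_le fc]]; split => //.
by rewrite (le_lt_trans fc) // ltry.
Qed.

Lemma L1LinftyE f : L1Linfty mu (real_complex R) f <-> L1Loo f.
Proof.
split.
  move=> [g [h [/Lp1_L1 g1 /Lpoo_Loo [c hc] ->]]].
  by exists g, h, c.
move=> [g [h [c [g1 hc ->]]]]; exists g, h; split => //.
  exact/Lp1_L1.
by apply/Lpoo_Loo; exists c.
Qed.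

Lemma L1LooM f : L1Loo f -> measurable_fun setT f.
Proof. by move=> [g [h [c [[mg _] [mh _] ->]]]]; exact: measurable_funD. Qed.

Lemma measurable_normE f : measurable_fun setT f ->
  measurable_fun setT (fun x => `|f x|%:E).
Proof. by move=> mf; apply/measurable_EFinP/measurableT_comp. Qed.

Lemma norm1_ge0 f : (0 <= norm1 f)%E.
Proof. by apply: integral_ge0 => x _; rewrite lee_fin. Qed.

Lemma norm1_le f g : measurable_fun setT f -> measurable_fun setT g ->
  {ae mu, forall x, `|f x| <= `|g x|} -> (norm1 f <= norm1 g)%E.
Proof.
move=> mf mg fg; apply: ae_ge0_le_integral => //;
  do ?[by move=> x _; rewrite lee_fin]; do ?exact: measurable_normE.
by apply: filterS fg => x fgx _; rewrite lee_fin.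
Qed.

Lemma norm1D_le f g : measurable_fun setT f -> measurable_fun setT g ->
  (norm1 (fun x => f x + g x)%R <= norm1 f + norm1 g)%E.
Proof.
move=> mf mg; rewrite /norm1 -ge0_integralD //;
  do ?[by move=> x _; rewrite lee_fin]; do ?exact: measurable_normE.
apply: ge0_le_integral => //; do ?[by move=> x _; rewrite lee_fin].
- exact: (measurable_normE (measurable_funD mf mg)).
- by apply: emeasurable_funD; exact: measurable_normE.
- by move=> x _; rewrite -EFinD lee_fin ler_normD.
Qed.

Lemma norm1Z a f : measurable_fun setT f ->
  norm1 (fun x => a * f x) = (`|a|%:E * norm1 f)%E.
Proof.
move=> mf; rewrite /norm1 -ge0_integralZl_EFin //.
- by apply: eq_integral => x _; rewrite normrM EFinM.
- exact: measurable_normE.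
Qed.

Lemma L1_0 : L1 (fun=> 0).
Proof.
split; first exact: measurable_cst.
by rewrite /norm1 (eq_integral (cst 0%E)) ?integral0 // => x _; rewrite normr0.
Qed.

Lemma Loo_0 c : 0 <= c -> Loo c (fun=> 0).
Proof.
by move=> c0; split; [exact: measurable_cst|apply: aeW => x; rewrite normr0].
Qed.

Lemma L1_lin a f g : L1 f -> L1 g -> L1 (fun x => a * f x + g x).
Proof.
move=> [mf f1] [mg g1].
have maf : measurable_fun setT (fun x => a * f x) by exact: measurable_funM.
split; first exact: measurable_funD.
rewrite (le_lt_trans (norm1D_le maf mg)) // norm1Z // lte_add_pinfty //.
by apply: lte_mul_pinfty; rewrite ?lee_fin.
Qed.

Lemma Loo_lin a b c f g : Loo b f -> Loo c g ->
  Loo (`|a| * b + c) (fun x => a * f x + g x).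
Proof.
move=> [mf fb] [mg gc].
have maf : measurable_fun setT (fun x => a * f x) by exact: measurable_funM.
split; first exact: measurable_funD.
apply: filterS2 fb gc => x fb gc.
rewrite (le_trans (ler_normD _ _)) // lerD // normrM ler_wpM2l //.
Qed.

Lemma L1_L1Loo f : L1 f -> L1Loo f.
Proof.
move=> f1; exists f, (fun=> 0), 0; split => //; first exact: Loo_0.
by apply/funext => x; rewrite addr0.
Qed.

Lemma Loo_L1Loo c f : Loo c f -> L1Loo f.
Proof.
move=> fc; exists (fun=> 0), f, c; split => //; first exact: L1_0.
by apply/funext => x; rewrite add0r.
Qed.

Lemma L1Loo_lin a f g : L1Loo f -> L1Loo g -> L1Loo (fun x => a * f x + g x).
Proof.
move=> [f1 [f2 [b [Hf1 Hf2 ->]]]] [g1 [g2 [c [Hg1 Hg2 ->]]]].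
exists (fun x => a * f1 x + g1 x), (fun x => a * f2 x + g2 x), (`|a| * b + c).
split; [exact: L1_lin|exact: Loo_lin|].
by apply/funext => x; rewrite mulrDr addrACA.
Qed.

Lemma L1Loo_0 : L1Loo (fun=> 0).
Proof. exact: L1_L1Loo L1_0. Qed.

Lemma L1Loo_sum n (a : nat -> R) (F : nat -> Omega -> R) :
  (forall k, L1Loo (F k)) -> L1Loo (fun x => \sum_(k < n) a k * F k x).
Proof.
move=> HF; elim: n => [|n IH].
  rewrite (_ : (fun _ => _) = fun=> 0); first exact: L1Loo_0.
  by apply/funext => x; rewrite big_ord0.
rewrite (_ : (fun _ => _) =
  fun x => a n * F n x + \sum_(k < n) a k * F k x); first exact: L1Loo_lin.
by apply/funext => x; rewrite big_ord_recr /= addrC.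
Qed.

End RealSpaces.

Section RealOperator.
Context (d : measure_display) (Omega : measurableType d) (R : realType).
Context (mu : {measure set Omega -> \bar R}).
Context (mu_gt0 : (0 < mu [set: Omega])%E).
Context (T : (Omega -> R) -> Omega -> R).
Context (DS : dunford_schwartz mu (real_complex R) T).
Implicit Types (f g h : Omega -> R) (c : R).

Lemma T_L1Loo f : L1Loo mu f -> L1Loo mu (T f).
Proof. by move=> /(L1LinftyE mu_gt0) /(ds_stable DS) /(L1LinftyE mu_gt0). Qed.

Lemma T_ae f g : L1Loo mu f -> L1Loo mu g ->
  {ae mu, forall x, f x = g x} -> {ae mu, forall x, T f x = T g x}.
Proof.
move=> /(L1LinftyE mu_gt0) f1 /(L1LinftyE mu_gt0) g1 fg.
have := ds_ae DS f1 g1.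
have fg' : f = g %[ae mu] by apply: filterS fg.
by move=> /(_ fg'); apply: filterS => x /(_ I).
Qed.

Lemma T_lin a f g : L1Loo mu f -> L1Loo mu g ->
  {ae mu, forall x, T (fun x => a * f x + g x) x = a * T f x + T g x}.
Proof.
move=> /(L1LinftyE mu_gt0) f1 /(L1LinftyE mu_gt0) g1.
by have := ds_linear DS a f1 g1; apply: filterS => x /(_ I).
Qed.

Lemma T_norm1 f : L1 mu f -> (norm1 mu (T f) <= norm1 mu f)%E.
Proof. by move=> /Lp1_L1 /(ds_L1 DS); rewrite !Lp1_norm. Qed.

Lemma T_L1 f : L1 mu f -> L1 mu (T f).
Proof.
move=> f1; split; last by rewrite (le_lt_trans (T_norm1 f1)) //; case: f1.
by apply: (@L1LooM _ _ _ mu); apply/T_L1Loo/L1_L1Loo.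
Qed.

Lemma T_Loo c f : Loo mu c f -> Loo mu c (T f).
Proof.
move=> fc; split.
  by apply: (@L1LooM _ _ _ mu); apply/T_L1Loo/Loo_L1Loo/fc.
apply/(Lpoo_norm_le mu_gt0); apply: le_trans (ds_Linfty DS _) _.
  by apply/(Lpoo_Loo mu_gt0); exists c.
by apply/(Lpoo_norm_le mu_gt0); case: fc.
Qed.

Lemma T_0 : {ae mu, forall x, T (fun=> 0) x = 0}.
Proof.
have := T_Loo (Loo_0 mu (lexx 0)) => -[_].
by apply: filterS => x; rewrite normr_le0 => /eqP.
Qed.

Lemma T_sum n (a : nat -> R) (F : nat -> Omega -> R) :
  (forall k, L1Loo mu (F k)) ->
  {ae mu, forall x, T (fun x => \sum_(k < n) a k * F k x) x
                    = \sum_(k < n) a k * T (F k) x}.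
Proof.
move=> HF; elim: n => [|n IH].
  rewrite (_ : (fun _ => _) = fun=> 0); last first.
    by apply/funext => x; rewrite big_ord0.
  by apply: filterS T_0 => x ->; rewrite big_ord0.
rewrite (_ : (fun _ => _) =
  fun x => a n * F n x + \sum_(k < n) a k * F k x); last first.
  by apply/funext => x; rewrite big_ord_recr /= addrC.
have := T_lin (a n) (HF n) (L1Loo_sum n a HF).
apply: filterS2 IH => x IH ->; rewrite IH.
by rewrite big_ord_recr /= addrC.
Qed.

Lemma iter_L1Loo k f : L1Loo mu f -> L1Loo mu (iter k T f).
Proof. by move=> f1; elim: k => //= k; exact: T_L1Loo. Qed.

Lemma iter_L1 k f : L1 mu f -> L1 mu (iter k T f).
Proof. by move=> f1; elim: k => //= k; exact: T_L1. Qed.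

Lemma iter_norm1 k f : L1 mu f -> (norm1 mu (iter k T f) <= norm1 mu f)%E.
Proof.
move=> f1; elim: k => //= k; apply: le_trans.
by apply: T_norm1; exact: iter_L1.
Qed.

Lemma iter_Loo k c f : Loo mu c f -> Loo mu c (iter k T f).
Proof. by move=> f1; elim: k => //= k; exact: T_Loo. Qed.

Lemma iter_sum j n (a : nat -> R) (F : nat -> Omega -> R) :
  (forall k, L1Loo mu (F k)) ->
  {ae mu, forall x, iter j T (fun x => \sum_(k < n) a k * F k x) x
                    = \sum_(k < n) a k * iter j T (F k) x}.
Proof.
move=> HF; elim: j => [|j IH] /=; first exact: aeW.
have := T_sum n a (fun k => iter_L1Loo j (HF k)).
have := T_ae _ _ IH.
move=> /(_ (iter_L1Loo _ (L1Loo_sum _ _ HF))).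
move=> /(_ (L1Loo_sum _ _ (fun k => iter_L1Loo j (HF k)))).
by apply: filterS2 => x -> ->.
Qed.

Lemma iter_lin j a f g : L1Loo mu f -> L1Loo mu g ->
  {ae mu, forall x, iter j T (fun x => a * f x + g x) x =
                    a * iter j T f x + iter j T g x}.
Proof.
move=> f1 g1; elim: j => [|j IH] /=; first exact: aeW.
have := T_lin a (iter_L1Loo j f1) (iter_L1Loo j g1).
have := T_ae (iter_L1Loo j (L1Loo_lin a f1 g1)) _ IH.
move=> /(_ (L1Loo_lin a (iter_L1Loo j f1) (iter_L1Loo j g1))).
by apply: filterS2 => x -> ->.
Qed.

End RealOperator.

(** * Chacon's maximal inequality *)

Section Clamp.
Context (R : realType).
Implicit Types m v : R.

Definition clamp m v : R := Num.max (- m) (Num.min m v).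

Lemma clamp_id m v : `|v| <= m -> clamp m v = v.
Proof.
rewrite ler_norml /clamp => /andP[v1 v2].
by rewrite (min_idPr v2) (max_idPr v1).
Qed.

Lemma clamp_le m v : 0 <= m -> `|clamp m v| <= m.
Proof.
move=> m0; rewrite /clamp ler_norml le_max lexx /= ge_max ge_min lexx /= andbT.
by rewrite (le_trans _ m0) // oppr_le0.
Qed.

(** The truncated part and the rest have the same sign, so no cancellation occurs. This is what
    makes the mass balance of the filling scheme exact. *)
Lemma clamp_split m v : 0 <= m -> `|clamp m v| + `|v - clamp m v| = `|v|.
Proof.
move=> m0; rewrite /clamp.
case: (leP m v) => [mv|vm].
  rewrite (max_idPr (_ : - m <= m)); last by rewrite (le_trans _ m0) // oppr_le0.
  by rewrite !ger0_norm ?subr_ge0 //; [lra|exact: le_trans mv].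
case: (leP (- m) v) => [mv|vm2]; first by rewrite subrr normr0 addr0.
rewrite !ler0_norm //; lra.
Qed.

Lemma clamp_rest m v : 0 <= m -> `|v - clamp m v| = Num.max 0 (`|v| - m).
Proof.
move=> m0; case: (leP `|v| m) => [vm|mv].
  by rewrite clamp_id // subrr normr0 max_l // subr_le0.
rewrite max_r; last by rewrite subr_ge0 ltW.
rewrite /clamp; case: (leP m v) => [mv'|vm].
  rewrite (max_idPr (_ : - m <= m)); last by rewrite (le_trans _ m0) // oppr_le0.
  by rewrite !ger0_norm ?subr_ge0 //; exact: le_trans mv'.
case: (leP (- m) v) => [mv'|vm2].
  by move: mv; rewrite ltNge ler_norml mv' (ltW vm).
rewrite !ler0_norm //; lra.
Qed.

Lemma clamp_full m v : 0 <= m -> v - clamp m v != 0 -> `|clamp m v| = m.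
Proof.
move=> m0 h; case: (leP `|v| m) => vm.
  by move: h; rewrite clamp_id // subrr eqxx.
have := clamp_split v m0; rewrite clamp_rest // max_r ?subr_ge0 ?ltW //.
lra.
Qed.

Lemma measurable_clamp d (S : measurableType d) (m v : S -> R) :
  measurable_fun setT m -> measurable_fun setT v ->
  measurable_fun setT (fun x => clamp (m x) (v x)).
Proof.
move=> mm mv; apply: measurable_maxr; first exact: measurable_funN.
exact: measurable_minr.
Qed.

End Clamp.

(** The triangle i + j < n is summed by antidiagonals and by rows. In [maximal_ineq], j is a filling
    step and i the number of later applications of T. *)
Lemma sum_triangle (V : nmodType) (F : nat -> nat -> V) n :
  \sum_(k < n) \sum_(j < k.+1) F (k - j)%N j =
  \sum_(i < n) \sum_(j < n - i) F i j.
Proof.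
elim: n => [|n IH]; first by rewrite !big_ord0.
rewrite big_ord_recr /= IH [RHS]big_ord_recr /= subSnn big_ord1.
rewrite [X in _ + X](reindex_inj rev_ord_inj) /= big_ord_recr /=.
rewrite !subnn [X in _ + (X + _)](eq_bigr (fun i : 'I_n => F i (n - i)%N)).
  rewrite addrA -big_split /= subn0; congr (_ + _); apply: eq_bigr => i _.
  by rewrite subSn ?big_ord_recr //= ltnW.
by move=> i _; rewrite subSS subKn // ltnW.
Qed.

Lemma measurable_gt (d : measure_display) (X : measurableType d) (R : realType)
    (u : X -> R) l : measurable_fun setT u -> measurable [set x | l < u x].
Proof.
move=> mu; have := @measurable_fun_ltr _ _ _ setT (cst l) u (measurable_cst _) mu.
by move=> /(_ measurableT [set true]); rewrite setTI; apply.
Qed.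

Lemma measurable_ge (d : measure_display) (X : measurableType d) (R : realType)
    (u : X -> R) l : measurable_fun setT u -> measurable [set x | l <= u x].
Proof.
move=> mu; have := @measurable_fun_ler _ _ _ setT (cst l) u (measurable_cst _) mu.
by move=> /(_ measurableT [set true]); rewrite setTI; apply.
Qed.

Lemma markov_norm1 (d : measure_display) (Omega : measurableType d)
    (R : realType) (mu : {measure set Omega -> \bar R}) (g : Omega -> R) (a : R) :
  measurable_fun setT g -> 0 < a ->
  (mu [set x | a <= `|g x|]%R <= a^-1%:E * norm1 mu g)%E.
Proof.
move=> mg a0; rewrite lee_pdivlMl //.
have := @le_integral_comp_abse _ _ _ mu setT measurableT (EFin \o g) a id.
rewrite setTI /=; apply => //; first exact/measurable_EFinP.
Qed.

Section Maximal.
Context (d : measure_display) (Omega : measurableType d) (R : realType).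
Context (mu : {measure set Omega -> \bar R}).
Context (mu_gt0 : (0 < mu [set: Omega])%E).
Context (T : (Omega -> R) -> Omega -> R).
Context (DS : dunford_schwartz mu (real_complex R) T).
Context (f : Omega -> R) (f1 : L1 mu f) (a : R) (a0 : 0 < a).

(* In [fill n = (v, A)], [v] is the mass still to be placed and [A] the total
   mass placed so far, never above the level [a]: the part of [v] that fits is
   added to [A], and T moves the excess on. *)
Fixpoint fill (n : nat) : (Omega -> R) * (Omega -> R) :=
  if n is n'.+1 then
    let: (v, A) := fill n' in
    (T (fun x => v x - clamp (a - A x) (v x)),
     fun x => A x + `|clamp (a - A x) (v x)|)
  else (f, fun=> 0).

Let v n := (fill n).1.
Let A n := (fill n).2.
Let D n x := clamp (a - A n x) (v n x).
Let h n x := v n x - D n x.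

Let v0 : v 0 = f. Proof. by []. Qed.

Let vS n : v n.+1 = T (h n).
Proof. by rewrite /v /h /D /A /v /=; case: (fill n). Qed.

Let AS n x : A n.+1 x = A n x + `|D n x|.
Proof. by rewrite /v /h /D /A /v /=; case: (fill n). Qed.

Let A_sum n x : A n x = \sum_(j < n) `|D j x|.
Proof.
by elim: n => [|n IH]; rewrite ?big_ord0 // AS big_ord_recr IH.
Qed.

Let A_le n x : A n x <= a.
Proof.
elim: n => [|n IH]; first by rewrite /A /= ltW.
by rewrite AS -lerBrDl; apply: clamp_le; rewrite subr_ge0.
Qed.

Let A_ge0 n x : 0 <= A n x.
Proof. by rewrite A_sum sumr_ge0. Qed.

Let A_nd m n x : (m <= n)%N -> A m x <= A n x.
Proof.
move=> /subnK <-; elim: (n - m)%N => // k IH.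
by rewrite addSn AS (le_trans IH) // lerDl.
Qed.

Let h_full n x : h n x != 0 -> A n.+1 x = a.
Proof.
move=> hn; rewrite AS clamp_full ?subrKC // subr_ge0; exact: A_le.
Qed.

Let h_eq0 n x : (forall N, A N x != a) -> h n x = 0.
Proof. by move=> H; apply/eqP/negPn/negP => /h_full /eqP; exact/negP. Qed.

Let mA_v n : measurable_fun setT (A n) /\ L1 mu (v n).
Proof.
elim: n => [|n [mA mv]]; first by split; [exact: measurable_cst|].
have [mvn _] := mv.
have mD : measurable_fun setT (D n).
  by apply: measurable_clamp => //; exact: measurable_funB.
have mh : measurable_fun setT (h n) by exact: measurable_funB.
split.
  rewrite (_ : A n.+1 = fun x => A n x + `|D n x|); last exact/funext/AS.
  by apply: measurable_funD => //; exact: measurableT_comp.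
rewrite vS; apply: (T_L1 mu_gt0 DS); split => //.
apply: le_lt_trans mv.2; apply: norm1_le => //; apply: aeW => x.
by rewrite -(@clamp_split _ (a - A n x) (v n x)) ?lerDr // subr_ge0.
Qed.

Let mA n : measurable_fun setT (A n). Proof. by case: (mA_v n). Qed.
Let v_L1 n : L1 mu (v n). Proof. by case: (mA_v n). Qed.

Let mD n : measurable_fun setT (D n).
Proof.
have [? _] := v_L1 n.
by apply: measurable_clamp => //; exact: measurable_funB.
Qed.

Let mh n : measurable_fun setT (h n).
Proof. by have [? _] := v_L1 n; exact: measurable_funB. Qed.

Let D_L1 n : L1 mu (D n).
Proof.
split => //; apply: le_lt_trans (v_L1 n).2; apply: norm1_le => //.
  by case: (v_L1 n).
apply: aeW => x.
by rewrite -(@clamp_split _ (a - A n x) (v n x)) ?lerDl // subr_ge0.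
Qed.

Let h_L1 n : L1 mu (h n).
Proof.
split => //; apply: le_lt_trans (v_L1 n).2; apply: norm1_le => //.
  by case: (v_L1 n).
apply: aeW => x.
by rewrite -(@clamp_split _ (a - A n x) (v n x)) ?lerDr // subr_ge0.
Qed.

(* The filled mass and the mass still to be placed together never exceed the
   initial mass, because T does not increase the L1 norm. *)
Let fill_norm n : (norm1 mu (A n) + norm1 mu (v n) <= norm1 mu f)%E.
Proof.
elim: n => [|n IH].
  rewrite /A /= [X in (X + _)%E](_ : _ = 0%E) ?add0e //.
  rewrite /norm1 (eq_integral (cst 0%E)) ?integral0 // => x _.
  by rewrite normr0.
apply: le_trans IH.
rewrite vS (_ : A n.+1 = fun x => A n x + `|D n x|); last exact/funext/AS.
apply: le_trans (leeD (norm1D_le mu (mA n) _) (T_norm1 DS (h_L1 n))) _.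
  exact: measurableT_comp.
have mDn : measurable_fun setT (fun x => `|D n x|) by exact: measurableT_comp.
rewrite -addeA leeD2l // /norm1 -ge0_integralD //;
  do ?[by move=> x _; rewrite lee_fin]; do ?exact: measurable_normE.
apply: ae_ge0_le_integral => //; do ?[by move=> x _; rewrite ?adde_ge0 ?lee_fin].
- by apply: emeasurable_funD; exact: measurable_normE.
- by apply: measurable_normE; case: (v_L1 n).
- apply: aeW => x _; rewrite -EFinD lee_fin normr_id.
  by rewrite (@clamp_split _ (a - A n x) (v n x)) // subr_ge0.
Qed.

(** Unrolling [v n.+1 = T (h n)] and [v n = D n + h n]: the piece [D j] placed at step j undergoes
    the remaining k - j applications of T, and [h k] is what has not found room. *)
Let iter_decomp k : {ae mu, forall x,
  iter k T f x = \sum_(j < k.+1) iter (k - j) T (D j) x + h k x}.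
Proof.
have vk n x : v n x = D n x + h n x by rewrite /h subrKC.
have HL n := L1_L1Loo (D_L1 n).
elim: k => [|k IH].
  by apply: aeW => x; rewrite big_ord1 /= -vk v0.
pose F j := iter (k - j) T (D j).
have FL j : L1Loo mu (F j) by apply: iter_L1Loo => //.
have e1 : (fun x => \sum_(j < k.+1) iter (k - j) T (D j) x + h k x) =
          (fun x => 1 * (\sum_(j < k.+1) 1 * F j x) + h k x).
  by apply/funext => x; rewrite mul1r; under [in RHS]eq_bigr do rewrite mul1r.
have SL : L1Loo mu (fun x => \sum_(j < k.+1) 1 * F j x).
  exact: (L1Loo_sum _ (fun=> 1)).
have hL := L1_L1Loo (h_L1 k).
have L1' : L1Loo mu (iter k T f) by apply: iter_L1Loo => //; exact: L1_L1Loo.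
have := T_ae mu_gt0 DS L1' _ IH.
rewrite e1 => /(_ (L1Loo_lin 1 SL hL)) H1.
have H2 := T_lin mu_gt0 DS 1 SL hL.
have H3 := T_sum mu_gt0 DS k.+1 (fun=> 1) FL.
apply: filterS3 H1 H2 H3 => x /= -> -> ->.
rewrite mul1r -vS vk addrA [in RHS]big_ord_recr /= subnn /=; congr (_ + _ + _).
apply: eq_bigr => j _; rewrite mul1r /F.
by rewrite subSn //; exact: (ltn_ord j).
Qed.

(** B is the set where the level a is reached at some step; [fill_norm] and Markov's inequality
    bound its measure. Off B every excess [h k] vanishes, so [iter_decomp] expresses the iterates
    through the placed pieces alone, and these sum in modulus to at most a. B is fixed before the
    weights b. *)
Lemma maximal_ineq : exists B : set Omega,
  [/\ measurable B, (mu B <= a^-1%:E * norm1 mu f)%E &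
   forall (b : nat -> R) (C : R), (forall k, `|b k| <= C) ->
   {ae mu, forall x, ~ B x -> forall n,
     `|\sum_(k < n) b k * iter k T f x| <= n%:R * (C * a)}].
Proof.
pose BN N := [set x | a <= `|A N x|].
have mBN N : measurable (BN N).
  by apply: measurable_ge; exact: measurableT_comp.
exists (\bigcup_N BN N); split.
- exact: bigcup_measurable.
- have ndB : nondecreasing_seq BN.
    move=> m n mn; apply/subsetPset => x /=; rewrite /BN /= !ger0_norm //.
    by move=> /le_trans; apply; exact: A_nd.
  have /cvg_lim <- // := @nondecreasing_cvg_mu _ _ _ mu _ mBN
    (bigcup_measurable (fun k _ => mBN k)) ndB.
  apply: lime_le.
    by apply: cvgP; apply: nondecreasing_cvg_mu => //; exact: bigcup_measurable.
  apply: nearW => N /=.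
  apply: le_trans (markov_norm1 mu (mA N) a0) _.
  rewrite lee_pmul2l // ?lte_fin ?invr_gt0 //.
  by apply: le_trans (fill_norm N); rewrite leeDl // norm1_ge0.
move=> b C bC.
have C0 : 0 <= C by exact: le_trans (bC 0).
have H1 := ae_foralln iter_decomp.
have HL n := L1_L1Loo (D_L1 n).
(* All pieces that receive exactly i applications of T, combined before T acts. Whatever the
   weights, this is at most C a in modulus since the sum of the [|D j|] is at most a; the
   contraction of L^oo preserves the bound, and n values of i give n C a. *)
pose S n i x := \sum_(j < n - i) b (i + j)%N * D j x.
have S_Loo n i : Loo mu (C * a) (S n i).
  split.
    apply: measurable_sum => j; exact: measurable_funM.
  apply: aeW => x; apply: le_trans (ler_norm_sum _ _ _) _.
  apply: (@le_trans _ _ (\sum_(j < n - i) C * `|D j x|)).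
    by apply: ler_sum => j _; rewrite normrM ler_wpM2r.
  by rewrite -mulr_sumr -A_sum ler_wpM2l.
have H2 : {ae mu, forall x, forall n i, `|iter i T (S n i) x| <= C * a}.
  apply: ae_foralln => n; apply: ae_foralln => i.
  by have [] := iter_Loo mu_gt0 DS i (S_Loo n i).
have H3 : {ae mu, forall x, forall n i, iter i T (S n i) x =
   \sum_(j < n - i) b (i + j)%N * iter i T (D j) x}.
  apply: ae_foralln => n; apply: ae_foralln => i.
  exact: (iter_sum mu_gt0 DS i (n - i) (fun j => b (i + j)%N)).
apply: filterS3 H1 H2 H3 => x H1 H2 H3 nBx n.
have h0 k : h k x = 0.
  apply: h_eq0 => N; apply/eqP => ANx; apply: nBx; exists N => //.
  by rewrite /BN /= ANx ger0_norm // ltW.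
rewrite (_ : \sum_(k < n) _ = \sum_(i < n) iter i T (S n i) x).
  apply: le_trans (ler_norm_sum _ _ _) _.
  apply: (@le_trans _ _ (\sum_(i < n) C * a)); first exact: ler_sum.
  by rewrite sumr_const card_ord mulr_natl.
pose F i j := b (i + j)%N * iter i T (D j) x.
rewrite [RHS](eq_bigr (fun i : 'I_n => \sum_(j < n - i) F i j)); last first.
  by move=> i _; rewrite H3.
rewrite -sum_triangle; apply: eq_bigr => k _.
rewrite H1 h0 addr0 mulr_sumr; apply: eq_bigr => j _.
by rewrite /F subnK // -ltnS.
Qed.

End Maximal.

(** * Contraction in L2 *)

Section LayerSum.
Context (R : realType).
Implicit Types (x t : R).

(** With [excess_step_ge], the telescoping step for lower and upper Riemann sums of mesh t in the
    formula x^2 = 2 int_0^oo (x - z)^+ dz. *)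
Lemma excess_step_le x t z : 0 <= t ->
  2 * t * Num.max 0 (x - (z + t)) + Num.max 0 (x - (z + t)) ^+ 2 <=
  Num.max 0 (x - z) ^+ 2.
Proof.
move=> t0.
case: (leP (x - (z + t)) 0) => h1; case: (leP (x - z) 0) => h2. 
- by rewrite mulr0 expr0n addr0.
- by rewrite mulr0 expr0n addr0 sqr_ge0.
- lra.
- nra.
Qed.

Lemma excess_step_ge x t z : 0 <= t ->
  Num.max 0 (x - z) ^+ 2 <=
  2 * t * Num.max 0 (x - z) + Num.max 0 (x - (z + t)) ^+ 2.
Proof.
move=> t0.
case: (leP (x - (z + t)) 0) => h1; case: (leP (x - z) 0) => h2. 
- by rewrite mulr0 expr0n addr0.
- rewrite expr0n addr0 expr2 ler_wpM2r //; lra.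
- lra.
- nra.
Qed.

Lemma layer_sum_le x t N : 0 <= x -> 0 <= t ->
  \sum_(j < N) 2 * t * Num.max 0 (x - j.+1%:R * t) <= x ^+ 2.
Proof.
move=> x0 t0; pose y j := Num.max 0 (x - j%:R * t).
suff: \sum_(j < N) 2 * t * y j.+1 + y N ^+ 2 <= x ^+ 2.
  by apply: le_trans; rewrite lerDl sqr_ge0.
elim: N => [|N IH]; first by rewrite big_ord0 add0r /y mul0r subr0 max_r.
apply: le_trans IH; rewrite big_ord_recr /= -addrA lerD2l.
have -> : y N.+1 = Num.max 0 (x - (N%:R * t + t)).
  by rewrite /y -(natr1 N) mulrDl mul1r.
exact: excess_step_le.
Qed.

(** The upper Riemann sum has one layer more than the lower one, that of level 0, equal to 2 t x. It
    is the error term, which is integrable when x = |T f| with f in L1. *)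
Lemma layer_sum_ge x t N : 0 <= x -> 0 <= t -> x <= N%:R * t ->
  x ^+ 2 <= 2 * t * x + \sum_(j < N) 2 * t * Num.max 0 (x - j.+1%:R * t).
Proof.
move=> x0 t0 xN; pose y j := Num.max 0 (x - j%:R * t).
have y0 j : 0 <= y j by rewrite le_max lexx.
have yN : y N = 0 by rewrite /y max_l // subr_le0.
suff H : x ^+ 2 <= \sum_(j < N) 2 * t * y j + y N ^+ 2.
  apply: le_trans H _; rewrite yN expr0n addr0.
  case: N {xN yN} => [|N]; first by rewrite !big_ord0 addr0 !mulr_ge0.
  rewrite big_ord_recl {1}/y mul0r subr0 max_r // lerD2l.
  rewrite [leRHS]big_ord_recr /=; apply: ler_wpDr; first by rewrite !mulr_ge0 // le_max lexx.
  by apply: ler_sum.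
elim: N {xN yN} => [|N IH]; first by rewrite big_ord0 add0r /y mul0r subr0 max_r.
apply: le_trans IH _; rewrite big_ord_recr /= -addrA lerD2l.
have -> : y N.+1 = Num.max 0 (x - (N%:R * t + t)).
  by rewrite /y -(natr1 N) mulrDl mul1r.
exact: excess_step_ge.
Qed.

End LayerSum.

Section L2.
Context (d : measure_display) (Omega : measurableType d) (R : realType).
Context (mu : {measure set Omega -> \bar R}).
Implicit Types f g : Omega -> R.

Definition sqn f : \bar R := (\int[mu]_x ((f x ^+ 2)%:E))%E.

Lemma measurable_sqE f : measurable_fun setT f ->
  measurable_fun setT (fun x => (f x ^+ 2)%:E).
Proof. by move=> mf; apply/measurable_EFinP/measurable_funX. Qed.

Lemma measurable_excess a f : measurable_fun setT f ->
  measurable_fun setT (fun x => Num.max 0 (`|f x| - a)).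
Proof.
move=> mf; apply: measurable_maxr => //; apply: measurable_funB => //.
exact: measurableT_comp.
Qed.

Lemma clamp_L1 a f : 0 <= a -> L1 mu f ->
  [/\ L1 mu (fun x => clamp a (f x)), Loo mu a (fun x => clamp a (f x)) &
      L1 mu (fun x => f x - clamp a (f x))].
Proof.
move=> a0 [mf f1].
have mc : measurable_fun setT (fun x => clamp a (f x)).
  exact: (measurable_clamp (measurable_cst a)).
split.
- split => //; apply: le_lt_trans f1; apply: norm1_le => //; apply: aeW => x.
  by rewrite -(clamp_split (f x) a0) lerDl.
- by split => //; apply: aeW => x; exact: clamp_le.
- have mb : measurable_fun setT (fun x => f x - clamp a (f x)).
    exact: measurable_funB.
  split => //; apply: le_lt_trans f1; apply: norm1_le => //; apply: aeW => x.
  by rewrite -(clamp_split (f x) a0) lerDr.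
Qed.

Context (mu_gt0 : (0 < mu [set: Omega])%E).
Context (T : (Omega -> R) -> Omega -> R).
Context (DS : dunford_schwartz mu (real_complex R) T).

Lemma T_clamp k a f : 0 <= a -> L1 mu f -> {ae mu, forall x,
  iter k T f x = iter k T (fun x => f x - clamp a (f x)) x +
                 iter k T (fun x => clamp a (f x)) x}.
Proof.
move=> a0 f1; have [c1 c2 g1] := clamp_L1 a0 f1.
have := iter_lin mu_gt0 DS k 1 (L1_L1Loo g1) (L1_L1Loo c1).
have -> : (fun x => 1 * (f x - clamp a (f x)) + clamp a (f x)) = f.
  by apply/funext => x; rewrite mul1r subrK.
by apply: filterS => x ->; rewrite mul1r.
Qed.

(** The truncated part of f stays bounded by a under T, so (|T f| - a)^+ is at most |T g| for the
    rest g, and the L1 norm of g is the right-hand side. *)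
Lemma T_excess a f : 0 <= a -> L1 mu f ->
  (\int[mu]_x (Num.max 0 (`|T f x| - a))%:E
     <= \int[mu]_x (Num.max 0 (`|f x| - a))%:E)%E.
Proof.
move=> a0 f1; have [c1 c2 g1] := clamp_L1 a0 f1.
have [mTf _] := T_L1 mu_gt0 DS f1; have [mf _] := f1.
have [mTg _] := T_L1 mu_gt0 DS g1.
have [_ Tc] := T_Loo mu_gt0 DS c2.
rewrite [leRHS](_ : _ = norm1 mu (fun x => f x - clamp a (f x))); last first.
  by apply: eq_integral => x _; rewrite clamp_rest.
apply: le_trans (T_norm1 DS g1).
apply: ae_ge0_le_integral => //.
- by move=> x _; rewrite lee_fin le_max lexx.
- by apply/measurable_EFinP; exact: measurable_excess.
- exact: measurable_normE.
have := T_clamp 1 a0 f1.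
apply: filterS2 Tc => x /= Tc -> _; rewrite lee_fin ge_max normr_ge0 /=.
by rewrite lerBlDr (le_trans (ler_normD _ _)) // lerD2l.
Qed.

Lemma int_layer_sum t N f : 0 <= t -> measurable_fun setT f ->
  (\int[mu]_x (\sum_(j < N) 2 * t * Num.max 0 (`|f x| - j.+1%:R * t))%:E =
   \sum_(j < N) (2 * t)%:E *
      \int[mu]_x (Num.max 0 (`|f x| - j.+1%:R * t))%:E)%E.
Proof.
move=> t0 mf.
have mj j : measurable_fun setT
    (fun x => (Num.max 0 (`|f x| - j.+1%:R * t))%:E).
  by apply/measurable_EFinP; exact: measurable_excess.
under eq_integral do rewrite -sumEFin.
rewrite ge0_integral_sum //=.
- apply: eq_bigr => j _; rewrite -ge0_integralZl_EFin //.
  + by move=> x _; rewrite lee_fin le_max lexx.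
  + by rewrite mulr_ge0.
- move=> j; apply/measurable_EFinP; apply: measurable_funM => //.
  exact: measurable_excess.
- by move=> j x _; rewrite lee_fin !mulr_ge0 // le_max lexx.
Qed.

(* Convexity: the excesses over all levels decrease under T, and x^2 is a
   superposition of excesses. *)
Lemma T_sqn f c : L1 mu f -> Loo mu c f -> (sqn (T f) <= sqn f)%E.
Proof.
move=> f1 fc; have [mTf _] := T_L1 mu_gt0 DS f1; have [mf _] := f1.
have [_ Tfc] := T_Loo mu_gt0 DS fc.
apply/lee_addgt0Pr => e e0.
have nf0 := norm1_ge0 mu f.
have nffin : norm1 mu f \is a fin_num by rewrite ge0_fin_numE //; case: f1.
(* The mesh is chosen so that the layer of level 0 contributes at most e; the [+ 1] in the
   denominator covers a vanishing norm. *)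
have [t t0 te] : exists2 t, 0 < t & 2 * t * fine (norm1 mu f) <= e.
  set F := fine _; have F0 : 0 <= F by exact: fine_ge0.
  have D0 : 0 < F + 1 by rewrite ltr_wpDl.
  exists (e / (2 * (F + 1))); first by rewrite divr_gt0 // mulr_gt0.
  rewrite (_ : 2 * (e / (2 * (F + 1))) * F = e * (F / (F + 1))); last first.
    by field; rewrite gt_eqF.
  by rewrite -[leRHS]mulr1 ler_pM2l // ler_pdivrMr // mul1r lerDl.
have t0' := ltW t0.
(* Since |T f| <= c, the N levels up to N t exhaust the range of |T f|. *)
pose N := Num.bound (c / t).
have cN : c <= N%:R * t.
  rewrite -ler_pdivrMr //; case: (leP 0 (c / t)) => ct.
    exact/ltW/archi_boundP.
  by rewrite (le_trans (ltW ct)).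
pose psi (g : Omega -> R) x :=
  \sum_(j < N) 2 * t * Num.max 0 (`|g x| - j.+1%:R * t).
have mpsi g : measurable_fun setT g -> measurable_fun setT (fun x => (psi g x)%:E).
  move=> mg; apply/measurable_EFinP; apply: measurable_sum => j.
  by apply: measurable_funM => //; exact: measurable_excess.
have psi0 g x : 0 <= psi g x.
  by apply: sumr_ge0 => j _; apply: mulr_ge0; [exact: mulr_ge0|rewrite le_max lexx].
have step1 : (sqn (T f) <= \int[mu]_x ((2 * t * `|T f x|)%:E + (psi (T f) x)%:E))%E.
  apply: ae_ge0_le_integral => //.
  - by move=> x _; rewrite lee_fin sqr_ge0.
  - exact: measurable_sqE.
  - by move=> x _; rewrite -EFinD lee_fin addr_ge0 // mulr_ge0 // mulr_ge0.
  - apply: emeasurable_funD; last exact: mpsi.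
    by apply/measurable_EFinP; apply: measurable_funM => //; exact: measurableT_comp.
  apply: filterS Tfc => x Tfc _; rewrite -EFinD lee_fin -(real_normK (num_real (T f x))).
  by apply: layer_sum_ge => //; exact: le_trans Tfc _.
apply: le_trans step1 _; rewrite ge0_integralD //.
- rewrite addeC; apply: leeD.
    apply: (@le_trans _ _ (\int[mu]_x (psi f x)%:E)%E).
      rewrite /psi !int_layer_sum //; apply: lee_sum => j _.
      rewrite lee_pmul2l // ?lte_fin ?mulr_gt0 //.
      by apply: T_excess => //; rewrite mulr_ge0.
    apply: ge0_le_integral => //.
    + by move=> x _; rewrite lee_fin.
    + exact: mpsi.
    + exact: measurable_sqE.
    + move=> x _; rewrite lee_fin -(real_normK (num_real (f x))).
      exact: layer_sum_le.
  rewrite (_ : (\int[mu]_x _)%E = ((2 * t)%:E * norm1 mu (T f))%E); last first.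
    rewrite -ge0_integralZl_EFin //.
    + exact: measurable_normE.
    + by rewrite mulr_ge0.
  apply: (@le_trans _ _ ((2 * t)%:E * norm1 mu f)%E).
    by rewrite lee_pmul2l ?lte_fin ?mulr_gt0 //; exact: T_norm1.
  by rewrite -(fineK nffin) -EFinM lee_fin.
- by move=> x _; rewrite lee_fin mulr_ge0 // mulr_ge0.
- by apply/measurable_EFinP; apply: measurable_funM => //; exact: measurableT_comp.
- by move=> x _; rewrite lee_fin.
- exact: mpsi.
Qed.

(** The weak type (1,1) inequality is applied to the excess of f over a, which is at most f^2 / a.
    The truncated part adds C a to each average, whence the factor 2. *)
Lemma maximal_ineq_sqn f a : L1 mu f -> 0 < a -> exists B : set Omega,
  [/\ measurable B, (mu B <= (a ^+ 2)^-1%:E * sqn f)%E &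
   forall (b : nat -> R) (C : R), (forall k, `|b k| <= C) ->
   {ae mu, forall x, ~ B x -> forall n,
     `|\sum_(k < n) b k * iter k T f x| <= n%:R * (2 * C * a)}].
Proof.
move=> f1 a0; have [c1 c2 g1] := clamp_L1 (ltW a0) f1; have [mf _] := f1.
have [B [mB muB HB]] := maximal_ineq mu_gt0 DS g1 a0.
exists B; split => //.
  apply: le_trans muB _.
  rewrite expr2 invfM EFinM -muleA lee_pmul2l // ?lte_fin ?invr_gt0 //.
  rewrite /sqn -ge0_integralZl_EFin //; do ?exact: measurable_sqE;
    do ?[by move=> x _; rewrite lee_fin sqr_ge0]; last by rewrite invr_ge0 ltW.
  apply: ge0_le_integral => //.
  - by apply: measurable_normE; case: g1.
  - apply/measurable_EFinP; apply: measurable_funM => //.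
    exact: measurable_funX.
  move=> x _; rewrite -EFinM lee_fin (clamp_rest _ (ltW a0)) ler_pdivlMl //.
  rewrite -(real_normK (num_real (f x))); have := normr_ge0 (f x).
  by case: (leP 0 (`|f x| - a)) => ? ?; nra.
move=> b C bC; have C0 : 0 <= C by exact: le_trans (bC 0).
have H1 := HB b C bC.
have H2 : {ae mu, forall x, forall k, `|iter k T (fun x => clamp a (f x)) x| <= a}.
  by apply: ae_foralln => k; have [] := iter_Loo mu_gt0 DS k c2.
have H3 := ae_foralln (fun k => T_clamp k (ltW a0) f1).
apply: filterS3 H1 H2 H3 => x H1 H2 H3 nB n.
under eq_bigr do rewrite H3 mulrDr.
rewrite big_split /= (le_trans (ler_normD _ _)) //.
rewrite (_ : n%:R * (2 * C * a) = n%:R * (C * a) + n%:R * (C * a)); last by ring.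
apply: lerD; first exact: H1.
apply: le_trans (ler_norm_sum _ _ _) _.
apply: (@le_trans _ _ (\sum_(i < n) C * a)).
  by apply: ler_sum => k _; rewrite normrM ler_pM.
by rewrite sumr_const card_ord mulr_natl.
Qed.

End L2.

(** * The mean ergodic theorem *)

Section MeanErgodic.
Context (R : realType) (F : numFieldType) (V : lmodType F) (N : V -> R).
Context (N_D : forall u v, N (u + v) <= N u + N v).
Context (N_N : forall v, N (- v) = N v).
Context (N_inv : forall n v, N (n%:R^-1 *: v) = n%:R^-1 * N v).
Context (S : V -> V).
Context (S_D : forall u v, S (u + v) = S u + S v).
Context (S_inv : forall n v, S (n%:R^-1 *: v) = n%:R^-1 *: S v).
Context (S_le : forall v, N (S v) <= N v).

(** The setting is abstract because it is used with two norms on polynomials: the L2 norm of p(T) f,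
    and the l1 norm of the coefficients, for which the parallelogram law [N_par] fails. Homogeneity
    is asked only for the scalars 1/n. *)
Definition avg (n : nat) (v : V) : V := n%:R^-1 *: \sum_(k < n) iter k S v.

(** The case n = 0 of [N_inv], where 0^-1 = 0. *)
Let N0 : N 0 = 0.
Proof. by have := N_inv 0 0; rewrite !invr0 scale0r mul0r. Qed.

Let N_ge0 v : 0 <= N v.
Proof.
have : N 0 <= N v + N v by rewrite -{2}(N_N v) -(subrr v) N_D.
by rewrite N0 -mulr2n pmulrn_lge0.
Qed.

Let N_sum n (G : 'I_n -> V) : N (\sum_i G i) <= \sum_i N (G i).
Proof.
elim/big_ind2 : _ => //; first by rewrite N0.
by move=> u a v b ua vb; apply: le_trans (N_D _ _) (lerD ua vb).
Qed.

Let S0 : S 0 = 0.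
Proof. by have := S_inv 0 0; rewrite invr0 !scale0r. Qed.

Let S_sum n (G : 'I_n -> V) : S (\sum_i G i) = \sum_i S (G i).
Proof. exact: (big_morph S S_D S0). Qed.

Let iter_D k u v : iter k S (u + v) = iter k S u + iter k S v.
Proof. by elim: k => //= k ->. Qed.

Let iter_inv k n v : iter k S (n%:R^-1 *: v) = n%:R^-1 *: iter k S v.
Proof. by elim: k => //= k ->. Qed.

Let iter_sumV k n (G : 'I_n -> V) : iter k S (\sum_i G i) = \sum_i iter k S (G i).
Proof. by elim: k => //= k ->; rewrite S_sum. Qed.

Let iter_le k v : N (iter k S v) <= N v.
Proof. by elim: k => //= k; apply: le_trans; exact: S_le. Qed.

Lemma avgD n u v : avg n (u + v) = avg n u + avg n v.
Proof.
rewrite /avg -scalerDr -big_split /=; congr (_ *: _).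
by apply: eq_bigr => k _; rewrite iter_D.
Qed.

Lemma avg_inv n m v : avg n (m%:R^-1 *: v) = m%:R^-1 *: avg n v.
Proof.
rewrite /avg scalerA mulrC -scalerA; congr (_ *: _).
by rewrite scaler_sumr; apply: eq_bigr => k _; rewrite iter_inv.
Qed.

Lemma avg_le n v : N (avg n v) <= N v.
Proof.
rewrite /avg N_inv; case: n => [|n]; first by rewrite invr0 mul0r.
rewrite ler_pdivrMl //; apply: le_trans (N_sum _) _.
apply: (@le_trans _ _ (\sum_(i < n.+1) N v)); first exact: ler_sum.
by rewrite sumr_const card_ord mulr_natl.
Qed.

Lemma avgE n v k : avg n (iter k S v) = n%:R^-1 *: \sum_(j < n) iter (j + k) S v.
Proof. by rewrite /avg; under eq_bigr do rewrite -iterD. Qed.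

Lemma avg_avgE m n v : avg m (avg n v) =
  n%:R^-1 *: \sum_(k < n) avg m (iter k S v).
Proof.
rewrite {2}/avg avg_inv; congr (_ *: _).
rewrite /avg -scaler_sumr; congr (_ *: _).
by rewrite exchange_big; apply: eq_bigr => k _; rewrite iter_sumV.
Qed.

Lemma avgC m n v : avg m (avg n v) = avg n (avg m v).
Proof.
rewrite avg_avgE [RHS]/avg; congr (_ *: _).
apply: eq_bigr => k _; rewrite [avg m v]/avg iter_inv iter_sumV /avg.
by congr (_ *: _); apply: eq_bigr => j _; rewrite -!iterD addnC.
Qed.

(** Applying S once more shifts the sum, which telescopes to its two end terms. *)
Lemma avg_shift m k v :
  N (avg m (iter k S v) - avg m v) <= m%:R^-1 * (2 * k%:R * N v).
Proof.
elim: k => [|k IH]; first by rewrite subrr N0 mulr0 mul0r mulr0.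
rewrite -(subrKA (avg m (iter k S v))) (le_trans (N_D _ _)) //.
rewrite -(natr1 k) mulrDr mulr1 mulrDl mulrDr addrC lerD //.
rewrite !avgE -scalerBr N_inv ler_wpM2l ?invr_ge0 //.
have -> : \sum_(j < m) iter (j + k.+1) S v - \sum_(j < m) iter (j + k) S v =
   iter (m + k) S v - iter k S v.
  clear IH; elim: m => [|m IHm]; first by rewrite !big_ord0 add0n !subrr.
  by rewrite !big_ord_recr /= opprD addrACA IHm addnS /= addrC subrKA.
rewrite (le_trans (N_D _ _)) // N_N mulr_natl mulr2n lerD //.
Qed.

(** For fixed n and large m, averaging over n first changes little: the average over n is a mean of
    iterates, each controlled by [avg_shift]. *)
Lemma avg_avg m n v : (0 < n)%N ->
  N (avg m (avg n v) - avg m v) <= m%:R^-1 * (2 * n%:R * N v).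
Proof.
move=> n0; have n0' : (n%:R : F) != 0 by rewrite pnatr_eq0 -lt0n.
have -> : avg m (avg n v) - avg m v =
    n%:R^-1 *: \sum_(k < n) (avg m (iter k S v) - avg m v).
  rewrite avg_avgE sumrB scalerBr; congr (_ - _).
  by rewrite sumr_const card_ord -[avg m v *+ n]scaler_nat scalerA mulVf // scale1r.
rewrite N_inv ler_pdivrMl ?ltr0n // (le_trans (N_sum _)) //.
apply: (@le_trans _ _ (\sum_(k < n) m%:R^-1 * (2 * n%:R * N v))); last first.
  by rewrite sumr_const card_ord -[leLHS]mulr_natl.
apply: ler_sum => k _; apply: le_trans (avg_shift _ _ _) _.
rewrite ler_wpM2l ?invr_ge0 // ler_wpM2r // ler_wpM2l // ler_nat.
exact: ltnW.
Qed.

Lemma divn_small (C e : R) : 0 < e ->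
  exists M : nat, forall m, (M <= m)%N -> m%:R^-1 * C <= e.
Proof.
move=> e0; exists (Num.bound (C / e)).+1 => m Mm.
have m0 : 0 < m%:R :> R by rewrite ltr0n (leq_trans _ Mm).
rewrite ler_pdivrMl // -ler_pdivrMr //.
apply: (@le_trans _ _ (Num.bound (C / e))%:R); last by rewrite ler_nat ltnW.
case: (leP 0 (C / e)) => h; first exact/ltW/archi_boundP.
by rewrite (le_trans (ltW h)).
Qed.

Context (N_par : forall u v,
  N (u + v) ^+ 2 + N (u - v) ^+ 2 = 2 * N u ^+ 2 + 2 * N v ^+ 2).

(* F. Riesz: the norms of the averages approach their infimum c, and no
   midpoint of two averages has norm below c; conclude by the parallelogram
   law. *)
Lemma avg_cauchy v (e : R) : 0 < e ->
  exists M : nat, forall m n, (M <= m)%N -> (M <= n)%N ->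
    N (avg m v - avg n v) <= e.
Proof.
(* The index starts at 1: the average of length 0 is 0 and would spoil the infimum. *)
move=> e0; pose A := [set N (avg n.+1 v) | n in [set: nat]].
have hA : has_inf A.
  split; first by exists (N (avg 1 v)); exists 0.
  by exists 0 => _ [n _ <-].
pose c := inf A.
have c_le n : (0 < n)%N -> c <= N (avg n v).
  by case: n => // n _; apply: ge_inf; [case: hA|exists n].
have c0 : 0 <= c by apply: lb_le_inf; [case: hA|move=> _ [n _ <-]].
(* The left-hand side is 4 (c + 2 t)^2 - (2 c)^2, the bound that the parallelogram law gives for the
   squared distance of two averages of norm at most c + 2 t whose sum has norm at least 2 c. *)
have [t t0 te] : exists2 t, 0 < t & 16 * c * t + 16 * t ^+ 2 <= e ^+ 2.
  pose t := Num.min 1 (e ^+ 2 / (16 * (c + 1))).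
  have D0 : 0 < 16 * (c + 1) by rewrite mulr_gt0 // ltr_wpDl.
  have t0 : 0 < t by rewrite lt_min ltr01 divr_gt0 // exprn_gt0.
  exists t => //.
  have : t <= 1 by rewrite ge_min lexx.
  have : t <= e ^+ 2 / (16 * (c + 1)) by rewrite ge_min lexx orbT.
  rewrite ler_pdivlMr //; nra.
have [n0 n00 Hn0] : exists2 n0, (0 < n0)%N & N (avg n0 v) < c + t.
  have [_ [n _ <-] ?] := inf_adherent t0 hA.
  by exists n.+1.
have [M HM] := divn_small (2 * n0%:R * N v) t0.
(* One t comes from the choice of n0, the other from [avg_avg]. *)
have Hup m : (M <= m)%N -> N (avg m v) <= c + 2 * t.
  move=> Mm; have := avg_avg m v n00; have := HM m Mm.
  have := avg_le m (avg n0 v).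
  have : N (avg m v) <= N (avg m (avg n0 v)) + N (avg m (avg n0 v) - avg m v).
    by rewrite -{1}(subKr (avg m (avg n0 v)) (avg m v)) (le_trans (N_D _ _)) // N_N.
  lra.
exists (maxn M 1) => m n; rewrite !geq_max => /andP[Mm m0] /andP[Mn nn0].
set u := avg m v; set w := avg n v.
(* A long average of the midpoint g is close to the same average of v, whose norm is at least c;
   averaging does not increase the norm of g. *)
have mid : 2 * c <= N (u + w).
  have half x : N x = 2 * N (2%:R^-1 *: x) by rewrite N_inv; field.
  rewrite half ler_pM2l //; set g := _ *: _.
  apply/ler_addgt0Pr => s s0.
  have [K HK] := divn_small (2 * m%:R * N v + 2 * n%:R * N v) s0.
  have gE : avg K.+1 g - avg K.+1 v = 2%:R^-1 *:
      ((avg K.+1 u - avg K.+1 v) + (avg K.+1 w - avg K.+1 v)).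
    rewrite /g avg_inv avgD addrACA [in RHS]scalerDr; congr (_ + _).
    rewrite -opprD -mulr2n -[X in _ = _ *: - X]scaler_nat scalerN scalerA mulVf //.
    by rewrite scale1r.
  have := avg_avg K.+1 v m0; have := avg_avg K.+1 v nn0.
  have := HK _ (leqnSn K); rewrite mulrDr.
  have : N (avg K.+1 g - avg K.+1 v) <= 2^-1 *
      (N (avg K.+1 u - avg K.+1 v) + N (avg K.+1 w - avg K.+1 v)).
    by rewrite gE N_inv ler_pM2l ?invr_gt0.
  have : N (avg K.+1 v) <= N (avg K.+1 g) + N (avg K.+1 g - avg K.+1 v).
    by rewrite -{1}(subKr (avg K.+1 g) (avg K.+1 v)) (le_trans (N_D _ _)) // N_N.
  have := avg_le K.+1 g; have := c_le K.+1 isT.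
  rewrite -/u -/w; set x1 := N (avg _ u - _); set x2 := N (avg _ w - _).
  have : 0 <= x1 by exact: N_ge0.
  have : 0 <= x2 by exact: N_ge0.
  move: x1 x2 (_ * (2 * m%:R * _)) (_ * (2 * n%:R * _)) => x1 x2 A1 A2.
  lra.
have := N_par u w; have := Hup m Mm; have := Hup n Mn; rewrite -/u -/w.
have := N_ge0 u; have := N_ge0 w; have := N_ge0 (u - w); have := N_ge0 (u + w).
move: (N (u + w)) (N (u - w)) (N u) (N w) mid => p q a b mid p0 q0 b0 a0 bc ac par.
have e0' := ltW e0.
rewrite -(@ler_pXn2r _ 2) ?nnegrE //.
apply: le_trans te.
have -> : q ^+ 2 = 2 * a ^+ 2 + 2 * b ^+ 2 - p ^+ 2 by rewrite -par; ring.
have : a ^+ 2 <= (c + 2 * t) ^+ 2 by rewrite ler_pXn2r // nnegrE addr_ge0 // mulr_ge0 // ltW.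
have : b ^+ 2 <= (c + 2 * t) ^+ 2 by rewrite ler_pXn2r // nnegrE addr_ge0 // mulr_ge0 // ltW.
have : (2 * c) ^+ 2 <= p ^+ 2 by rewrite ler_pXn2r // nnegrE mulr_ge0.
rewrite !expr2; lra.
Qed.

End MeanErgodic.

(** * Complex numbers through real and imaginary parts *)

Section ComplexModulus.
Context (R : realType).
Implicit Types z w : R[i].
Local Notation normc := (@ComplexField.Normc.normc R).
Local Notation Re := (@complex.Re R).
Local Notation Im := (@complex.Im R).

Lemma cReD z w : Re (z + w) = Re z + Re w. Proof. by case: z; case: w. Qed.
Lemma cImD z w : Im (z + w) = Im z + Im w. Proof. by case: z; case: w. Qed.
Lemma cReN z : Re (- z) = - Re z. Proof. by case: z. Qed.
Lemma cImN z : Im (- z) = - Im z. Proof. by case: z. Qed.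
Lemma cReM z w : Re (z * w) = Re z * Re w - Im z * Im w.
Proof. by case: z; case: w. Qed.
Lemma cImM z w : Im (z * w) = Re z * Im w + Im z * Re w.
Proof. by case: z; case: w. Qed.

Lemma cReB z w : Re (z - w) = Re z - Re w. Proof. by rewrite cReD cReN. Qed.
Lemma cImB z w : Im (z - w) = Im z - Im w. Proof. by rewrite cImD cImN. Qed.

Lemma cReMr z (r : R) : Re (z * real_complex R r) = Re z * r.
Proof. by rewrite cReM /= mulr0 subr0. Qed.
Lemma cImMr z (r : R) : Im (z * real_complex R r) = Im z * r.
Proof. by rewrite cImM /= mulr0 add0r. Qed.

Lemma eqComplex z (a b : R) : Re z = a -> Im z = b -> z = Complex a b.
Proof. by case: z => x y /= -> ->. Qed.

Lemma Re_sum n (G : 'I_n -> R[i]) : Re (\sum_i G i) = \sum_i Re (G i).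
Proof. by apply: big_morph => //; exact: cReD. Qed.
Lemma Im_sum n (G : 'I_n -> R[i]) : Im (\sum_i G i) = \sum_i Im (G i).
Proof. by apply: big_morph => //; exact: cImD. Qed.

Lemma invnatCE n : n%:R^-1 = real_complex R n%:R^-1.
Proof. by rewrite fmorphV rmorph_nat. Qed.

Lemma sqr_normcE z : normc z ^+ 2 = Re z ^+ 2 + Im z ^+ 2.
Proof. by case: z => a b /=; rewrite sqr_sqrtr // addr_ge0 // sqr_ge0. Qed.

Lemma normc_ge0 z : 0 <= normc z.
Proof. by case: z => a b; exact: sqrtr_ge0. Qed.

Lemma Re_le_normc z : `|Re z| <= normc z.
Proof.
by case: z => a b /=; rewrite -sqrtr_sqr ler_wsqrtr // lerDl sqr_ge0.
Qed.

Lemma Im_le_normc z : `|Im z| <= normc z.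
Proof.
by case: z => a b /=; rewrite -sqrtr_sqr ler_wsqrtr // lerDr sqr_ge0.
Qed.

Lemma normc_real (r : R) : normc (real_complex R r) = `|r|.
Proof. by rewrite /= expr0n addr0 sqrtr_sqr. Qed.

Lemma normcD z w : normc (z + w) <= normc z + normc w.
Proof. exact: le_normcD. Qed.

Lemma normcNE z : normc (- z) = normc z.
Proof. exact: normcN. Qed.

Lemma normcME z w : normc (z * w) = normc z * normc w.
Proof. exact: ComplexField.Normc.normcM. Qed.

Lemma normc0E : normc 0 = 0.
Proof. exact: ComplexField.Normc.normc0. Qed.

Lemma normcB z w : normc (z - w) = normc (w - z).
Proof. by rewrite -normcNE opprB. Qed.

Lemma normc_sum n (G : 'I_n -> R[i]) : normc (\sum_i G i) <= \sum_i normc (G i).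
Proof.
elim/big_ind2 : _ => //; first by rewrite normc0E.
by move=> u a v b ua vb; apply: le_trans (normcD _ _) (lerD ua vb).
Qed.

Lemma normc_invnat n z : normc (n%:R^-1 * z) = n%:R^-1 * normc z.
Proof. by rewrite invnatCE normcME normc_real ger0_norm // invr_ge0. Qed.

Lemma normc_le_ReIm z : normc z <= `|Re z| + `|Im z|.
Proof.
rewrite -(@ler_pXn2r _ 2) ?nnegrE ?normc_ge0 ?addr_ge0 // sqr_normcE sqrrD.
rewrite !real_normK ?num_real // -addrA lerD2l lerDr.
by rewrite mulrn_wge0 // mulr_ge0.
Qed.

(** The oscillation bound is kept apart for each e so that exceptional sets may depend on e in
    [ae_cauchy]. *)
Definition osc_le (s : nat -> R[i]) (e : R) : Prop :=
  exists M : nat, forall m n, (M <= m)%N -> (M <= n)%N -> normc (s m - s n) <= e.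

Definition cauchy_at (s : nat -> R[i]) : Prop :=
  forall e : R, 0 < e -> osc_le s e.

End ComplexModulus.

Section AeCauchy.
Context (d : measure_display) (Omega : measurableType d) (R : realType).
Context (mu : {measure set Omega -> \bar R}).

(** Sets D of measure at most 1/(j+1) are intersected: the intersection is null, and a point outside
    it is outside some D. *)
Lemma ae_off_small (P : Omega -> Prop) :
  (forall e : R, 0 < e -> exists D : set Omega, [/\ measurable D,
     (mu D <= e%:E)%E & {ae mu, forall x, ~ D x -> P x}]) ->
  {ae mu, forall x, P x}.
Proof.
move=> H; have /choice [D HD] : forall j : nat, exists D : set Omega,
    [/\ measurable D, (mu D <= (j.+1%:R^-1)%:E)%E &
        {ae mu, forall x, ~ D x -> P x}].
  by move=> j; apply: H; rewrite invr_gt0.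
have mD j : measurable (D j) by case: (HD j).
have mI : measurable (\bigcap_j D j) by exact: bigcap_measurableType.
have I0 : mu (\bigcap_j D j) = 0%E.
  apply/eqP; rewrite eq_le measure_ge0 andbT.
  apply/lee_addgt0Pr => e e0; rewrite add0e.
  have [M HM] := divn_small 1 e0.
  have [_ DM _] := HD M.
  apply: (@le_trans _ _ (mu (D M))).
    by apply: le_measure; rewrite ?inE //; exact: bigcap_inf.
  apply: le_trans DM _; rewrite lee_fin -[leLHS]mulr1; exact: HM.
have nI : {ae mu, forall x, ~ (\bigcap_j D j) x}.
  exists (\bigcap_j D j); split => // x /=.
  by apply: contra_notP => ?; apply/not_notP.
have HP : {ae mu, forall x, forall j, ~ D j x -> P x}.
  by apply: ae_foralln => j; have [] := HD j.
apply: filterS2 nI HP => x nI HP.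
by move: nI; rewrite /bigcap /= => /existsNP[j /not_implyP[_ /HP]].
Qed.

(** The form of the Banach principle in which the maximal inequalities are used; it suffices to let
    e run through the numbers 1/(i+1). *)
Lemma ae_cauchy (u : nat -> Omega -> R[i]) :
  (forall e t : R, 0 < e -> 0 < t -> exists D : set Omega, [/\ measurable D,
     (mu D <= t%:E)%E & {ae mu, forall x, ~ D x -> osc_le (u ^~ x) e}]) ->
  {ae mu, forall x, cauchy_at (u ^~ x)}.
Proof.
move=> H.
have : {ae mu, forall x, forall i : nat, osc_le (u ^~ x) i.+1%:R^-1}.
  apply: ae_foralln => i; apply: ae_off_small => e e0.
  by apply: H => //; rewrite invr_gt0.
apply: filterS => x Hx e e0.
have [i Hi] := divn_small 1 e0.
have [M HM] := Hx i; exists M => m n Mm Mn.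
by apply: le_trans (HM m n Mm Mn) _; rewrite -[leLHS]mulr1; exact: Hi.
Qed.

End AeCauchy.

(** * Operator polynomials *)

Section SquareNorm.
Context (d : measure_display) (Omega : measurableType d) (R : realType).
Context (mu : {measure set Omega -> \bar R}).
Implicit Types f g : Omega -> R.

Lemma sqn_ge0 f : (0 <= sqn mu f)%E.
Proof. by apply: integral_ge0 => x _; rewrite lee_fin sqr_ge0. Qed.

Lemma sqn_fin f c : L1 mu f -> Loo mu c f -> (sqn mu f < +oo)%E.
Proof.
move=> [mf f1] [_ fc].
apply: (@le_lt_trans _ _ (`|c|%:E * norm1 mu f)%E).
  rewrite -norm1Z //; apply: ae_ge0_le_integral => //.
  - by move=> x _; rewrite lee_fin sqr_ge0.
  - exact: measurable_sqE.
  - by apply: measurable_normE; exact: measurable_funM.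
  apply: filterS fc => x fc _; rewrite lee_fin normrM.
  rewrite -(real_normK (num_real (f x))) expr2 ler_wpM2r //.
  exact: le_trans fc (ler_norm _).
by apply: lte_mul_pinfty; rewrite ?lee_fin.
Qed.

Lemma sqn_par f g : measurable_fun setT f -> measurable_fun setT g ->
  (sqn mu (fun x => f x + g x)%R + sqn mu (fun x => f x - g x)%R =
   2%:E * sqn mu f + 2%:E * sqn mu g)%E.
Proof.
move=> mf mg.
have mfg : measurable_fun setT (fun x => f x + g x) by exact: measurable_funD.
have mfg' : measurable_fun setT (fun x => f x - g x) by exact: measurable_funB.
rewrite /sqn -!ge0_integralZl_EFin //; do ?exact: measurable_sqE;
  do ?[by move=> x _; rewrite lee_fin sqr_ge0].
rewrite -!ge0_integralD //; do ?exact: measurable_sqE;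
  do ?[by move=> x _; rewrite lee_fin sqr_ge0];
  do ?[by move=> x _; rewrite -EFinM lee_fin mulr_ge0 // sqr_ge0];
  do ?[by apply/measurable_EFinP; apply: measurable_funM => //; exact: measurable_funX].
by apply: eq_integral => x _; rewrite -!EFinM -!EFinD; congr (_%:E); ring.
Qed.

Lemma sqnZ a f : measurable_fun setT f ->
  sqn mu (fun x => a * f x) = ((a ^+ 2)%:E * sqn mu f)%E.
Proof.
move=> mf; rewrite /sqn -ge0_integralZl_EFin ?sqr_ge0 //;
  do ?exact: measurable_sqE; do ?[by move=> x _; rewrite lee_fin sqr_ge0].
by apply: eq_integral => x _; rewrite exprMn.
Qed.

(** Young's inequality 2 f g <= t f^2 + g^2 / t, integrated. It serves as the triangle inequality in
    L2 once t is optimized in [sqrt_triangle]. *)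
Lemma sqnD_le t f g : 0 < t -> measurable_fun setT f -> measurable_fun setT g ->
  (sqn mu (fun x => f x + g x)%R <=
   (1 + t)%:E * sqn mu f + (1 + t^-1)%:E * sqn mu g)%E.
Proof.
move=> t0 mf mg.
have t1 : 0 <= 1 + t by rewrite addr_ge0 // ltW.
have t2 : 0 <= 1 + t^-1 by rewrite addr_ge0 // invr_ge0 ltW.
have mfg : measurable_fun setT (fun x => f x + g x) by exact: measurable_funD.
rewrite /sqn -!ge0_integralZl_EFin //; do ?exact: measurable_sqE;
  do ?[by move=> x _; rewrite lee_fin sqr_ge0].
rewrite -!ge0_integralD //;
  do ?[by move=> x _; rewrite -EFinM lee_fin mulr_ge0 // sqr_ge0];
  do ?[by apply/measurable_EFinP; apply: measurable_funM => //; exact: measurable_funX].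
apply: ge0_le_integral => //; do ?exact: measurable_sqE;
  do ?[by move=> x _; rewrite lee_fin sqr_ge0].
  by apply: emeasurable_funD; apply/measurable_EFinP; apply: measurable_funM => //;
    exact: measurable_funX.
move=> x _; rewrite -!EFinM -!EFinD lee_fin.
rewrite -subr_ge0 (_ : _ - _ = t * (f x - t^-1 * g x) ^+ 2); last first.
  by field; rewrite gt_eqF.
by rewrite mulr_ge0 ?sqr_ge0 // ltW.
Qed.

End SquareNorm.

Lemma sqrt_triangle (R : realType) (q a b : R) : 0 <= a -> 0 <= b ->
  (forall t, 0 < t -> q <= (1 + t) * a + (1 + t^-1) * b) ->
  Num.sqrt q <= Num.sqrt a + Num.sqrt b.
Proof.
move=> a0 b0 H; apply/ler_addgt0Pr => e e0.
have s0 := sqrtr_ge0 a; have s0' := sqrtr_ge0 b.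
(* The optimal parameter is the ratio of the two roots; adding e/2 keeps both positive, and t = v /
   u turns the bound into (u + v)^2. *)
pose u := Num.sqrt a + e / 2; pose v := Num.sqrt b + e / 2.
have e20 : 0 < e / 2 by rewrite divr_gt0.
have u0 : 0 < u by rewrite ltr_wpDl.
have v0 : 0 < v by rewrite ltr_wpDl.
rewrite (_ : _ + _ + e = u + v); last by rewrite /u /v; field.
have uv0 : 0 <= u + v by rewrite addr_ge0 // ltW.
rewrite -[leRHS]ger0_norm // -sqrtr_sqr ler_wsqrtr //.
apply: le_trans (H (v / u) _) _; first by rewrite divr_gt0.
have au : a <= u ^+ 2.
  rewrite -{1}(sqr_sqrtr a0) ler_pXn2r ?nnegrE ?(ltW u0) //.
  by rewrite lerDl ltW.
have bv : b <= v ^+ 2.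
  rewrite -{1}(sqr_sqrtr b0) ler_pXn2r ?nnegrE ?(ltW v0) //.
  by rewrite lerDl ltW.
have -> : (u + v) ^+ 2 = (1 + v / u) * u ^+ 2 + (1 + (v / u)^-1) * v ^+ 2.
  by field; rewrite !gt_eqF.
by apply: lerD; rewrite ler_pM2l // addr_gt0 // ?invr_gt0 divr_gt0.
Qed.

Section OperatorPolynomials.
Context (d : measure_display) (Omega : measurableType d) (R : realType).
Context (mu : {measure set Omega -> \bar R}).
Context (mu_gt0 : (0 < mu [set: Omega])%E).
Context (T : (Omega -> R) -> Omega -> R).
Context (DS : dunford_schwartz mu (real_complex R) T).
Context (f : Omega -> R) (c : R) (f1 : L1 mu f) (fc : Loo mu c f).
Implicit Types p q : {poly R[i]}.
Local Notation normc := (@ComplexField.Normc.normc R).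
Local Notation Re := (@complex.Re R).
Local Notation Im := (@complex.Im R).
Local Notation toC := (real_complex R).

(* [cev p] is [p(T) f], a combination of the chosen representatives of the
   iterates: it is linear in [p] pointwise, not only almost everywhere. *)
Definition cev p (x : Omega) : R[i] :=
  \sum_(k < size p) p`_k * toC (iter k T f x).

Lemma cev_wide n p x : (size p <= n)%N ->
  cev p x = \sum_(k < n) p`_k * toC (iter k T f x).
Proof.
move=> pn; rewrite /cev (big_ord_widen n (fun k => p`_k * toC (iter k T f x))) //.
rewrite big_mkcond /=; apply: eq_bigr => k _; case: ltnP => // kp.
by rewrite nth_default // mul0r.
Qed.

Lemma cevD p q x : cev (p + q) x = cev p x + cev q x.
Proof.
have pn := leq_maxl (size p) (size q); have qn := leq_maxr (size p) (size q).
rewrite (cev_wide _ pn) (cev_wide _ qn) (cev_wide _ (size_polyD p q)).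
by rewrite -big_split; apply: eq_bigr => k _; rewrite coefD mulrDl.
Qed.

Lemma cevZ a p x : cev (a *: p) x = a * cev p x.
Proof.
rewrite (cev_wide _ (size_scale_leq a p)) mulr_sumr.
by apply: eq_bigr => k _; rewrite coefZ mulrA.
Qed.

Lemma cevN p x : cev (- p) x = - cev p x.
Proof. by rewrite -scaleN1r cevZ mulN1r. Qed.

Lemma cevB p q x : cev (p - q) x = cev p x - cev q x.
Proof. by rewrite cevD cevN. Qed.

Lemma cev0 x : cev 0 x = 0.
Proof. by rewrite /cev size_poly0 big_ord0. Qed.

Lemma cev_sum n (G : 'I_n -> {poly R[i]}) x :
  cev (\sum_i G i) x = \sum_i cev (G i) x.
Proof. by apply: (big_morph (fun p => cev p x)); [move=> p q; exact: cevD|exact: cev0]. Qed.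

Lemma cevXn n x : cev 'X^n x = toC (iter n T f x).
Proof.
rewrite /cev size_polyXn big_ord_recr /= coefXn eqxx mul1r big1 ?add0r // => k _.
by rewrite coefXn ltn_eqF // mul0r.
Qed.

Lemma Re_cev n p : (size p <= n)%N ->
  (fun x => Re (cev p x)) = (fun x => \sum_(k < n) Re p`_k * iter k T f x).
Proof.
move=> pn; apply/funext => x; rewrite (cev_wide _ pn) Re_sum.
by apply: eq_bigr => k _; rewrite cReMr.
Qed.

Lemma Im_cev n p : (size p <= n)%N ->
  (fun x => Im (cev p x)) = (fun x => \sum_(k < n) Im p`_k * iter k T f x).
Proof.
move=> pn; apply/funext => x; rewrite (cev_wide _ pn) Im_sum.
by apply: eq_bigr => k _; rewrite cImMr.
Qed.

Let comb_L1_Loo n (a : nat -> R) :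
  L1 mu (fun x => \sum_(k < n) a k * iter k T f x) /\
  exists b, Loo mu b (fun x => \sum_(k < n) a k * iter k T f x).
Proof.
elim: n => [|n [H1 [b Hb]]].
  rewrite (_ : (fun _ => _) = fun=> 0); last first.
    by apply/funext => x; rewrite big_ord0.
  by split; [exact: L1_0|exists 0; exact: Loo_0].
rewrite (_ : (fun _ => _) =
  fun x => a n * iter n T f x + \sum_(k < n) a k * iter k T f x); last first.
  by apply/funext => x; rewrite big_ord_recr /= addrC.
split; first by apply: L1_lin => //; exact: (iter_L1 mu_gt0 DS).
exists (`|a n| * c + b); apply: Loo_lin => //.
exact: (iter_Loo mu_gt0 DS).
Qed.

Lemma Re_cev_L1 p : L1 mu (fun x => Re (cev p x)).
Proof. by rewrite (Re_cev (leqnn _)); case: (comb_L1_Loo (size p) (fun k => Re p`_k)). Qed.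

Lemma Im_cev_L1 p : L1 mu (fun x => Im (cev p x)).
Proof. by rewrite (Im_cev (leqnn _)); case: (comb_L1_Loo (size p) (fun k => Im p`_k)). Qed.

Lemma Re_cev_Loo p : exists b, Loo mu b (fun x => Re (cev p x)).
Proof. by rewrite (Re_cev (leqnn _)); case: (comb_L1_Loo (size p) (fun k => Re p`_k)). Qed.

Lemma Im_cev_Loo p : exists b, Loo mu b (fun x => Im (cev p x)).
Proof. by rewrite (Im_cev (leqnn _)); case: (comb_L1_Loo (size p) (fun k => Im p`_k)). Qed.

Lemma cev_iter j p : {ae mu, forall x, cev ('X^j * p) x =
  Complex (iter j T (fun y => Re (cev p y)) x) (iter j T (fun y => Im (cev p y)) x)}.
Proof.
have FL k : L1Loo mu (iter k T f) by apply: (iter_L1Loo mu_gt0 DS); exact: L1_L1Loo.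
rewrite (Re_cev (leqnn _)) (Im_cev (leqnn _)).
have H1 := iter_sum mu_gt0 DS j (size p) (fun k => Re p`_k) FL.
have H2 := iter_sum mu_gt0 DS j (size p) (fun k => Im p`_k) FL.
apply: filterS2 H1 H2 => x -> ->.
have sz : (size ('X^j * p)%R <= j + size p)%N.
  by rewrite (leq_trans (size_polyMleq _ _)) // size_polyXn addSn.
rewrite (cev_wide _ sz) big_split_ord /= big1 ?add0r; last first.
  by move=> k _; rewrite coefXnM ltn_ord mul0r.
transitivity (\sum_(k < size p) p`_k * toC (iter j T (iter k T f) x)).
  apply: eq_bigr => k _; rewrite coefXnM ltnNge leq_addr /= addKn.
  by rewrite -iterD.
apply: eqComplex.
- by rewrite Re_sum; apply: eq_bigr => k _; rewrite cReMr.
- by rewrite Im_sum; apply: eq_bigr => k _; rewrite cImMr.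
Qed.

Definition cevQ p : \bar R :=
  (sqn mu (fun x => Re (cev p x)) + sqn mu (fun x => Im (cev p x)))%E.

Let mRe p : measurable_fun setT (fun x => Re (cev p x)).
Proof. by case: (Re_cev_L1 p). Qed.
Let mIm p : measurable_fun setT (fun x => Im (cev p x)).
Proof. by case: (Im_cev_L1 p). Qed.

Lemma cevQ_ge0 p : (0 <= cevQ p)%E.
Proof. by rewrite adde_ge0 // sqn_ge0. Qed.

Lemma cevQ_fin p : cevQ p \is a fin_num.
Proof.
rewrite ge0_fin_numE ?cevQ_ge0 // lte_add_pinfty //.
  by have [b Hb] := Re_cev_Loo p; apply: sqn_fin Hb; exact: Re_cev_L1.
by have [b Hb] := Im_cev_Loo p; apply: sqn_fin Hb; exact: Im_cev_L1.
Qed.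

Lemma cevQ_par p q : (cevQ (p + q) + cevQ (p - q) = 2%:E * cevQ p + 2%:E * cevQ q)%E.
Proof.
have e1 : (fun x => Re (cev (p + q) x)) = fun x => Re (cev p x) + Re (cev q x).
  by apply/funext => x; rewrite cevD cReD.
have e2 : (fun x => Im (cev (p + q) x)) = fun x => Im (cev p x) + Im (cev q x).
  by apply/funext => x; rewrite cevD cImD.
have e3 : (fun x => Re (cev (p - q) x)) = fun x => Re (cev p x) - Re (cev q x).
  by apply/funext => x; rewrite cevB cReD cReN.
have e4 : (fun x => Im (cev (p - q) x)) = fun x => Im (cev p x) - Im (cev q x).
  by apply/funext => x; rewrite cevB cImD cImN.
rewrite /cevQ e1 e2 e3 e4 addeACA !sqn_par // addeACA.
by rewrite !(ge0_muleDr _ (sqn_ge0 mu _) (sqn_ge0 mu _)).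
Qed.

Lemma cevQ_D t p q : 0 < t ->
  (cevQ (p + q) <= (1 + t)%:E * cevQ p + (1 + t^-1)%:E * cevQ q)%E.
Proof.
move=> t0; rewrite /cevQ.
have e1 : (fun x => Re (cev (p + q) x)) = fun x => Re (cev p x) + Re (cev q x).
  by apply/funext => x; rewrite cevD cReD.
have e2 : (fun x => Im (cev (p + q) x)) = fun x => Im (cev p x) + Im (cev q x).
  by apply/funext => x; rewrite cevD cImD.
rewrite e1 e2 !(ge0_muleDr _ (sqn_ge0 mu _) (sqn_ge0 mu _)) [leRHS]addeACA.
by apply: leeD; exact: sqnD_le.
Qed.

Lemma cevQ_inv n p : cevQ (n%:R^-1 *: p) = ((n%:R^-1 ^+ 2)%:E * cevQ p)%E.
Proof.
rewrite /cevQ.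
have e1 : (fun x => Re (cev (n%:R^-1 *: p) x)) = fun x => n%:R^-1 * Re (cev p x).
  by apply/funext => x; rewrite cevZ invnatCE mulrC cReMr mulrC.
have e2 : (fun x => Im (cev (n%:R^-1 *: p) x)) = fun x => n%:R^-1 * Im (cev p x).
  by apply/funext => x; rewrite cevZ invnatCE mulrC cImMr mulrC.
by rewrite e1 e2 !sqnZ // (ge0_muleDr _ (sqn_ge0 mu _) (sqn_ge0 mu _)).
Qed.

Lemma cevQ_N p : cevQ (- p) = cevQ p.
Proof.
rewrite /cevQ /sqn; congr (_ + _)%E; apply: eq_integral => x _.
  by rewrite cevN cReN sqrrN.
by rewrite cevN cImN sqrrN.
Qed.

Context (lam : R[i]) (lam1 : normc lam = 1).

(** Under [cev] this is the operator lam T, so [avg pshift m 1] evaluates to the average of f with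
    weights lam^k. *)
Definition pshift p : {poly R[i]} := lam *: ('X * p).

(** T acts on real and imaginary parts separately, where [T_sqn] applies, and the unimodular factor
    lam leaves the modulus unchanged. *)
Lemma cevQ_shift p : (cevQ (pshift p) <= cevQ p)%E.
Proof.
set u := fun x => Re (cev p x); set v := fun x => Im (cev p x).
have [bu Hu] := Re_cev_Loo p; have [bv Hv] := Im_cev_Loo p.
have [mTu _] := T_L1 mu_gt0 DS (Re_cev_L1 p).
have [mTv _] := T_L1 mu_gt0 DS (Im_cev_L1 p).
apply: le_trans (leeD (T_sqn mu_gt0 DS (Re_cev_L1 p) Hu) (T_sqn mu_gt0 DS (Im_cev_L1 p) Hv)).
rewrite /cevQ /sqn -!ge0_integralD //; do ?[by move=> x _; rewrite lee_fin sqr_ge0];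
  do ?exact: measurable_sqE.
apply: ae_ge0_le_integral => //;
  do ?[by move=> x _; rewrite adde_ge0 // lee_fin sqr_ge0];
  do ?[by apply: emeasurable_funD; exact: measurable_sqE].
have := cev_iter 1 p; rewrite expr1; apply: filterS => x H _.
rewrite -!EFinD lee_fin -!sqr_normcE /pshift cevZ normcME lam1 mul1r H.
by rewrite sqr_normcE.
Qed.

Lemma iter_pshift k p : iter k pshift p = lam ^+ k *: ('X^k * p).
Proof.
elim: k => [|k IH]; first by rewrite !expr0 scale1r mul1r.
by rewrite iterS IH /pshift -scalerAr scalerA -exprS mulrA -exprS.
Qed.

Lemma pshiftD p q : pshift (p + q) = pshift p + pshift q.
Proof. by rewrite /pshift mulrDr scalerDr. Qed.

Lemma pshift_inv n p : pshift (n%:R^-1 *: p) = n%:R^-1 *: pshift p.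
Proof. by rewrite /pshift -scalerAr scalerA mulrC -scalerA. Qed.

Definition cevN2 p : R := Num.sqrt (fine (cevQ p)).

Lemma cevN2_cauchy p e : 0 < e -> exists M : nat, forall m n,
  (M <= m)%N -> (M <= n)%N -> cevN2 (avg pshift m p - avg pshift n p) <= e.
Proof.
have [Q QE] : exists Q : {poly R[i]} -> R, forall q, cevQ q = (Q q)%:E.
  by exists (fun q => fine (cevQ q)) => q; rewrite fineK // cevQ_fin.
have Q0 q : 0 <= Q q by rewrite -lee_fin -QE cevQ_ge0.
have NE q : cevN2 q = Num.sqrt (Q q) by rewrite /cevN2 QE.
apply: (@avg_cauchy _ _ _ cevN2).
- move=> u v; rewrite !NE; apply: sqrt_triangle => // t t0.
  by have := cevQ_D u v t0; rewrite !QE -!EFinM -EFinD lee_fin.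
- by move=> v; rewrite /cevN2 cevQ_N.
- move=> n v; rewrite /cevN2 cevQ_inv QE -EFinM /=.
  by rewrite sqrtrM ?sqr_ge0 // sqrtr_sqr ger0_norm // invr_ge0.
- exact: pshiftD.
- exact: pshift_inv.
- move=> v; rewrite !NE ler_wsqrtr //.
  by have := cevQ_shift v; rewrite !QE lee_fin.
- move=> u v; rewrite !NE !sqr_sqrtr //.
  by have := cevQ_par u v; rewrite !QE -!EFinM -!EFinD => -[].
Qed.

(** Off one null set, |p(T) f| <= c [coefN1 p] for all p simultaneously, so estimates in this norm
    become uniform bounds. Applied to [avg_avg], it gives uniform smallness of A_m A_n f - A_m f. *)
Definition coefN1 p : R := \sum_(k < size p) normc p`_k.

Lemma coefN1_wide n p : (size p <= n)%N -> coefN1 p = \sum_(k < n) normc p`_k.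
Proof.
move=> pn; rewrite /coefN1 (big_ord_widen n (fun k => normc p`_k)) //.
rewrite big_mkcond /=; apply: eq_bigr => k _; case: ltnP => // kp.
by rewrite nth_default // normc0E.
Qed.

Lemma coefN1_D p q : coefN1 (p + q) <= coefN1 p + coefN1 q.
Proof.
have pn := leq_maxl (size p) (size q); have qn := leq_maxr (size p) (size q).
rewrite (coefN1_wide pn) (coefN1_wide qn) (coefN1_wide (size_polyD p q)).
by rewrite -big_split; apply: ler_sum => k _; rewrite coefD normcD.
Qed.

Lemma coefN1_Z a p : coefN1 (a *: p) = normc a * coefN1 p.
Proof.
rewrite (coefN1_wide (size_scale_leq a p)) mulr_sumr.
by apply: eq_bigr => k _; rewrite coefZ normcME.
Qed.

Lemma coefN1_shift p : coefN1 (pshift p) <= coefN1 p.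
Proof.
rewrite /pshift coefN1_Z lam1 mul1r.
have sz : (size ('X * p)%R <= (size p).+1)%N.
  by rewrite (leq_trans (size_polyMleq _ _)) // size_polyX.
have c0 : ('X * p)`_(@ord0 (size p)) = 0 by rewrite coefXM.
rewrite (coefN1_wide sz) big_ord_recl c0 normc0E add0r.
by apply: ler_sum => k _; rewrite coefXM.
Qed.

Lemma coefN1_avg_avg m n p : (0 < n)%N ->
  coefN1 (avg pshift m (avg pshift n p) - avg pshift m p) <=
  m%:R^-1 * (2 * n%:R * coefN1 p).
Proof.
apply: avg_avg; first exact: coefN1_D.
- move=> v; rewrite -scaleN1r coefN1_Z normcNE.
  by rewrite -[1]/(toC 1) normc_real normr1 mul1r.
- by move=> k v; rewrite coefN1_Z invnatCE normc_real ger0_norm // invr_ge0.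
- exact: pshiftD.
- exact: pshift_inv.
- exact: coefN1_shift.
Qed.

Lemma cev_le_coefN1 x : (forall k, `|iter k T f x| <= c) ->
  forall p, normc (cev p x) <= c * coefN1 p.
Proof.
move=> H p; rewrite /cev (le_trans (normc_sum _)) // mulr_sumr.
apply: ler_sum => k _; rewrite normcME normc_real mulrC ler_wpM2r //.
exact: normc_ge0.
Qed.

(** The constant 8 collects four real sums, one for each choice of the real or imaginary part of
    lam^k and of p(T) f, each bounded by 2 a. Two exceptional sets suffice since they do not depend
    on the weights. *)
Lemma cev_maximal p a : 0 < a -> exists B : set Omega,
  [/\ measurable B, (mu B <= (a ^+ 2)^-1%:E * cevQ p)%E &
   {ae mu, forall x, ~ B x -> forall m, normc (cev (avg pshift m p) x) <= 8 * a}].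
Proof.
move=> a0.
have [B1 [mB1 muB1 H1]] := maximal_ineq_sqn mu_gt0 DS (Re_cev_L1 p) a0.
have [B2 [mB2 muB2 H2]] := maximal_ineq_sqn mu_gt0 DS (Im_cev_L1 p) a0.
exists (B1 `|` B2); split; first exact: measurableU.
  apply: le_trans (measureU2 _ mB1 mB2) _.
  rewrite (ge0_muleDr _ (sqn_ge0 mu _) (sqn_ge0 mu _)); exact: leeD.
have lamk k : normc (lam ^+ k) = 1.
  elim: k => [|k IH]; last by rewrite exprS normcME lam1 IH mul1r.
  by rewrite expr0 -[1]/(toC 1) normc_real normr1.
have Rek k : `|Re (lam ^+ k)| <= 1 by rewrite -(lamk k) Re_le_normc.
have Imk k : `|Im (lam ^+ k)| <= 1 by rewrite -(lamk k) Im_le_normc.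
have H1r := H1 _ _ Rek; have H1i := H1 _ _ Imk.
have H2r := H2 _ _ Rek; have H2i := H2 _ _ Imk.
have H3 := ae_foralln (fun k => cev_iter k p).
apply: filterS3 (filterI H1r H1i) (filterI H2r H2i) H3 => x [H1x H1y] [H2x H2y] H3.
move=> nB m.
have {}H1x := H1x (fun h => nB (or_introl h)) m.
have {}H1y := H1y (fun h => nB (or_introl h)) m.
have {}H2x := H2x (fun h => nB (or_intror h)) m.
have {}H2y := H2y (fun h => nB (or_intror h)) m.
rewrite /avg cevZ normc_invnat.
case: m H1x H1y H2x H2y => [|m] H1x H1y H2x H2y.
  by rewrite invr0 mul0r mulr_ge0 // ltW.
rewrite ler_pdivrMl // cev_sum (le_trans (normc_le_ReIm _)) // Re_sum Im_sum.
have eR : \sum_(k < m.+1) Re (cev (iter k pshift p) x) =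
  \sum_(k < m.+1) Re (lam ^+ k) * iter k T (fun y => Re (cev p y)) x -
  \sum_(k < m.+1) Im (lam ^+ k) * iter k T (fun y => Im (cev p y)) x.
  by rewrite -sumrB; apply: eq_bigr => k _; rewrite iter_pshift cevZ H3 cReM.
have eI : \sum_(k < m.+1) Im (cev (iter k pshift p) x) =
  \sum_(k < m.+1) Re (lam ^+ k) * iter k T (fun y => Im (cev p y)) x +
  \sum_(k < m.+1) Im (lam ^+ k) * iter k T (fun y => Re (cev p y)) x.
  by rewrite -big_split; apply: eq_bigr => k _; rewrite iter_pshift cevZ H3 cImM.
rewrite eR eI.
apply: le_trans (lerD (ler_normB _ _) (ler_normD _ _)) _.
apply: le_trans (lerD (lerD H1x H2y) (lerD H2x H1y)) _.
by rewrite le_eqVlt; apply/orP; left; apply/eqP; ring.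
Qed.

End OperatorPolynomials.

(** * Measure estimates and approximation by truncation *)

Section MeasureLemmas.
Context (d : measure_display) (Omega : measurableType d) (R : realType).
Context (mu : {measure set Omega -> \bar R}).

Lemma ae_measure_le (A B : set Omega) : measurable A -> measurable B ->
  {ae mu, forall x, A x -> B x} -> (mu A <= mu B)%E.
Proof.
move=> mA mB [N [mN N0 NAB]].
apply: (@le_trans _ _ (mu (B `|` N))).
  apply: le_measure; rewrite ?inE //; first exact: measurableU.
  move=> x Ax; have [Bx|nBx] := pselect (B x); first by left.
  by right; apply: NAB => /= H; apply: nBx; exact: H.
have {}N0 : mu N = 0%E by exact: N0.
apply: (@le_trans _ _ (mu B + mu N)%E); first exact: measureU2.
by rewrite N0 adde0.
Qed.

(** Continuity from below. It allows the bound for each finite union to come from an auxiliary set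
    that changes with n, as in [eigen_cauchy]. *)
Lemma measure_bigcup_le (F : nat -> set Omega) (t : \bar R) :
  (forall n, measurable (F n)) ->
  (forall n, (mu (\big[setU/set0]_(k < n) F k) <= t)%E) ->
  (mu (\bigcup_n F n) <= t)%E.
Proof.
move=> mF Ft; rewrite -bigcup_bigsetU_bigcup.
pose G n := \big[setU/set0]_(k < n.+1) F k.
have mG n : measurable (G n) by exact: bigsetU_measurable.
have ndG : nondecreasing_seq G.
  apply/nondecreasing_seqP => n; apply/subsetPset => x Gx.
  by rewrite /G big_ord_recr /=; left.
have H := @nondecreasing_cvg_mu _ _ _ mu G mG (bigcup_measurable (fun k _ => mG k)) ndG.
have /cvg_lim <- // := H.
apply: lime_le; first exact: cvgP H.
by apply: nearW => n; exact: Ft.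
Qed.

Lemma measurable_normc_gt (u : Omega -> R[i]) (b : R) : 0 <= b ->
  measurable_fun setT (fun x => complex.Re (u x)) ->
  measurable_fun setT (fun x => complex.Im (u x)) ->
  measurable [set x | b < ComplexField.Normc.normc (u x)].
Proof.
move=> b0 mr mi.
have -> : [set x | b < ComplexField.Normc.normc (u x)] =
  [set x | b ^+ 2 < complex.Re (u x) ^+ 2 + complex.Im (u x) ^+ 2].
  apply/seteqP; split => x /=; rewrite -sqr_normcE ltr_pXn2r // nnegrE ?normc_ge0 //.
by apply: measurable_gt; apply: measurable_funD; exact: measurable_funX.
Qed.

(** Dominated convergence: at each point the rest vanishes as soon as n >= |f x|, and it is
    dominated by |f|. *)
Lemma clamp_approx (f : Omega -> R) (e : R) : L1 mu f -> 0 < e ->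
  exists2 n : nat, 0 <= n%:R :> R &
    (norm1 mu (fun x => (f x - clamp n%:R (f x))%R) <= e%:E)%E.
Proof.
move=> f1 e0; have [mf _] := f1.
pose g n x := `|f x - clamp n%:R (f x)|%:E.
have n0 (n : nat) : 0 <= n%:R :> R by [].
have mg n : measurable_fun setT (g n).
  by apply: measurable_normE; have [_ _ []] := clamp_L1 (n0 n) f1.
have int : mu.-integrable setT (fun x => `|f x|%:E).
  apply/integrableP; split; first exact: measurable_normE.
  case: f1 => _; rewrite /norm1; under [in X in _ -> X]eq_integral do rewrite abse_EFin normr_id.
  by [].
have g0 : {ae mu, forall x, setT x -> g ^~ x @ \oo --> 0%E}.
  apply: aeW => x _; apply: cvg_near_cst.
  near=> n; rewrite /g clamp_rest // max_l // subr_le0.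
  near: n; exists (Num.bound `|f x|) => // n /= bn.
  by apply: le_trans (ltW (archi_boundP _)) _ => //; rewrite ler_nat.
have gf : {ae mu, forall x n, setT x -> (`|g n x| <= `|f x|%:E)%E}.
  apply: aeW => x n _; rewrite /g abse_EFin normr_id lee_fin.
  by rewrite -(clamp_split (f x) (n0 n)) lerDr.
have [_ _] := @dominated_convergence _ _ _ mu setT measurableT g (cst 0%E)
  (fun x => `|f x|%:E) mg (measurable_cst _) g0 int gf.
rewrite integral0 => H.
apply: contrapT => Hn.
have : (e%:E <= 0)%E.
  rewrite -(cvg_lim _ H) //; apply: lime_ge; first exact: cvgP H.
  apply: nearW => n; rewrite leNgt; apply/negP => /ltW lt_e.
  by apply: Hn; exists n.
by rewrite lee_fin leNgt e0.
Unshelve. all: by end_near. Qed.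


End MeasureLemmas.

(** * Almost everywhere convergence *)

Section CauchyCombinations.
Context (R : realType).
Implicit Types s t : nat -> R[i].
Local Notation normc := (@ComplexField.Normc.normc R).

Lemma cauchy_at0 : cauchy_at (fun=> 0 : R[i]).
Proof. by move=> e e0; exists 0%N => m n _ _; rewrite subrr normc0E ltW. Qed.

Lemma cauchy_at_lin (a : R[i]) s t : cauchy_at s -> cauchy_at t ->
  cauchy_at (fun n => a * s n + t n).
Proof.
move=> Hs Ht e e0.
have A0 : 0 < normc a + 1 by rewrite ltr_wpDl // normc_ge0.
have [|M1 H1] := Hs (e / 2 / (normc a + 1)); first by rewrite !divr_gt0.
have [|M2 H2] := Ht (e / 2); first by rewrite divr_gt0.
exists (maxn M1 M2) => m n; rewrite !geq_max => /andP[m1 m2] /andP[n1 n2].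
have -> : a * s m + t m - (a * s n + t n) = a * (s m - s n) + (t m - t n) by ring.
rewrite (le_trans (normcD _ _)) // normcME (splitr e) lerD ?H2 //.
apply: (@le_trans _ _ ((normc a + 1) * (e / 2 / (normc a + 1)))).
  by rewrite ler_pM ?normc_ge0 ?H1 // lerDl.
by rewrite mulrC divfK // gt_eqF.
Qed.

Lemma cauchy_at_sum n (a : 'I_n -> R[i]) (s : 'I_n -> nat -> R[i]) :
  (forall i, cauchy_at (s i)) -> cauchy_at (fun k => \sum_i a i * s i k).
Proof.
elim: n a s => [|n IH] a s Hs.
  rewrite (_ : (fun _ => _) = fun=> 0); first exact: cauchy_at0.
  by apply/funext => k; rewrite big_ord0.
rewrite (_ : (fun _ => _) = fun k => a ord_max * s ord_max k +
    \sum_(i < n) a (widen_ord (leqnSn n) i) * s (widen_ord (leqnSn n) i) k).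
  by apply: cauchy_at_lin => //; exact: IH.
by apply/funext => k; rewrite big_ord_recr addrC.
Qed.

Lemma osc_le_near s t (e1 e2 : R) :
  (exists M : nat, forall n, (M <= n)%N -> normc (s n - t n) <= e1) ->
  osc_le t e2 -> osc_le s (2 * e1 + e2).
Proof.
move=> [M1 H1] [M2 H2].
exists (maxn M1 M2) => m n; rewrite !geq_max => /andP[m1 m2] /andP[n1 n2].
have -> : s m - s n = (s m - t m) + (t n - s n) + (t m - t n) by ring.
rewrite (le_trans (normcD _ _)) // lerD ?H2 //.
by rewrite (le_trans (normcD _ _)) // (normcB (t n)) mulr_natl mulr2n lerD ?H1.
Qed.

Lemma cauchy_osc s e : 0 < e -> cauchy_at s -> osc_le s e.
Proof. by move=> e0 /(_ e e0). Qed.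

End CauchyCombinations.

Section Convergence.
Context (d : measure_display) (Omega : measurableType d) (R : realType).
Context (mu : {measure set Omega -> \bar R}).
Context (mu_gt0 : (0 < mu [set: Omega])%E).
Context (T : (Omega -> R) -> Omega -> R).
Context (DS : dunford_schwartz mu (real_complex R) T).
Implicit Types (f g h : Omega -> R) (beta : nat -> R[i]).
Local Notation normc := (@ComplexField.Normc.normc R).
Local Notation Re := (@complex.Re R).
Local Notation Im := (@complex.Im R).
Local Notation toC := (real_complex R).
Local Notation W beta f := (weighted_average (real_complex R) beta T f).

Lemma avg_add beta f g h : L1Loo mu g -> L1Loo mu h ->
  (forall x, f x = g x + h x) ->
  {ae mu, forall x, forall n, W beta f n x = W beta g n x + W beta h n x}.
Proof.
move=> Hg Hh fgh.
have -> : f = (fun x => 1 * g x + h x) by apply/funext => x; rewrite mul1r.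
have := ae_foralln (fun k => iter_lin mu_gt0 DS k 1 Hg Hh).
apply: filterS => x Hx n; rewrite /weighted_average -mulrDr -big_split /=.
congr (_ * _); apply: eq_bigr => k _.
by rewrite Hx mul1r -mulrDr -rmorphD.
Qed.

Lemma avg_bound beta f (C c : R) : (forall k, normc (beta k) <= C) ->
  Loo mu c f -> {ae mu, forall x, forall n, normc (W beta f n x) <= C * c}.
Proof.
move=> bC fc.
have : {ae mu, forall x, forall k, `|iter k T f x| <= c}.
  by apply: ae_foralln => k; have [] := iter_Loo mu_gt0 DS k fc.
apply: filterS => x Hx n; rewrite /weighted_average normc_invnat.
have C0 : 0 <= C by exact: le_trans (normc_ge0 _) (bC 0%N).
have c0 : 0 <= c by exact: le_trans (Hx 0%N).
case: n => [|n]; first by rewrite invr0 mul0r mulr_ge0.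
rewrite ler_pdivrMl // (le_trans (normc_sum _)) //.
apply: (@le_trans _ _ (\sum_(k < n.+1) C * c)); last first.
  by rewrite sumr_const card_ord -[leLHS]mulr_natl.
by apply: ler_sum => k _; rewrite normcME normc_real ler_pM ?normc_ge0.
Qed.

(** The factor 2 adds the real and the imaginary parts of the weights, both handled off the same
    B. *)
Lemma avg_maximal beta f (C a : R) : (forall k, normc (beta k) <= C) ->
  L1 mu f -> 0 < a -> exists B : set Omega,
  [/\ measurable B, (mu B <= a^-1%:E * norm1 mu f)%E &
   {ae mu, forall x, ~ B x -> forall n, normc (W beta f n x) <= 2 * C * a}].
Proof.
move=> bC f1 a0; have C0 : 0 <= C by exact: le_trans (normc_ge0 _) (bC 0%N).
have [B [mB muB HB]] := maximal_ineq mu_gt0 DS f1 a0.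
exists B; split => //.
have Rek k : `|Re (beta k)| <= C by apply: le_trans (bC k); exact: Re_le_normc.
have Imk k : `|Im (beta k)| <= C by apply: le_trans (bC k); exact: Im_le_normc.
apply: filterS2 (HB _ _ Rek) (HB _ _ Imk) => x H1 H2 nB n.
rewrite /weighted_average normc_invnat.
case: n {H1 H2} (H1 nB n) (H2 nB n) => [|n] H1 H2.
  by rewrite invr0 mul0r !mulr_ge0 // ltW.
rewrite ler_pdivrMl // (le_trans (normc_le_ReIm _)) // Re_sum Im_sum.
under eq_bigr do rewrite cReMr.
under [in X in _ + X]eq_bigr do rewrite cImMr.
apply: le_trans (lerD H1 H2) _.
by rewrite le_eqVlt; apply/orP; left; apply/eqP; ring.
Qed.

(** No limit in L2 is constructed. Its role, that of a function fixed by the averages, is taken by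
    an average [P n] with n much larger than the lengths considered: it is nearly fixed by all A_m
    with m <= K. This bounds the bad set for m <= K, uniformly in K. *)
Lemma eigen_cauchy f c (lam : R[i]) : L1 mu f -> Loo mu c f -> normc lam = 1 ->
  {ae mu, forall x, cauchy_at (fun n => W (fun k => lam ^+ k) f n x)}.
Proof.
move=> f1 fc lam1.
pose S := pshift lam; pose P m := avg S m 1.
pose ev := cev T f.
have WE m x : W (fun k => lam ^+ k) f m x = ev (P m) x.
  rewrite /ev /P /avg cevZ cev_sum; congr (_ * _); apply: eq_bigr => k _.
  by rewrite iter_pshift mulr1 cevZ cevXn.
have itc : {ae mu, forall x, forall k, `|iter k T f x| <= c}.
  by apply: ae_foralln => k; have [] := iter_Loo mu_gt0 DS k fc.
have evc : {ae mu, forall x, forall p, normc (ev p x) <= c * coefN1 p}.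
  by apply: filterS itc => x Hx p; exact: cev_le_coefN1.
apply: ae_cauchy => e t e0 t0.
(* Two terms bounded by 8 a make e/8, and the term [small] adds e/8, giving the e/4 in [F]. The
   threshold a sqrt t for the L2 distance makes the weak type (2,2) bound at level a equal to t. *)
pose a := e / 128; have a0 : 0 < a by rewrite divr_gt0.
have st0 : 0 < Num.sqrt t by rewrite sqrtr_gt0.
have [M HM] := cevN2_cauchy mu_gt0 DS f1 fc lam1 1 (mulr_gt0 a0 st0).
pose n0 := maxn M 1.
have n00 : (0 < n0)%N by rewrite /n0 leq_max orbT.
have Mn0 : (M <= n0)%N by rewrite /n0 leq_max leqnn.
pose G m x := ev (avg S m (P n0) - P n0) x.
(* The index is shifted because the average of length 0 is 0, for which [G] is not small. *)
pose F m := [set x | e / 4 < normc (G m.+1 x)].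
have mF m : measurable (F m).
  apply: measurable_normc_gt; first by rewrite divr_ge0 // ltW.
    by have [] := Re_cev_L1 mu_gt0 DS f1 fc (avg S m.+1 (P n0) - P n0).
  by have [] := Im_cev_L1 mu_gt0 DS f1 fc (avg S m.+1 (P n0) - P n0).
exists (\bigcup_m F m); split; first exact: bigcup_measurable.
- apply: measure_bigcup_le => // K.
  (* The length n is chosen after K, so that A_m [P n] differs from [P n] by at most e/8 for all m
     <= K. *)
  have [N HN] := divn_small (2 * K%:R * coefN1 1 * `|c|) (divr_gt0 e0 (ltr0Sn R 7)).
  pose n := maxn N n0.
  have Nn : (N <= n)%N by rewrite leq_max leqnn.
  have Mn : (M <= n)%N by rewrite leq_max Mn0 orbT.
  pose r := P n0 - P n.
  have Qr : (cevQ mu T f r <= (a ^+ 2 * t)%:E)%E.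
    have := HM n0 n Mn0 Mn; rewrite -/S -/(P n0) -/(P n) -/r /cevN2.
    have Qf := cevQ_fin mu_gt0 DS f1 fc r.
    have Qge := cevQ_ge0 mu T f r.
    rewrite -[in X in _ -> X](fineK Qf) lee_fin => H.
    rewrite -(sqr_sqrtr (fine_ge0 Qge)) -[X in _ <= _ * X](sqr_sqrtr (ltW t0)).
    by rewrite -exprMn ler_pXn2r // nnegrE ?sqrtr_ge0 // mulr_ge0 // ltW.
  have [B [mB muB HB]] := cev_maximal mu_gt0 DS f1 fc lam1 r a0.
  apply: (@le_trans _ _ (mu B)); last first.
    apply: le_trans muB _; rewrite lee_pdivrMl ?exprn_gt0 //.
  apply: ae_measure_le => //; first exact: bigsetU_measurable.
  apply: filterS2 evc HB => x evx HB; rewrite -bigcup_mkord => -[m /= mK Fm].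
  apply: contrapT => nB; move: Fm; apply/negP; rewrite -leNgt.
  have -> : G m.+1 x = ev (avg S m.+1 r) x - ev r x +
                       ev (avg S m.+1 (P n) - P n) x.
    have avB u v : avg S m.+1 (u - v) = avg S m.+1 u - avg S m.+1 v.
      by apply/eqP; rewrite eq_sym subr_eq -(avgD (pshiftD lam)) subrK.
    by rewrite /G /r /ev avB !cevB; ring.
  have evr : normc (ev r x) <= 8 * a.
    (* As an average of length 1, r itself falls under the maximal inequality. *)
    have -> : r = avg S 1 r by rewrite /avg big_ord1 invr1 scale1r.
    exact: HB.
  have small : normc (ev (avg S m.+1 (P n) - P n) x) <= e / 8.
    apply: le_trans (evx _) _.
    (* Averages commute: the long average n is moved outside, so that the factor 1/n of
       [coefN1_avg_avg] becomes available. *)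
    rewrite /P (avgC (pshiftD lam) (pshift_inv lam)).
    apply: (@le_trans _ _ (`|c| * coefN1 (avg S n (avg S m.+1 1) - avg S n 1))).
      rewrite ler_wpM2r ?ler_norm // sumr_ge0 // => k _; exact: normc_ge0.
    apply: (@le_trans _ _ (`|c| * (n%:R^-1 * (2 * m.+1%:R * coefN1 1)))).
      by rewrite ler_wpM2l //; exact: coefN1_avg_avg.
    apply: le_trans (HN n Nn).
    rewrite mulrCA ler_wpM2l ?invr_ge0 // mulrC ler_wpM2r //.
    rewrite ler_wpM2r ?sumr_ge0 // => [k _|]; first exact: normc_ge0.
    by rewrite ler_pM2l // ler_nat.
  rewrite (le_trans (normcD _ _)) //.
  apply: le_trans (lerD (normcD _ _) small) _; rewrite normcNE.
  apply: le_trans (lerD (lerD (HB nB m.+1) evr) (lexx _)) _.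
  by rewrite /a; lra.
apply: filterS evc => x evx nD.
have GD m : normc (G m.+1 x) <= e / 4.
  by rewrite leNgt; apply/negP => h; apply: nD; exists m.
have [N HN] := divn_small (2 * n0%:R * coefN1 1 * `|c|) (divr_gt0 e0 (ltr0Sn R 7)).
(* Comparison with a constant sequence: e/8 for A_m A_n0 - A_m, e/4 for [G]; the oscillation of the
   constant is 0, and e/4 is to spare. *)
rewrite (_ : e = 2 * (e / 8 + e / 4) + e / 4); last by field.
apply: (@osc_le_near _ _ (fun=> ev (P n0) x)); last first.
  by apply: cauchy_osc; [rewrite divr_gt0|move=> s s0; exists 0%N => *; rewrite subrr normc0E ltW].
exists (maxn N 1) => m; rewrite geq_max => /andP[Nm m0].
rewrite WE.
have -> : ev (P m) x - ev (P n0) x = - ev (avg S m (P n0) - P m) x + G m x.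
  by rewrite /G /ev !cevB; ring.
rewrite (le_trans (normcD _ _)) // normcNE lerD //; last by case: m m0 {Nm}.
apply: le_trans (evx _) _.
apply: (@le_trans _ _ (`|c| * coefN1 (avg S m (avg S n0 1) - avg S m 1))).
  rewrite ler_wpM2r ?ler_norm // sumr_ge0 // => k _; exact: normc_ge0.
apply: (@le_trans _ _ (`|c| * (m%:R^-1 * (2 * n0%:R * coefN1 1)))).
  by rewrite ler_wpM2l //; exact: coefN1_avg_avg.
by rewrite mulrC -(mulrA m%:R^-1); exact: HN.
Qed.

End Convergence.

(** * Besicovitch weights: bounded, integrable and vanishing functions *)

Section BesicovitchConvergence.
Context (d : measure_display) (Omega : measurableType d) (R : realType).
Context (mu : {measure set Omega -> \bar R}).
Context (mu_gt0 : (0 < mu [set: Omega])%E).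
Context (T : (Omega -> R) -> Omega -> R).
Context (DS : dunford_schwartz mu (real_complex R) T).
Implicit Types (f g h : Omega -> R) (beta : nat -> R[i]).
Local Notation normc := (@ComplexField.Normc.normc R).
Local Notation toC := (real_complex R).
Local Notation W beta f := (weighted_average (real_complex R) beta T f).

Lemma trig_cauchy f c (P : int -> R[i]) : L1 mu f -> Loo mu c f ->
  trigonometric_polynomial P ->
  {ae mu, forall x, cauchy_at (fun n => W (fun k => P k%:Z) f n x)}.
Proof.
move=> f1 fc [s [z [lam [lam1 PE]]]].
have H j : {ae mu, forall x, cauchy_at (fun n => W (fun k => lam j ^+ k) f n x)}.
  exact: eigen_cauchy fc (lam1 j).
have HA : {ae mu, forall x, forall j, cauchy_at (fun n => W (fun k => lam j ^+ k) f n x)}.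
  apply: filter_forall => j; exact: H.
apply: filterS HA => x Hx.
rewrite (_ : (fun n => _) =
  fun n => \sum_(j < s) z j * W (fun k => lam j ^+ k) f n x).
  exact: cauchy_at_sum.
apply/funext => n; rewrite /weighted_average.
under [RHS]eq_bigr do rewrite mulrCA mulr_sumr.
rewrite -mulr_sumr exchange_big /=; congr (_ * _); apply: eq_bigr => k _.
by rewrite PE mulr_suml; apply: eq_bigr => j _; rewrite mulrA.
Qed.

Lemma besicovitch_approx beta : bounded_besicovitch beta -> forall e : R, 0 < e ->
  exists2 P, trigonometric_polynomial P & exists M : nat, forall n, (M <= n)%N ->
    n%:R^-1 * \sum_(k < n) normc (beta k - P k%:Z) <= e.
Proof.
move=> [_ H] e /H [P tP He]; exists P => //.
have [_ [V [M _ VM] <-] HV] := ereal_inf_lt He.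
exists M => n Mn; rewrite -lee_fin; apply: le_trans (ltW HV).
by apply: ereal_sup_ubound; exists n => //; exact: VM.
Qed.

(** For bounded f, the mean error of the weights bounds the error of the averages off a null set; so
    the exceptional set asked for by [ae_cauchy] can be empty. *)
Lemma bounded_cauchy f c beta : L1 mu f -> Loo mu c f -> bounded_besicovitch beta ->
  {ae mu, forall x, cauchy_at (fun n => W beta f n x)}.
Proof.
move=> f1 fc bB; have [[C bC] _] := bB.
have itc : {ae mu, forall x, forall k, `|iter k T f x| <= c}.
  by apply: ae_foralln => k; have [] := iter_Loo mu_gt0 DS k fc.
apply: ae_cauchy => e t e0 t0; exists set0; split => //.
  by rewrite measure0 lee_fin ltW.
have D0 : 0 < e / 4 / (`|c| + 1) by rewrite !divr_gt0 // ltr_wpDl.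
have [P tP [M HM]] := besicovitch_approx bB D0.
apply: filterS2 itc (trig_cauchy f1 fc tP) => x Hx Px _.
rewrite (_ : e = 2 * (e / 4) + e / 2); last by field.
apply: (@osc_le_near _ _ (fun n => W (fun k => P k%:Z) f n x)); last first.
  by apply: cauchy_osc => //; rewrite divr_gt0.
exists M => n Mn; rewrite /weighted_average -mulrBr -sumrB normc_invnat.
apply: (@le_trans _ _ ((`|c| + 1) * (n%:R^-1 *
    \sum_(k < n) normc (beta k - P k%:Z)))); last first.
  rewrite -ler_pdivlMl; last by rewrite ltr_wpDl.
  by rewrite [leRHS]mulrC; exact: HM.
rewrite mulrCA ler_wpM2l ?invr_ge0 // (le_trans (normc_sum _)) // mulr_sumr.
apply: ler_sum => k _; rewrite -mulrBl normcME normc_real mulrC.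
rewrite ler_wpM2r ?normc_ge0 // (le_trans (Hx k)) //.
by rewrite (le_trans (ler_norm c)) // lerDl.
Qed.

Lemma L1_cauchy f beta : L1 mu f -> bounded_besicovitch beta ->
  {ae mu, forall x, cauchy_at (fun n => W beta f n x)}.
Proof.
move=> f1 bB; have [[C bC] _] := bB.
have C0 : 0 <= C by exact: le_trans (normc_ge0 _) (bC 0%N).
apply: ae_cauchy => e t e0 t0.
(* Then 2 C a <= e/4, and approximating f in L1 up to a t makes the weak type bound at level a equal
   to t. *)
pose a := e / (8 * (C + 1)).
have a0 : 0 < a by rewrite divr_gt0 // mulr_gt0 // ltr_wpDl.
have [N N0 HN] := clamp_approx f1 (mulr_gt0 a0 t0).
have [c1 c2 g1] := clamp_L1 N0 f1.
have [B [mB muB HB]] := avg_maximal mu_gt0 DS bC g1 a0.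
exists B; split => //.
  by apply: le_trans muB _; rewrite lee_pdivrMl.
have H1 := bounded_cauchy c1 c2 bB.
have H2 := avg_add mu_gt0 DS beta (L1_L1Loo g1) (L1_L1Loo c1)
  (fun x => esym (subrK (clamp N%:R (f x)) (f x))).
apply: filterS3 HB H1 H2 => x HB H1 H2 nB.
rewrite (_ : e = 2 * (e / 4) + e / 2); last by field.
apply: (@osc_le_near _ _ (fun n => W beta (fun x => clamp N%:R (f x)) n x)); last first.
  by apply: cauchy_osc => //; rewrite divr_gt0.
exists 0%N => n _; rewrite H2 addrK; apply: le_trans (HB nB n) _.
rewrite /a (_ : 2 * C * _ = e / 4 * (C / (C + 1))); last first.
  by field; rewrite gt_eqF // ltr_wpDl.
rewrite ler_piMr ?divr_ge0 // ?(ltW e0) // ler_pdivrMr ?mul1r ?lerDl //.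
by rewrite ltr_wpDl.
Qed.

(** The excess lives on a set of finite measure, where it is at most |f1| plus the bound of the L^oo
    part. *)
Lemma excess_L1 f e : 0 < e -> L1Loo mu f ->
  (mu [set x | (e < `|f x|)%R] < +oo)%E ->
  L1 mu (fun x => f x - clamp e (f x)).
Proof.
move=> e0 fL mufin; have mf := L1LooM fL.
have [f1 [f2 [c [[mf1 f1fin] [mf2 f2c] fE]]]] := fL.
set A := [set x | _] in mufin.
have mA : measurable A.
  by apply: measurable_gt; exact: measurableT_comp.
have mg : measurable_fun setT (fun x => f x - clamp e (f x)).
  by apply: measurable_funB => //; exact: (measurable_clamp (measurable_cst e)).
have mI : measurable_fun setT (fun x => `|c| * \1_A x).
  by apply: measurable_funM => //; exact: measurable_indic.
split => //.
apply: (@le_lt_trans _ _ (norm1 mu (fun x => `|f1 x| + `|c| * \1_A x))).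
  apply: norm1_le => //.
    by apply: measurable_funD => //; exact: measurableT_comp.
  apply: filterS f2c => x f2c.
  rewrite clamp_rest ?(ltW e0) // (ger0_norm (_ : 0 <= _ + _)) ?addr_ge0 ?mulr_ge0 //.
  rewrite indicE; case: (leP `|f x| e) => h.
    by rewrite max_l ?subr_le0 // addr_ge0 ?mulr_ge0.
  rewrite (_ : (x \in A) = true); last exact: mem_set.
  rewrite mulr1 max_r ?subr_ge0 ?(ltW h) //.
  have := ler_normD (f1 x) (f2 x); have := ler_norm c; rewrite fE; lra.
apply: le_lt_trans (norm1D_le _ _ _) _ => //; first exact: measurableT_comp.
apply: lte_add_pinfty.
  by rewrite /norm1; under eq_integral do rewrite normr_id.
rewrite norm1Z; last exact: measurable_indic.
apply: lte_mul_pinfty; rewrite ?lee_fin //.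
rewrite /norm1; under eq_integral do rewrite ger0_norm //.
by rewrite integral_indic // setIT.
Qed.

Lemma vanishing_cauchy f beta : L1Loo mu f ->
  (forall l : R, 0 < l -> (mu [set x | (l < `|f x|)%R] < +oo)%E) ->
  bounded_besicovitch beta ->
  {ae mu, forall x, cauchy_at (fun n => W beta f n x)}.
Proof.
move=> fL fv bB; have [[C bC] _] := bB.
have C0 : 0 <= C by exact: le_trans (normc_ge0 _) (bC 0%N).
apply: ae_cauchy => e t e0 t0; exists set0; split => //.
  by rewrite measure0 lee_fin ltW.
have C1 : 0 < C + 1 by rewrite ltr_wpDl.
(* The truncated part changes every average by at most C a <= e/4. *)
pose a := e / (4 * (C + 1)); have a0 : 0 < a by rewrite divr_gt0 // mulr_gt0.
have g1 := excess_L1 a0 fL (fv a a0).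
have mc : measurable_fun setT (fun x => clamp a (f x)).
  by apply: (measurable_clamp (measurable_cst a)); exact: L1LooM fL.
have c1 : Loo mu a (fun x => clamp a (f x)).
  by split => //; apply: aeW => x; apply: clamp_le; exact: ltW.
have H1 := L1_cauchy g1 bB.
have H2 := avg_add mu_gt0 DS beta (L1_L1Loo g1) (Loo_L1Loo c1)
  (fun x => esym (subrK (clamp a (f x)) (f x))).
have H3 := avg_bound mu_gt0 DS bC c1.
apply: filterS3 H1 H2 H3 => x H1 H2 H3 _.
rewrite (_ : e = 2 * (e / 4) + e / 2); last by field.
apply: (@osc_le_near _ _ (fun n => W beta (fun x => f x - clamp a (f x)) n x)); last first.
  by apply: cauchy_osc => //; rewrite divr_gt0.
exists 0%N => n _; rewrite H2 addrAC subrr add0r; apply: le_trans (H3 n) _.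
rewrite /a (_ : C * _ = e / 4 * (C / (C + 1))); last by field; rewrite gt_eqF.
by rewrite ler_piMr ?divr_ge0 // ?(ltW e0) // ler_pdivrMr ?mul1r ?lerDl.
Qed.

End BesicovitchConvergence.

(** * Rearrangements *)

Section LowerLimit.
Context (R : realType).
Implicit Types (u : nat -> \bar R) (x : \bar R).

Lemma le_limn_einf u x :
  (forall r : R, (r%:E < x)%E -> exists M : nat, forall n, (M <= n)%N -> (r%:E <= u n)%E) ->
  (x <= limn_einf u)%E.
Proof.
move=> H.
have K r : (r%:E < x)%E -> (r%:E <= limn_einf u)%E.
  move=> /H[M HM]; rewrite limn_einf_lim; apply: lime_ge; first exact: is_cvg_einfs.
  exists M => // n /= Mn; apply: le_ereal_inf_tmp => _ [k /= nk <-].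
  by apply: HM; exact: leq_trans nk.
case: x {H} K => [r| |] K; last by rewrite leNye.
- apply/lee_subgt0Pr => e e0; rewrite -EFinB; apply: K.
  by rewrite lte_fin ltrBlDr ltrDl.
- rewrite (_ : limn_einf u = +oo%E) //; apply/eqyP => A _.
  by apply: K; rewrite ltry.
Qed.

Lemma limn_einf_le u x : (forall n, (u n <= x)%E) -> (limn_einf u <= x)%E.
Proof.
move=> H; rewrite limn_einf_lim; apply: lime_le; first exact: is_cvg_einfs.
apply: nearW => n; apply: le_trans (H n).
by apply: ereal_inf_lbound; exists n => /=.
Qed.

End LowerLimit.

(** * Comparison of integrals through distribution functions *)

Section LayerCake.
Context (R : realType).

(* A staircase with steps of size 1/(n+1), below [y] and capped at n+1. *)
Definition layer (n : nat) (y : \bar R) : R :=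
  \sum_(j < n.+1 * n.+1) n.+1%:R^-1 * ((j.+1%:R * n.+1%:R^-1)%:E < y)%E%:R.

Let stair (t : R) N (y : \bar R) : R :=
  \sum_(j < N) t * ((j.+1%:R * t)%:E < y)%E%:R.

Let stair_le t N y : 0 <= t -> (0 <= y)%E -> ((stair t N y)%:E <= y)%E.
Proof.
move=> t0 y0; suff : ((stair t N y)%:E <= y)%E /\ stair t N y <= N%:R * t by case.
elim: N => [|N [IH1 IH2]]; first by rewrite /stair big_ord0 mul0r.
rewrite /stair big_ord_recr /= -/(stair t N y).
case: ltP => h; rewrite ?mulr1 ?mulr0 ?addr0.
  have H : stair t N y + t <= N.+1%:R * t by rewrite -(natr1 N) mulrDl mul1r lerD2r.
  by split => //; apply: le_trans (ltW h); rewrite lee_fin.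
by split => //; rewrite (le_trans IH2) // ler_wpM2r // ler_nat.
Qed.

(** The second alternative is the cap: y lies above all N steps. *)
Let stair_ge t N y (r : R) : 0 <= t -> (r%:E <= y)%E ->
  r - t <= stair t N y \/ N%:R * t <= stair t N y.
Proof.
move=> t0 ry; elim: N => [|N IH]; first by right; rewrite /stair big_ord0 mul0r.
rewrite /stair big_ord_recr /= -/(stair t N y).
case: ltP => h; rewrite ?mulr1 ?mulr0 ?addr0.
  case: IH => IH; first by left; rewrite (le_trans IH) // lerDl.
  by right; rewrite -(natr1 N) mulrDl mul1r lerD2r.
case: IH => IH; first by left.
left; apply: le_trans IH; rewrite lerBlDr.
have : (r%:E <= (N.+1%:R * t)%:E)%E by exact: le_trans h.
by rewrite lee_fin -(natr1 N) mulrDl mul1r.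
Qed.

Lemma layer_le n y : (0 <= y)%E -> ((layer n y)%:E <= y)%E.
Proof. by apply: stair_le; rewrite invr_ge0. Qed.

Lemma layer_ge0 n y : 0 <= layer n y.
Proof. by apply: sumr_ge0 => j _; rewrite mulr_ge0 // invr_ge0. Qed.

Lemma layer_lim y : (y <= limn_einf (fun n => (layer n y)%:E))%E.
Proof.
apply: le_limn_einf => r ry.
have [r' rr' r'y] : exists2 r', r < r' & (r'%:E <= y)%E.
  case: y ry => [y| |] //; first by rewrite lte_fin => ry; exists y.
  by move=> _; exists (r + 1); rewrite ?leey // ltrDl.
have e0 : 0 < r' - r by rewrite subr_gt0.
have [M1 H1] := divn_small 1 e0.
exists (maxn M1 (Num.bound `|r|)) => n; rewrite geq_max => /andP[n1 n2].
rewrite lee_fin.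
have t0 : 0 <= n.+1%:R^-1 :> R by rewrite invr_ge0.
case: (stair_ge (n.+1 * n.+1) t0 r'y) => H; apply: le_trans H.
  have := H1 n.+1 (leq_trans n1 (leqnSn n)).
  by rewrite mulr1 lerBrDl -lerBrDr.
rewrite natrM -mulrA divff ?mulr1 ?pnatr_eq0 //.
rewrite (le_trans (ler_norm r)) // (le_trans (ltW (archi_boundP _))) //.
by rewrite ler_nat (leq_trans n2).
Qed.

Let indic_lt (X : Type) (F : X -> \bar R) l x :
  \1_[set x | (l < F x)%E] x = (l < F x)%E%:R :> R.
Proof. by rewrite indicE; congr ((nat_of_bool _)%:R); apply/idP/idP => [/set_mem|/mem_set]. Qed.

Lemma int_layer (d : measure_display) (X : measurableType d)
    (mu : {measure set X -> \bar R}) (F : X -> \bar R) n :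
  measurable_fun setT F ->
  (\int[mu]_x (layer n (F x))%:E = \sum_(j < n.+1 * n.+1) n.+1%:R^-1%:E *
      mu [set x | (j.+1%:R * n.+1%:R^-1)%:E < F x]%E)%E.
Proof.
move=> mF.
have mS (l : \bar R) : measurable [set x | (l < F x)%E].
  by rewrite -[X in measurable X]setTI; exact: emeasurable_fun_o_infty.
have E x : (layer n (F x))%:E = (\sum_(j < n.+1 * n.+1) n.+1%:R^-1%:E *
    (\1_[set x | (j.+1%:R * n.+1%:R^-1)%:E < F x]%E x)%:E)%E.
  rewrite /layer -sumEFin; apply: eq_bigr => j _; rewrite -EFinM; congr (_ * _)%:E.
  by rewrite indic_lt.
under eq_integral do rewrite E.
rewrite ge0_integral_sum //.
- apply: eq_bigr => j _; rewrite ge0_integralZl_EFin ?invr_ge0 //.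
  + by rewrite integral_indic // setIT.
  + by apply/measurable_EFinP; exact: measurable_indic.
- by move=> j; apply: emeasurable_funM => //; apply/measurable_EFinP; exact: measurable_indic.
Qed.

(** The layer-cake principle across two measure spaces. Staircases take the place of Fubini's
    theorem, as mu need not be sigma-finite. *)
Lemma le_integral_dist (d d' : measure_display) (X : measurableType d)
    (Y : measurableType d') (mu : {measure set X -> \bar R})
    (nu : {measure set Y -> \bar R}) (F : X -> \bar R) (G : Y -> \bar R) :
  measurable_fun setT F -> measurable_fun setT G ->
  (forall x, (0 <= F x)%E) -> (forall y, (0 <= G y)%E) ->
  (forall l : R, 0 < l -> (mu [set x | l%:E < F x] <= nu [set y | l%:E < G y])%E) ->
  (\int[mu]_x F x <= \int[nu]_y G y)%E.
Proof.
move=> mF mG F0 G0 H.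
have mL (e : measure_display) (Z : measurableType e) (K : Z -> \bar R) n :
    measurable_fun setT K -> measurable_fun setT (fun x => (layer n (K x))%:E).
  move=> mK; apply/measurable_EFinP; apply: measurable_sum => j.
  apply: measurable_funM => //.
  rewrite (_ : (fun x => _) = \1_[set x | (j.+1%:R * n.+1%:R^-1)%:E < K x]%E).
    apply: measurable_indic; rewrite -[X in measurable X]setTI.
    exact: emeasurable_fun_o_infty.
  by apply/funext => x; rewrite indic_lt.
(* The staircases are not monotone in n, since their meshes 1/(n+1) are not nested; hence a lower
   limit and Fatou's lemma. *)
apply: (@le_trans _ _ (\int[mu]_x (limn_einf (fun n => (layer n (F x))%:E)))%E).
  apply: ge0_le_integral => //.
  - rewrite (_ : (fun x => _) = fun x => (- limn_esup (fun n => - (layer n (F x))%:E))%E) //.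
    apply: measurableT_comp => //; apply: measurable_fun_limn_esup => n.
    by apply: measurableT_comp => //; exact: mL.
  - by move=> x _; exact: layer_lim.
apply: le_trans (fatou _ measurableT _ _) _.
- by move=> n; exact: mL.
- by move=> n x _; rewrite lee_fin layer_ge0.
apply: limn_einf_le => n; apply: (@le_trans _ _ (\int[nu]_y (layer n (G y))%:E)%E).
  rewrite !int_layer //; apply: lee_sum => j _.
  rewrite lee_pmul2l ?lte_fin ?invr_gt0 //; apply: H.
  by rewrite mulr_gt0 // invr_gt0.
apply: ge0_le_integral => //.
- by move=> y _; rewrite lee_fin layer_ge0.
- exact: mL.
- by move=> y _; exact: layer_le.
Qed.

End LayerCake.

Section Rearrangement.
Context (d : measure_display) (Omega : measurableType d) (R : realType).
Context (mu : {measure set Omega -> \bar R}).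
Implicit Types (m : Omega -> R) (t l : R).

Definition dist m l : \bar R := mu [set x | (l < m x)%R].

Definition rear m t : \bar R :=
  ereal_inf [set l%:E | l in [set l : R | 0 < l /\ (dist m l <= t%:E)%E]].

Lemma dist_ge0 m l : (0 <= dist m l)%E.
Proof. exact: measure_ge0. Qed.

Lemma dist_nonincr m l l' : measurable_fun setT m -> l <= l' ->
  (dist m l' <= dist m l)%E.
Proof.
move=> mm ll; apply: le_measure; rewrite ?inE; do ?exact: measurable_gt.
by move=> x; exact: le_lt_trans.
Qed.

Lemma rear_ge0 m t : (0 <= rear m t)%E.
Proof. by apply: le_ereal_inf_tmp => _ [l [l0 _] <-]; rewrite lee_fin ltW. Qed.

Lemma rear_nonincr m t t' : t <= t' -> (rear m t' <= rear m t)%E.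
Proof.
move=> tt; apply: ereal_inf_le_tmp => _ [l [l0 H] <-]; exists l => //; split => //.
by apply: le_trans H _; rewrite lee_fin.
Qed.

Lemma le_rear m m' t : measurable_fun setT m -> measurable_fun setT m' ->
  {ae mu, forall x, m x <= m' x} -> (rear m t <= rear m' t)%E.
Proof.
move=> mm mm' mle; apply: ereal_inf_le_tmp => _ [l [l0 H] <-]; exists l => //; split => //.
apply: le_trans H; apply: ae_measure_le; do ?exact: measurable_gt.
by apply: filterS mle => x mx /=; move=> /lt_le_trans; apply.
Qed.

(** The rearrangement is the generalized inverse of the distribution function. The backward
    direction is right continuity of the latter; the forward one passes through l + e, as only
    positive levels enter the infimum. *)
Lemma rear_gt m t l : measurable_fun setT m -> 0 <= l ->
  (l%:E < rear m t)%E <-> (t%:E < dist m l)%E.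
Proof.
move=> mm l0; split => [H|H].
  rewrite ltNge; apply/negP => dl; move: H; apply/negP; rewrite -leNgt.
  apply/lee_addgt0Pr => e e0; apply: ereal_inf_lbound.
  exists (l + e); last by rewrite EFinD.
  split; first by rewrite ltr_wpDl.
  by apply: le_trans dl; apply: dist_nonincr => //; rewrite lerDl ltW.
pose F n := [set x | (l + n.+1%:R^-1 < m x)%R].
have [n Hn] : exists n, (t%:E < mu (F n))%E.
  apply: contrapT => Hn; move: H; apply/negP; rewrite -leNgt /dist.
  have -> : [set x | l < m x] = \bigcup_n F n.
    apply/seteqP; split => x /=.
      move=> lx; have h : 0 < m x - l by rewrite subr_gt0.
      have h2 : 0 < (m x - l) / 2 by rewrite divr_gt0.
      have [M HM] := divn_small 1 h2.
      exists M => //=; rewrite /F /=.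
      have := HM M.+1 (leqnSn _); rewrite mulr1 => H.
      rewrite -ltrBrDl; apply: le_lt_trans H _.
      by rewrite ltr_pdivrMr // ltr_pMr // ltr1n.
    move=> [n _] /=; apply: le_lt_trans; by rewrite lerDl invr_ge0.
  have mF n : measurable (F n) by exact: measurable_gt.
  have ndF : nondecreasing_seq F.
    move=> i j ij; apply/subsetPset => x; rewrite /F /=; apply: le_lt_trans.
    by rewrite lerD2l lef_pV2 ?posrE // ler_nat.
  have H := @nondecreasing_cvg_mu _ _ _ mu F mF (bigcup_measurable (fun k _ => mF k)) ndF.
  have /cvg_lim <- // := H.
  apply: lime_le; first exact: cvgP H.
  apply: nearW => n /=; rewrite leNgt; apply/negP => h; apply: Hn; by exists n.
apply: (@lt_le_trans _ _ (l + n.+1%:R^-1)%:E).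
  by rewrite lte_fin ltrDl invr_gt0.
apply: le_ereal_inf_tmp => _ [l' [l'0 H'] <-]; rewrite lee_fin leNgt.
apply/negP => ll'; move: Hn; apply/negP; rewrite -leNgt.
by apply: le_trans H'; apply: dist_nonincr => //; exact: ltW.
Qed.

Lemma measurable_rear m : measurable_fun setT m -> measurable_fun setT (rear m).
Proof.
move=> mm; apply: (measurability _ (ErealGenOInfty.measurableE R)) => // _ [_ [l ->] <-].
rewrite setTI; case: (ltP l 0) => l0.
  rewrite (_ : _ @^-1` _ = setT) //; apply/seteqP; split => // t _ /=.
  by rewrite in_itv /= andbT (lt_le_trans _ (rear_ge0 m t)) // lte_fin.
have -> : rear m @^-1` `]l%:E, +oo[%classic = [set t | (t%:E < dist m l)%E].
  apply/seteqP; split => t /=; rewrite in_itv /= andbT.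
    by move/(rear_gt _ mm l0).
  by move=> H; apply/rear_gt.
have -> : [set t | (t%:E < dist m l)%E] = EFin @^-1` `]-oo, dist m l[%classic.
  by apply/seteqP; split => t /=; rewrite in_itv.
rewrite -[X in measurable X]setTI; apply: EFin_measurable => //.
exact: emeasurable_itv.
Qed.

Local Notation leb := (@lebesgue_measure R).

Lemma rear_dist_le m s l : measurable_fun setT m -> 0 < l ->
  (leb [set t | l%:E < (rear m \_ `]0%R, s]) t]%E <= dist m l)%E.
Proof.
move=> mm l0.
have mA : measurable [set t | (l%:E < (rear m \_ `]0%R, s]) t)%E].
  rewrite -[X in measurable X]setTI; apply: emeasurable_fun_o_infty => //.
  by apply/(measurable_restrictT _ _).1 => //; apply: measurable_funTS; exact: measurable_rear.
have sub : [set t | (l%:E < (rear m \_ `]0%R, s]) t)%E] `<=`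
    [set t | 0 < t /\ (t%:E < dist m l)%E].
  move=> t /=; rewrite patchE; case: ifPn => [|_]; last by rewrite lte_fin ltNge ltW.
  rewrite inE /= in_itv /= => /andP[t0 _] /(rear_gt _ mm (ltW l0)) H; by split.
case E : (dist m l) => [q| |]; last 2 first.
- by rewrite leey.
- by have := dist_ge0 m l; rewrite E.
apply: (@le_trans _ _ (leb `]0%R, q[%classic)).
  apply: le_measure; rewrite ?inE //.
  by move=> t /sub /=; rewrite in_itv /= E lte_fin => -[-> ->].
rewrite lebesgue_measure_itv /= lte_fin; case: ifPn => _; first by rewrite oppr0 adde0.
by rewrite -E dist_ge0.
Qed.

Lemma int_rear_le m s : measurable_fun setT m -> (forall x, 0 <= m x) ->
  (\int[leb]_(t in `]0%R, s]) rear m t <= \int[mu]_x (m x)%:E)%E.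
Proof.
move=> mm m0; rewrite [leLHS]integral_mkcond.
apply: le_integral_dist => //.
- by apply/(measurable_restrictT _ _).1 => //; apply: measurable_funTS; exact: measurable_rear.
- exact/measurable_EFinP.
- by move=> t; rewrite patchE; case: ifP => // _; exact: rear_ge0.
- by move=> l l0; exact: rear_dist_le.
Qed.

(** The distributions of (m - a)^+ and of mu_t(m) - a on (0, s] are compared: for l > 0 the set
    where m > a + l has measure q <= s because a = mu_s(m), and mu_t(m) > a + l for t in (0, q). *)
Lemma int_excess_le m s a : measurable_fun setT m -> 0 < s ->
  rear m s = a%:E ->
  (\int[mu]_x (Num.max 0 (m x - a))%:E + (s * a)%:E <=
   \int[leb]_(t in `]0%R, s]) rear m t)%E.
Proof.
move=> mm s0 ra.
have a0 : 0 <= a by rewrite -lee_fin -ra rear_ge0.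
have mr : measurable_fun (`]0%R, s] : set R) (rear m).
  by apply: measurable_funTS; exact: measurable_rear.
pose G t := (rear m t - a%:E)%E.
have mG : measurable_fun (`]0%R, s] : set R) G by exact: emeasurable_funB.
have G0 t : `]0, s]%classic t -> (0 <= G t)%E.
  by rewrite /= in_itv /= => /andP[_ ts]; rewrite sube_ge0 // -ra rear_nonincr.
have -> : (\int[leb]_(t in `]0%R, s]) rear m t =
    \int[leb]_(t in `]0%R, s]) G t + (s * a)%:E)%E.
  transitivity (\int[leb]_(t in `]0%R, s]) (G t + a%:E))%E.
    by apply: eq_integral => t _; rewrite /G subeK.
  rewrite ge0_integralD //.
  rewrite integral_cst //= lebesgue_measure_itv /= lte_fin s0 oppr0 adde0.
  by rewrite -EFinM mulrC.
apply: leeD => //; rewrite [leRHS]integral_mkcond.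
apply: le_integral_dist.
- by apply/measurable_EFinP; apply: measurable_maxr => //; exact: measurable_funB.
- exact/(measurable_restrictT _ _).1.
- by move=> x; rewrite lee_fin le_max lexx.
- by move=> t; rewrite patchE; case: ifPn => // /set_mem; exact: G0.
move=> l l0.
have -> : [set x | l%:E < (Num.max 0 (m x - a))%:E]%E = [set x | (a + l < m x)%R].
  apply/seteqP; split => x /=; rewrite lte_fin lt_max (ltNge l 0) (ltW l0) /= ltrBrDl //.
have al0 : 0 <= a + l by rewrite addr_ge0 // ltW.
have qs : (mu [set x | (a + l < m x)%R] <= s%:E)%E.
  rewrite leNgt; apply/negP => /(rear_gt _ mm al0).
  by rewrite ra lte_fin ltNge lerDl (ltW l0).
have q0 := measure_ge0 mu [set x | (a + l < m x)%R].
have [q Eq] : exists q, mu [set x | (a + l < m x)%R] = q%:E.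
  exists (fine (mu [set x | (a + l < m x)%R])); rewrite fineK // ge0_fin_numE //.
  by rewrite (le_lt_trans qs) // ltry.
rewrite Eq !lee_fin in qs q0 *.
apply: (@le_trans _ _ (leb `]0%R, q[%classic)).
  rewrite lebesgue_measure_itv /= lte_fin; case: ltP => h; first by rewrite oppr0 adde0.
  by rewrite lee_fin.
apply: le_measure; rewrite ?inE //.
- rewrite -[X in measurable X]setTI; apply: emeasurable_fun_o_infty => //.
  exact/(measurable_restrictT _ _).1.
move=> t /=; rewrite in_itv /= => /andP[t0 tq].
have ts : t <= s by rewrite (le_trans (ltW tq)).
rewrite patchE mem_set /=; last by rewrite in_itv /= t0.
rewrite /G lteBrDr // addrC -EFinD; apply/rear_gt => //.
by rewrite /dist Eq lte_fin.
Qed.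

Lemma rear_excess m t b : measurable_fun setT m -> 0 <= b ->
  (rear m t <= rear (fun x => Num.max 0 (m x - b))%R t + b%:E)%E.
Proof.
move=> mm b0; rewrite -leeBlDr //; apply: le_ereal_inf_tmp => _ [l [l0 H] <-].
rewrite leeBlDr // -EFinD; apply: ereal_inf_lbound; exists (l + b) => //.
split; first by rewrite ltr_pwDl.
apply: le_trans H; rewrite /dist (_ : [set x | l < _] = [set x | l + b < m x]) //.
by apply/seteqP; split => x /=; rewrite lt_max (ltNge l 0) (ltW l0) /= ltrBrDr.
Qed.

(** The converse bound, for every level b. Combined with [int_excess_le] at b = mu_s of the
    majorant, it reduces majorization to comparing excesses over one common level. *)
Lemma int_rear_excess m s b : measurable_fun setT m -> 0 < s -> 0 <= b ->
  (\int[leb]_(t in `]0%R, s]) rear m t <=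
   \int[mu]_x (Num.max 0 (m x - b))%:E + (s * b)%:E)%E.
Proof.
move=> mm s0 b0.
have me : measurable_fun setT (fun x => Num.max 0 (m x - b)).
  by apply: measurable_maxr => //; exact: measurable_funB.
apply: (@le_trans _ _ (\int[leb]_(t in `]0%R, s])
    (rear (fun x => Num.max 0 (m x - b))%R t + b%:E))%E).
  apply: ge0_le_integral => //.
  - by move=> t _; exact: rear_ge0.
  - by apply: measurable_funTS; exact: measurable_rear.
  - by apply: emeasurable_funD => //; apply: measurable_funTS; exact: measurable_rear.
  - by move=> t _; exact: rear_excess.
rewrite ge0_integralD //.
- apply: leeD; first by apply: int_rear_le => // x; rewrite le_max lexx.
  rewrite integral_cst //= lebesgue_measure_itv /= lte_fin s0 oppr0 adde0.
  by rewrite -EFinM mulrC.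
- by move=> t _; exact: rear_ge0.
- by apply: measurable_funTS; exact: measurable_rear.
Qed.

End Rearrangement.

(** * The limit function *)

Section AeLimit.
Context (d : measure_display) (Omega : measurableType d) (R : realType).
Context (mu : {measure set Omega -> \bar R}).

Lemma real_cauchy_cvg (s : nat -> R) :
  (forall e : R, 0 < e -> exists M : nat, forall m n, (M <= m)%N -> (M <= n)%N ->
    `|s m - s n| <= e) -> cvgn s.
Proof.
move=> H; apply/cauchy_cvgP/cauchy_exP => e e0.
have [M HM] := H (e / 2) (divr_gt0 e0 (ltr0n _ 2)).
exists (s M); exists M => // n /= Mn; rewrite /ball /=.
by apply: le_lt_trans (HM _ _ (leqnn M) Mn) _; rewrite ltr_pdivrMr // ltr_pMr // ltr1n.
Qed.

(** The upper limit is defined and measurable everywhere, so its finite part is a measurable version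
    of the limit. *)
Lemma ae_limit (s : nat -> Omega -> R) : (forall n, measurable_fun setT (s n)) ->
  {ae mu, forall x, cvgn (s ^~ x)} ->
  exists2 v : Omega -> R, measurable_fun setT v &
    {ae mu, forall x, s n x @[n --> \oo] --> v x}.
Proof.
move=> ms Hs; exists (fun x => fine (limn_esup (fun n => (s n x)%:E))).
  apply: measurableT_comp => //.
  by apply: measurable_fun_limn_esup => n; exact/measurable_EFinP.
apply: filterS Hs => x Hx.
have H : (s n x)%:E @[n --> \oo] --> (limn (s ^~ x))%:E.
  by apply: cvg_EFin => //; exact: nearW.
by rewrite (is_cvg_limn_esupE (cvgP _ H)) (cvg_lim _ H).
Qed.

End AeLimit.

Section RealLimit.
Context (d : measure_display) (Omega : measurableType d) (R : realType).
Context (mu : {measure set Omega -> \bar R}).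
Context (mu_gt0 : (0 < mu [set: Omega])%E).
Context (T : (Omega -> R) -> Omega -> R).
Context (DS : dunford_schwartz mu (real_complex R) T).
Implicit Types (f g h u v w : Omega -> R).
Local Notation normc := (@ComplexField.Normc.normc R).
Local Notation toC := (real_complex R).
Local Notation W beta f := (weighted_average (real_complex R) beta T f).

Lemma rearrangement_real u :
  rearrangement mu (real_complex R) u = rear mu (fun x => `|u x|).
Proof. by rewrite -modulus_real. Qed.

Lemma L1Loo_ideal u w : L1Loo mu u -> measurable_fun setT w ->
  {ae mu, forall x, `|w x| <= `|u x|} -> L1Loo mu w.
Proof.
move=> [u1 [u2 [c [[mu1 u1f] [mu2 u2c] uE]]]] mw wu.
have c0 := normr_ge0 c.
have mcl : measurable_fun setT (fun x => clamp `|c| (w x)).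
  exact: (measurable_clamp (measurable_cst _)).
(* Where |w| exceeds |c|, its excess is at most |u1|, because |w| <= |u1| + |c| almost
   everywhere. *)
exists (fun x => w x - clamp `|c| (w x)), (fun x => clamp `|c| (w x)), `|c|; split.
- have mr : measurable_fun setT (fun x => w x - clamp `|c| (w x)).
    exact: measurable_funB.
  split => //; apply: le_lt_trans u1f; apply: norm1_le => //.
  apply: filterS2 wu u2c => x wu u2c; rewrite clamp_rest // ge_max normr_ge0 /=.
  rewrite lerBlDr (le_trans wu) // uE (le_trans (ler_normD _ _)) // lerD2l.
  by rewrite (le_trans u2c) // ler_norm.
- by split => //; apply: aeW => x; exact: clamp_le.
- by apply/funext => x; rewrite subrK.
Qed.

Lemma rear_fin u s : L1Loo mu u -> 0 < s ->
  exists a, rear mu (fun x => `|u x|%R) s = a%:E.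
Proof.
move=> uL s0; have [u1 [u2 [c [[mu1 u1f] [mu2 u2c] uE]]]] := uL.
have mu' := L1LooM uL.
have mn : measurable_fun setT (fun x => `|u x|) by exact: measurableT_comp.
have n0 := norm1_ge0 mu u1.
have [q Eq] : exists q, norm1 mu u1 = q%:E.
  by exists (fine (norm1 mu u1)); rewrite fineK // ge0_fin_numE.
have q0 : 0 <= q by rewrite -lee_fin -Eq.
(* Markov's inequality then bounds the measure of |u1| >= l by q s / (q + 1) <= s. *)
pose l := (q + 1) / s; have l0 : 0 < l by rewrite divr_gt0 // ltr_wpDl.
have b0 : 0 <= l + `|c| by rewrite addr_ge0 // ltW.
have H : (rear mu (fun x => `|u x|%R) s <= (l + `|c|)%:E)%E.
  rewrite leNgt; apply/negP => /(rear_gt _ _ mn b0); apply/negP; rewrite -leNgt.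
  apply: (@le_trans _ _ (mu [set x | l <= `|u1 x|]%R)).
    apply: ae_measure_le.
    - exact: measurable_gt.
    - by apply: measurable_ge; exact: measurableT_comp.
    apply: filterS u2c => x u2c /=; rewrite uE => h.
    have := ler_normD (u1 x) (u2 x); have := ler_norm c; lra.
  apply: le_trans (markov_norm1 mu mu1 l0) _.
  rewrite Eq -EFinM lee_fin /l invf_div mulrAC ler_pdivrMr; last by rewrite ltr_wpDl.
  by rewrite ler_pM2l // lerDl.
exists (fine (rear mu (fun x => `|u x|%R) s)); rewrite fineK //.
by rewrite ge0_fin_numE ?rear_ge0 // (le_lt_trans H) // ltry.
Qed.

Lemma int_avg_le (C : R) g n : 0 <= C -> L1 mu g ->
  (\int[mu]_x (n%:R^-1 * \sum_(k < n) C * `|iter k T g x|)%:E <= C%:E * norm1 mu g)%E.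
Proof.
move=> C0 g1; have gf := g1.2.
have mi k : measurable_fun setT (iter k T g) by case: (iter_L1 mu_gt0 DS k g1).
have ma k : measurable_fun setT (fun x => `|iter k T g x|) by exact: measurableT_comp.
under eq_integral do rewrite EFinM -sumEFin.
have nn : 0 <= n%:R^-1 :> R by rewrite invr_ge0.
rewrite ge0_integralZl_EFin //; last 2 first.
- by move=> x _; apply: sume_ge0 => k _; rewrite lee_fin mulr_ge0.
- by apply: emeasurable_sum => k; apply/measurable_EFinP; apply: measurable_funM.
rewrite ge0_integral_sum //; last 2 first.
- by move=> k; apply/measurable_EFinP; apply: measurable_funM.
- by move=> k x _; rewrite lee_fin mulr_ge0.
have Hk k : (\int[mu]_x (C * `|iter k T g x|)%:E <= C%:E * norm1 mu g)%E.
  under eq_integral do rewrite EFinM.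
  rewrite ge0_integralZl_EFin //; last exact/measurable_EFinP.
  by apply: lee_wpmul2l; rewrite ?lee_fin //; exact: (iter_norm1 mu_gt0 DS).
have [q Eq] : exists q, norm1 mu g = q%:E.
  by exists (fine (norm1 mu g)); rewrite fineK // ge0_fin_numE // norm1_ge0.
rewrite Eq in Hk *.
apply: (@le_trans _ _ (n%:R^-1%:E * \sum_(k < n) (C * q)%:E)%E).
  by apply: lee_wpmul2l; rewrite ?lee_fin //; apply: lee_sum => k _; rewrite EFinM.
rewrite sumEFin -EFinM lee_fin sumr_const card_ord.
have q0 : 0 <= q by rewrite -lee_fin -Eq norm1_ge0.
case: n {nn} => [|n]; first by rewrite invr0 mul0r mulr_ge0.
by rewrite -[C * q *+ n.+1]mulr_natl mulKf // pnatr_eq0.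
Qed.

Context (theta : R[i] -> R) (theta_le : forall z, `|theta z| <= normc z).

(** [theta] stands for the real or the imaginary part. The truncated part of u accounts for C a, so
    the excess of the limit is at most the lower limit of the averages of C |T^k g| for the rest g.
    Their integrals are at most C times the L1 norm of g. *)
Lemma excess_limit u v beta (C a : R) : L1Loo mu u -> 0 <= a -> 0 <= C ->
  (forall k, normc (beta k) <= C) ->
  L1 mu (fun x => u x - clamp a (u x)) -> measurable_fun setT v ->
  {ae mu, forall x, theta (W beta u n x) @[n --> \oo] --> v x} ->
  (\int[mu]_x (Num.max 0 (`|v x| - C * a))%:E <=
   C%:E * norm1 mu (fun x => (u x - clamp a (u x))%R))%E.
Proof.
move=> uL a0 C0 bC g1 mv Hv.
set g := fun x => u x - clamp a (u x).
pose K n x := n%:R^-1 * \sum_(k < n) C * `|iter k T g x|.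
have mi k : measurable_fun setT (iter k T g) by case: (iter_L1 mu_gt0 DS k g1).
have mK n : measurable_fun setT (fun x => (K n x)%:E).
  apply/measurable_EFinP; apply: measurable_funM => //; apply: measurable_sum => k.
  by apply: measurable_funM => //; exact: measurableT_comp.
have K0 n x : 0 <= K n x.
  by rewrite mulr_ge0 ?invr_ge0 // sumr_ge0 // => k _; rewrite mulr_ge0.
have c1 : Loo mu a (fun x => clamp a (u x)).
  split; last by apply: aeW => x; exact: clamp_le.
  by apply: (measurable_clamp (measurable_cst _)); exact: L1LooM uL.
have H2 := avg_add mu_gt0 DS beta (L1_L1Loo g1) (Loo_L1Loo c1)
  (fun x => esym (subrK (clamp a (u x)) (u x))).
have H3 := avg_bound mu_gt0 DS bC c1.
have main : {ae mu, forall x, setT x -> ((Num.max 0 (`|v x| - C * a))%:E <=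
    limn_einf (fun n => (K n x)%:E))%E}.
  apply: filterS3 Hv H2 H3 => x Hv H2 H3 _.
  have WK n : `|theta (W beta u n x)| <= K n x + C * a.
    apply: le_trans (theta_le _) _; rewrite H2 (le_trans (normcD _ _)) // lerD //.
    rewrite /weighted_average normc_invnat ler_wpM2l ?invr_ge0 //.
    rewrite (le_trans (normc_sum _)) //; apply: ler_sum => k _.
    by rewrite normcME normc_real ler_wpM2r.
  apply: le_limn_einf => r; rewrite lte_fin lt_max => /orP[r0|rv].
    by exists 0%N => n _; rewrite lee_fin (le_trans (ltW r0)).
  have e0 : 0 < `|v x| - C * a - r by rewrite subr_gt0.
  have /cvgrPdist_lt /(_ _ e0) [M _ HM] := Hv.
  exists M => n Mn; rewrite lee_fin.
  have := HM n Mn; have := WK n; have := ler_distD (theta (W beta u n x)) (v x) 0.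
  rewrite !subr0; lra.
apply: (@le_trans _ _ (\int[mu]_x limn_einf (fun n => (K n x)%:E))%E).
  apply: ae_ge0_le_integral => //.
  - by move=> x _; rewrite lee_fin le_max lexx.
  - by apply/measurable_EFinP; exact: measurable_excess.
  - by move=> x _; apply: le_limn_einf => r; rewrite lte_fin => r0; exists 0%N => n _;
      rewrite lee_fin (le_trans (ltW r0)).
  - rewrite (_ : (fun x => _) = fun x => (- limn_esup (fun n => - (K n x)%:E))%E) //.
    apply: measurableT_comp => //; apply: measurable_fun_limn_esup => n.
    exact: measurableT_comp.
apply: le_trans (fatou _ measurableT mK _) _.
  by move=> n x _; rewrite lee_fin.
by apply: limn_einf_le => n; exact: int_avg_le.
Qed.

Context (theta_D : forall z1 z2, theta (z1 - z2) = theta z1 - theta z2).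
Context (theta_real : forall z (r : R), theta (z * toC r) = theta z * r).
Context (theta_sum : forall n (G : 'I_n -> R[i]), theta (\sum_i G i) = \sum_i theta (G i)).

Lemma real_limit u beta (C : R) : L1Loo mu u ->
  (forall l : R, 0 < l -> (mu [set x | (l < `|u x|)%R] < +oo)%E) ->
  bounded_besicovitch beta -> 0 < C -> (forall k, normc (beta k) <= C) ->
  exists v : Omega -> R,
  [/\ L1Loo mu v,
      {ae mu, forall x, theta (W beta u n x) @[n --> \oo] --> v x} &
      hlp_majorized mu (real_complex R) v (fun x => C * u x)].
Proof.
move=> uL uv bB C0 bC; have mu' := L1LooM uL.
have Hc := vanishing_cauchy mu_gt0 DS uL uv bB.
have mW n : measurable_fun setT (fun x => theta (W beta u n x)).
  rewrite (_ : (fun x => _) =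
    fun x => n%:R^-1 * \sum_(k < n) theta (beta k) * iter k T u x).
    apply: measurable_funM => //; apply: measurable_sum => k.
    apply: measurable_funM => //.
    exact: L1LooM (iter_L1Loo mu_gt0 DS k uL).
  apply/funext => x; rewrite /weighted_average invnatCE mulrC theta_real mulrC.
  by rewrite theta_sum; congr (_ * _); apply: eq_bigr => k _; rewrite theta_real.
have [v mv Hv] : exists2 v : Omega -> R, measurable_fun setT v &
    {ae mu, forall x, theta (W beta u n x) @[n --> \oo] --> v x}.
  apply: ae_limit => //; apply: filterS Hc => x Hx.
  apply: real_cauchy_cvg => e /Hx[M HM]; exists M => m n Mm Mn.
  by rewrite -theta_D; apply: le_trans (HM m n Mm Mn); exact: theta_le.
exists v; split; [|exact: Hv|].
  (* The estimate at level 1 already shows that v is the sum of an integrable function and one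
     bounded by C. *)
  have g1 := excess_L1 ltr01 uL (uv 1 ltr01).
  have H := excess_limit uL ler01 (ltW C0) bC g1 mv Hv.
  rewrite mulr1 in H; have C0' := ltW C0.
  have mc : measurable_fun setT (fun x => clamp C (v x)).
    exact: (measurable_clamp (measurable_cst _)).
  exists (fun x => v x - clamp C (v x)), (fun x => clamp C (v x)), C; split.
  - split; first exact: measurable_funB.
    rewrite /norm1; under eq_integral do rewrite clamp_rest //.
    apply: le_lt_trans H _; apply: lte_mul_pinfty; rewrite ?lee_fin //.
    by case: g1.
  - by split => //; apply: aeW => x; exact: clamp_le.
  - by apply/funext => x; rewrite subrK.
move=> s s0; rewrite !rearrangement_real.
have CuL : L1Loo mu (fun x => C * u x).
  have := L1Loo_lin C uL (L1Loo_0 mu).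
  by congr L1Loo; apply/funext => x; rewrite addr0.
have [b Eb] := rear_fin CuL s0.
have b0 : 0 <= b by rewrite -lee_fin -Eb rear_ge0.
have mCu : measurable_fun setT (fun x => `|C * u x|).
  by apply: measurableT_comp => //; exact: measurable_funM.
have mnv : measurable_fun setT (fun x => `|v x|) by exact: measurableT_comp.
(* When the majorant is finite, its finiteness makes the excess integrable. This covers the level b
   = 0, to which [excess_L1] does not apply. *)
have [->|fin] := eqVneq (\int[lebesgue_measure]_(t in `]0%R, s]) rear mu (fun x => `|C * u x|%R) t)%E +oo%E.
  by rewrite leey.
have HE := int_excess_le mCu s0 Eb.
(* The level of u that corresponds to the level b of C u: the excess of C u over b is C times the
   excess of u over a. *)
pose a := b / C; have a0 : 0 <= a by rewrite divr_ge0 // ltW.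
have CaE : C * a = b by rewrite /a mulrC divfK // gt_eqF.
have NE : (\int[mu]_x (Num.max 0 (`|C * u x| - b))%:E =
    C%:E * norm1 mu (fun x => (u x - clamp a (u x))%R))%E.
  rewrite /norm1 -ge0_integralZl_EFin ?(ltW C0) //.
    apply: eq_integral => x _; rewrite -EFinM clamp_rest // maxr_pMr ?(ltW C0) //.
    by rewrite mulr0 mulrBr CaE normrM (gtr0_norm C0).
  apply: measurable_normE; apply: measurable_funB => //.
  exact: (measurable_clamp (measurable_cst _)).
have g1 : L1 mu (fun x => u x - clamp a (u x)).
  split.
    by apply: measurable_funB => //; exact: (measurable_clamp (measurable_cst _)).
  have lty : (C%:E * norm1 mu (fun x => (u x - clamp a (u x))%R) < +oo)%E.
    rewrite -NE; apply: (@le_lt_trans _ _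
      (\int[lebesgue_measure]_(t in `]0%R, s]) rear mu (fun x => `|C * u x|%R) t)%E).
      by apply: le_trans HE; rewrite leeDl // lee_fin mulr_ge0 // ltW.
    by rewrite ltey; exact: fin.
  by rewrite ltey; apply/negP => /eqP E; move: lty; rewrite E gt0_muley ?lte_fin // ltxx.
have HX := excess_limit uL a0 (ltW C0) bC g1 mv Hv; rewrite CaE in HX.
apply: le_trans (int_rear_excess mu mnv s0 b0) _.
by apply: le_trans HE; rewrite leeD2r // NE.
Qed.


End RealLimit.

(** * Complex spaces and the theorem *)

Section Scalars.
Context (d : measure_display) (Omega : measurableType d) (R : realType).
Context (mu : {measure set Omega -> \bar R}).
Context (mu_gt0 : (0 < mu [set: Omega])%E).
Context (K : numFieldType) (iota : {rmorphism K -> R[i]}).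
Implicit Types (f g : Omega -> K).
Local Notation normc := (@ComplexField.Normc.normc R).

Lemma modulus_ge0 f x : 0 <= modulus iota f x.
Proof. exact: normc_ge0. Qed.

Lemma measurable_modulus f : measurable_scalar_fun iota f ->
  measurable_fun setT (modulus iota f).
Proof.
move=> [mr mi]; rewrite (_ : modulus iota f = fun x =>
  Num.sqrt (complex.Re (iota (f x)) ^+ 2 + complex.Im (iota (f x)) ^+ 2)).
  have msqrt : measurable_fun setT (@Num.sqrt R).
    by apply: continuous_measurable_fun; exact: sqrt_continuous.
  by apply: measurableT_comp => //; apply: measurable_funD; exact: measurable_funX.
by apply/funext => x; rewrite /modulus; case: (iota (f x)).
Qed.

Lemma measurable_scalarD f g : measurable_scalar_fun iota f ->
  measurable_scalar_fun iota g -> measurable_scalar_fun iota (fun x => f x + g x).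
Proof.
move=> [f1 f2] [g1 g2]; split.
  under [X in measurable_fun _ X]eq_fun do rewrite rmorphD cReD.
  exact: measurable_funD.
under [X in measurable_fun _ X]eq_fun do rewrite rmorphD cImD.
exact: measurable_funD.
Qed.

Lemma L1Linfty_measurable f : L1Linfty mu iota f -> measurable_scalar_fun iota f.
Proof. by move=> [g [h [[mg _] [mh _] ->]]]; exact: measurable_scalarD. Qed.

Lemma Lp1_normE f : Lp_norm mu iota 1%E f = (\int[mu]_x (modulus iota f x)%:E)%E.
Proof.
rewrite /Lp_norm Lnorm1; apply: eq_integral => x _ /=.
by rewrite ger0_norm // modulus_ge0.
Qed.

Lemma Lpoo_normE f c :
  (Lp_norm mu iota +oo%E f <= c%:E)%E <-> {ae mu, forall x, modulus iota f x <= c}.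
Proof.
rewrite /Lp_norm unlock /Lnorm mu_gt0; split.
  move=> /ess_supP; apply: filterS => x /=.
  by rewrite ger0_norm ?modulus_ge0 // lee_fin.
move=> fc; apply/ess_supP; move: fc; apply: filterS => x /=.
by rewrite ger0_norm ?modulus_ge0 // lee_fin.
Qed.

(** The integrable part is kept, and the whole change on a null set goes into the bounded part. *)
Lemma L1Linfty_ae f g : L1Linfty mu iota f -> measurable_scalar_fun iota g ->
  {ae mu, forall x, f x = g x} -> L1Linfty mu iota g.
Proof.
move=> [f1 [f2 [[m1 f1y] [m2 f2y] ->]]] mg fg.
have m1N : measurable_scalar_fun iota (fun x => - f1 x).
  case: m1 => mr mi; split.
    under [X in measurable_fun _ X]eq_fun do rewrite rmorphN cReN.
    exact: measurable_funN.
  under [X in measurable_fun _ X]eq_fun do rewrite rmorphN cImN.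
  exact: measurable_funN.
exists f1, (fun x => g x - f1 x); split; first by split.
- split; first exact: measurable_scalarD.
  have [c Ec] : exists c, Lp_norm mu iota +oo f2 = c%:E.
    exists (fine (Lp_norm mu iota +oo f2)); rewrite fineK // ge0_fin_numE //.
    exact: Lnorm_ge0.
  apply: (@le_lt_trans _ _ c%:E); last exact: ltry.
  apply/Lpoo_normE.
  have /Lpoo_normE : (Lp_norm mu iota +oo f2 <= c%:E)%E by rewrite Ec.
  by apply: filterS2 fg => x fgx; rewrite /modulus -fgx addrC addKr.
- by apply/funext => x; rewrite subrKC.
Qed.

Lemma L1Linfty_cst a : L1Linfty mu iota (fun=> a).
Proof.
exists (fun=> 0), (fun=> a); split.
- split; first by split; exact: measurable_cst.
  rewrite Lp1_normE (eq_integral (cst 0%E)) ?integral0 // => x _.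
  by rewrite /modulus rmorph0 normc0E.
- split; first by split; exact: measurable_cst.
  apply: le_lt_trans (_ : (normc (iota a))%:E < +oo)%E; last exact: ltry.
  by apply/Lpoo_normE; exact: aeW.
- by apply/funext => x; rewrite add0r.
Qed.

(* If a function of E exceeded l on a set of infinite measure, then the
   constant 1 would be majorized by a multiple of it. *)
Lemma finite_level_sets (E : set (Omega -> K)) N (scal : R -> K) :
  (forall r, iota (scal r) = real_complex R r) ->
  fully_symmetric mu iota E N -> ~ E (fun=> 1) -> forall f, E f ->
  forall l : R, 0 < l -> (mu [set x | (l < modulus iota f x)%R] < +oo)%E.
Proof.
move=> scalE [bE fsE] nE1 f Ef l l0; rewrite ltey; apply/negP => /eqP muy.
have mf := measurable_modulus (L1Linfty_measurable (bfs_sub bE Ef)).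
pose g x := scal l^-1 * f x.
have Eg : E g.
  have := bfs_linear bE (scal l^-1) Ef (bfs_0 bE).
  by congr E; apply/funext => x; rewrite addr0.
have mg := measurable_modulus (L1Linfty_measurable (bfs_sub bE Eg)).
have m1 := measurable_modulus (L1Linfty_measurable (L1Linfty_cst 1)).
have gE x : modulus iota g x = l^-1 * modulus iota f x.
  by rewrite /modulus rmorphM normcME scalE normc_real gtr0_norm ?invr_gt0.
have oneE x : modulus iota (fun=> 1) x = 1.
  by rewrite /modulus rmorph1 -[1]/(real_complex R 1) normc_real normr1.
apply: nE1; apply: (proj1 (fsE _ _ Eg (L1Linfty_cst 1) _)) => s s0.
rewrite -/(rear mu (modulus iota (fun=> 1))) -/(rear mu (modulus iota g)).
apply: ge0_le_integral => //.
- by move=> t _; exact: rear_ge0.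
- by apply: measurable_funTS; exact: measurable_rear.
- by apply: measurable_funTS; exact: measurable_rear.
move=> t; rewrite /= in_itv /= => /andP[t0 _].
apply: (@le_trans _ _ 1%:E).
  apply: ereal_inf_lbound; exists 1 => //; split => //.
  rewrite /dist (_ : [set x | _] = set0) ?measure0 ?lee_fin ?ltW //.
  by apply/seteqP; split => // x /=; rewrite oneE ltxx.
apply: le_ereal_inf_tmp => _ [r [r0 Hr] <-]; rewrite lee_fin leNgt.
apply/negP => r1; move: Hr; apply/negP; rewrite -ltNge.
apply: (@lt_le_trans _ _ +oo%E); first exact: ltry.
rewrite -muy; apply: le_measure; rewrite ?inE.
- exact: measurable_gt.
- exact: measurable_gt.
move=> x /=; rewrite gE => lf; apply: lt_trans r1 _.
by rewrite ltr_pdivlMl // mulr1.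
Qed.

End Scalars.

Lemma complex_cvg (R : realType) (s : nat -> R[i]) (a b : R) :
  complex.Re (s n) @[n --> \oo] --> a -> complex.Im (s n) @[n --> \oo] --> b ->
  (s n : (R[i] : numFieldType)) @[n --> \oo] --> (Complex a b : (R[i] : numFieldType)).
Proof.
(* A positive element of R[i] is a positive real: its imaginary part e' is 0. *)
move=> Ha Hb; apply/cvgrPdist_lt => -[e e'] /=.
rewrite ltcE /= => /andP[/eqP e'0 e0].
have e20 : 0 < e / 2 by rewrite divr_gt0.
move/cvgrPdist_lt : Ha => /(_ _ e20) Ha; move/cvgrPdist_lt : Hb => /(_ _ e20) Hb.
near=> n.
rewrite normc_def ltcE /= e'0 eqxx /=.
rewrite -sqr_normcE sqrtr_sqr ger0_norm ?normc_ge0 //.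
apply: le_lt_trans (normc_le_ReIm _) _.
rewrite cReD cReN cImD cImN /= (splitr e); apply: ltrD.
  by near: n; exact: Ha.
by near: n; exact: Hb.
Unshelve. all: by end_near. Qed.

(** * Reduction of a positive operator on complex functions to a real one *)

Section ComplexReduction.
Context (d : measure_display) (Omega : measurableType d) (R : realType).
Context (mu : {measure set Omega -> \bar R}).
Context (mu_gt0 : (0 < mu [set: Omega])%E).
Implicit Types (u v : Omega -> R) (F G : Omega -> R[i]).
Local Notation normc := (@ComplexField.Normc.normc R).
Local Notation toC := (real_complex R).
Local Notation idC := (idfun : {rmorphism R[i] -> R[i]}).
Local Notation Re := (@complex.Re R).
Local Notation Im := (@complex.Im R).

Lemma modulus_toC u : modulus idC (fun x => toC (u x)) = fun x => `|u x|.
Proof. by apply/funext => x; rewrite /modulus normc_real. Qed.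

Lemma measurable_scalar_toC u :
  measurable_scalar_fun idC (fun x => toC (u x)) <-> measurable_fun setT u.
Proof. by split=> [[]//|mu0]; split => //; exact: measurable_cst. Qed.

Lemma Lp_norm_toC p u :
  Lp_norm mu idC p (fun x => toC (u x)) = Lp_norm mu (real_complex R) p u.
Proof. by rewrite /Lp_norm modulus_toC modulus_real. Qed.

Lemma Lp_toC p u : Lp mu idC p (fun x => toC (u x)) <-> Lp mu (real_complex R) p u.
Proof. by rewrite /Lp Lp_norm_toC measurable_scalar_toC measurable_scalar_real. Qed.

Lemma L1Linfty_toC u :
  L1Linfty mu (real_complex R) u -> L1Linfty mu idC (fun x => toC (u x)).
Proof.
move=> [g [h [g1 h1 ->]]]; exists (fun x => toC (g x)), (fun x => toC (h x)).
by split; [exact/Lp_toC|exact/Lp_toC|apply/funext => x; rewrite rmorphD].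
Qed.

Lemma Lp1_norm_le u F : measurable_fun setT u -> measurable_scalar_fun idC F ->
  (forall x, `|u x| <= normc (F x)) ->
  (Lp_norm mu (real_complex R) 1 u <= Lp_norm mu idC 1 F)%E.
Proof.
move=> mu0 mF uF; rewrite !Lp1_normE modulus_real; apply: ge0_le_integral => //.
- exact: measurable_normE.
- by apply/measurable_EFinP; exact: measurable_modulus.
- by move=> x _; rewrite lee_fin.
Qed.

Lemma Lpoo_norm_mono u F : (forall x, `|u x| <= normc (F x)) ->
  (Lp_norm mu (real_complex R) +oo u <= Lp_norm mu idC +oo F)%E.
Proof.
move=> uF; rewrite /Lp_norm unlock /Lnorm mu_gt0 modulus_real.
apply: le_ess_sup; apply: aeW => x /=; rewrite lee_fin normr_id.
by rewrite [leRHS]ger0_norm ?modulus_ge0 //; exact: uF.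
Qed.

Lemma L1Linfty_part (theta : R[i] -> R) F :
  (forall z, `|theta z| <= normc z) ->
  (forall z1 z2, theta (z1 + z2) = theta z1 + theta z2) ->
  (forall G, measurable_scalar_fun idC G -> measurable_fun setT (theta \o G)) ->
  L1Linfty mu idC F -> L1Linfty mu (real_complex R) (theta \o F).
Proof.
move=> tle tD tm [g [h [[mg g1] [mh h1] ->]]].
exists (theta \o g), (theta \o h); split.
- split; first by apply/measurable_scalar_real; exact: tm.
  by apply: le_lt_trans g1; apply: Lp1_norm_le => //; [exact: tm|move=> x; exact: tle].
- split; first by apply/measurable_scalar_real; exact: tm.
  by apply: le_lt_trans h1; apply: Lpoo_norm_mono => x; exact: tle.
- by apply/funext => x /=; rewrite tD.
Qed.

Lemma L1Linfty_Re F : L1Linfty mu idC F -> L1Linfty mu (real_complex R) (Re \o F).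
Proof.
apply: L1Linfty_part; [exact: Re_le_normc|exact: cReD|by move=> G []].
Qed.

Lemma L1Linfty_Im F : L1Linfty mu idC F -> L1Linfty mu (real_complex R) (Im \o F).
Proof.
apply: L1Linfty_part; [exact: Im_le_normc|exact: cImD|by move=> G []].
Qed.

Context (T : (Omega -> R[i]) -> Omega -> R[i]).
Context (DS : dunford_schwartz mu idC T).

Definition real_part u : Omega -> R := fun x => Re (T (fun y => toC (u y)) x).

Lemma real_part_DS : dunford_schwartz mu (real_complex R) real_part.
Proof.
split.
- by move=> u /L1Linfty_toC /(ds_stable DS) /L1Linfty_Re.
- move=> u v u1 v1 uv.
  have := ds_ae DS (L1Linfty_toC u1) (L1Linfty_toC v1).
  have uv' : (fun x => toC (u x)) = (fun x => toC (v x)) %[ae mu].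
    by apply: filterS uv => x H /H ->.
  by move=> /(_ uv'); apply: filterS => x H /H; rewrite /real_part => ->.
- move=> a u v u1 v1.
  have := ds_linear DS (toC a) (L1Linfty_toC u1) (L1Linfty_toC v1).
  rewrite (_ : (fun x => toC a * toC (u x) + toC (v x)) =
    (fun x => toC (a * u x + v x))); last first.
    by apply/funext => x; rewrite rmorphD rmorphM.
  apply: filterS => x H /H; rewrite /real_part => ->.
  by rewrite cReD mulrC cReMr mulrC.
- move=> u u1; rewrite -(Lp_norm_toC _ u); move/Lp_toC: (u1) => u1'.
  have uL : L1Linfty mu (real_complex R) u.
    by apply/(L1LinftyE mu_gt0)/L1_L1Loo/Lp1_L1.
  apply: le_trans (ds_L1 DS u1').
  have TL := ds_stable DS (L1Linfty_toC uL).
  have mT := L1Linfty_measurable TL.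
  by apply: Lp1_norm_le => //; [case: mT|move=> x; exact: Re_le_normc].
- move=> u u1; rewrite -(Lp_norm_toC _ u); move/Lp_toC: (u1) => u1'.
  apply: le_trans (ds_Linfty DS u1').
  by apply: Lpoo_norm_mono => x; exact: Re_le_normc.
Qed.

Context (TP : positive_operator mu idC T).

(** Write u = p - q with p the positive part. Positivity makes T p and T q nonnegative, hence with
    imaginary part 0. *)
Lemma T_real u : L1Linfty mu (real_complex R) u ->
  {ae mu, forall x, T (fun y => toC (u y)) x = toC (real_part u x)}.
Proof.
move=> u1; have uL : L1Loo mu u by exact/(L1LinftyE mu_gt0).
have mu0 := L1LooM uL.
pose p x := Num.max 0 (u x); pose q x := Num.max 0 (u x) - u x.
have mp : measurable_fun setT p by exact: measurable_maxr.
have pL : L1Loo mu p.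
  apply: (L1Loo_ideal uL) => //; apply: aeW => x; rewrite /p.
  by case: (leP (u x) 0) => // _; rewrite normr0.
have qL : L1Loo mu q.
  apply: (L1Loo_ideal uL); first exact: measurable_funB.
  apply: aeW => x; rewrite /q; case: (leP (u x) 0) => // _.
    by rewrite sub0r normrN.
  by rewrite subrr normr0.
have toCL w : L1Loo mu w -> L1Linfty mu idC (fun x => toC (w x)).
  by move=> wL; apply: L1Linfty_toC; exact/(L1LinftyE mu_gt0).
have nonneg w : L1Loo mu w -> (forall x, 0 <= w x) ->
    {ae mu, forall x, Im (T (fun y => toC (w y)) x) = 0}.
  move=> wL w0; have := TP (toCL w wL).
  have H : {ae mu, forall x, 0 <= toC (w x)} by apply: aeW => x; rewrite ler0c.
  by move=> /(_ H); apply: filterS => x; rewrite lecE => /andP[/eqP -> _].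
have Hp : {ae mu, forall x, Im (T (fun y => toC (p y)) x) = 0}.
  by apply: nonneg => // x; rewrite le_max lexx.
have Hq : {ae mu, forall x, Im (T (fun y => toC (q y)) x) = 0}.
  by apply: nonneg => // x; rewrite subr_ge0 le_max lexx orbT.
have := ds_linear DS (- 1) (toCL q qL) (toCL p pL).
rewrite (_ : (fun x => -1 * toC (q x) + toC (p x)) = (fun x => toC (u x))); last first.
  by apply/funext => x; rewrite mulN1r addrC -rmorphB /p /q subKr.
apply: filterS3 Hp Hq => x Hp Hq /(_ I) H.
apply: eqComplex => //; rewrite H mulN1r cImD cImN Hp Hq oppr0 addr0 //.
Qed.

Lemma iter_real F k : L1Linfty mu idC F ->
  {ae mu, forall x, iter k T F x =
     'i%C * toC (iter k real_part (Im \o F) x) + toC (iter k real_part (Re \o F) x)}.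
Proof.
move=> F1.
have RL j : L1Linfty mu (real_complex R) (iter j real_part (Re \o F)).
  apply/(L1LinftyE mu_gt0)/(iter_L1Loo mu_gt0 real_part_DS)/(L1LinftyE mu_gt0).
  exact: L1Linfty_Re.
have IL j : L1Linfty mu (real_complex R) (iter j real_part (Im \o F)).
  apply/(L1LinftyE mu_gt0)/(iter_L1Loo mu_gt0 real_part_DS)/(L1LinftyE mu_gt0).
  exact: L1Linfty_Im.
have TL j : L1Linfty mu idC (iter j T F).
  by elim: j => //= j; exact: (ds_stable DS).
elim: k => [|k IH].
  apply: aeW => x /=; case: (F x) => a b; apply/esym/eqComplex.
    by rewrite cReD cReMr /= mul0r add0r.
  by rewrite cImD cImMr /= mul1r addr0.
set a := iter k real_part (Im \o F) in IH; set b := iter k real_part (Re \o F) in IH.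
(* [ds_ae] transports the induction hypothesis through T only between members of L^1 + L^oo;
   membership is inherited from [iter k T F]. *)
have GL : L1Linfty mu idC (fun x => 'i%C * toC (a x) + toC (b x)).
  apply: (L1Linfty_ae mu_gt0 (TL k) _ IH); split.
    rewrite (_ : (fun x => _) = b).
      by apply: (@L1LooM _ _ _ mu); apply/(L1LinftyE mu_gt0); exact: RL.
    apply/funext => x; rewrite -[LHS]/(Re ('i%C * toC (a x) + toC (b x))).
    by rewrite cReD cReMr mul0r add0r.
  rewrite (_ : (fun x => _) = a).
    by apply: (@L1LooM _ _ _ mu); apply/(L1LinftyE mu_gt0); exact: IL.
  apply/funext => x; rewrite -[LHS]/(Im ('i%C * toC (a x) + toC (b x))).
  by rewrite cImD cImMr mul1r addr0.
have H1 := ds_ae DS (TL k) GL.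
have IH' : iter k T F = (fun x => 'i%C * toC (a x) + toC (b x)) %[ae mu].
  by apply: filterS IH => x -> _.
have H2 := ds_linear DS 'i%C (L1Linfty_toC (IL k)) (L1Linfty_toC (RL k)).
have H3 := T_real (IL k); have H4 := T_real (RL k).
apply: filterS3 (filterI (H1 IH') H2) H3 H4 => x [h1 h2] h3 h4.
by rewrite iterS h1 // h2 // h3 h4.
Qed.

Lemma weighted_average_real F beta : L1Linfty mu idC F ->
  {ae mu, forall x, forall n, weighted_average idC beta T F n x =
    'i%C * weighted_average (real_complex R) beta real_part (Im \o F) n x +
    weighted_average (real_complex R) beta real_part (Re \o F) n x}.
Proof.
move=> F1; have := ae_foralln (fun k => iter_real k F1).
apply: filterS => x H n; rewrite /weighted_average mulrCA -mulrDr; congr (_ * _).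
by rewrite mulr_sumr -big_split; apply: eq_bigr => k _ /=; rewrite H; ring.
Qed.


End ComplexReduction.

(* First conjunct: real spaces.  As beta may be complex, the limit is
   fhat = g + i h with g and h in E; h = 0 when beta is real. *)
Theorem corollary5p1 (d : measure_display) (Omega : measurableType d)
    (R : realType) (mu : {measure set Omega -> \bar R})
    (mu_complete : measure_is_complete mu) (mu_infty : mu [set: Omega] = +oo%E) :
  (forall (E : set (Omega -> R)) (normE : (Omega -> R) -> R)
          (T : (Omega -> R) -> (Omega -> R)),
     fully_symmetric mu (real_complex R) E normE ->
     ~ E (fun=> 1) ->
     dunford_schwartz mu (real_complex R) T ->
     forall f, E f ->
     forall beta : nat -> R[i], bounded_besicovitch beta ->
     exists g h : Omega -> R,
       [/\ E g, E h,
           (forall k, complex.Im (beta k) = 0) -> h = (fun=> 0)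
         & cvg_ae mu (weighted_average (real_complex R) beta T f)
             (fun x => Complex (g x) (h x))])
  /\
  (forall (E : set (Omega -> R[i])) (normE : (Omega -> R[i]) -> R)
          (T : (Omega -> R[i]) -> (Omega -> R[i])),
     fully_symmetric mu idfun E normE ->
     ~ E (fun=> 1) ->
     dunford_schwartz mu idfun T ->
     positive_operator mu idfun T ->
     forall f, E f ->
     forall beta : nat -> R[i], bounded_besicovitch beta ->
     exists2 fhat : Omega -> R[i], E fhat &
       cvg_ae mu (weighted_average idfun beta T f) fhat).
Proof.
have mu_gt0 : (0 < mu [set: Omega])%E by rewrite mu_infty ltry.
have bound beta : bounded_besicovitch beta ->
    exists2 C : R, 0 < C & forall k, ComplexField.Normc.normc (beta k) <= C.
  move=> [[C bC] _]; exists (C + 1); last by move=> k; rewrite (le_trans (bC k)) // lerDl.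
  by rewrite ltr_wpDl // (le_trans (normc_ge0 _) (bC 0%N)).
split=> E N T fs nE1 DS.
  move=> f Ef beta bB; have [C C0 bC] := bound beta bB.
  have [bE fsE] := fs.
  have fL : L1Loo mu f by have := bfs_sub bE Ef; move/(L1LinftyE mu_gt0).
  have lev : forall l : R, 0 < l -> (mu [set x | (l < `|f x|)%R] < +oo)%E.
    move=> l l0; have := finite_level_sets mu_gt0 (scal := id) (fun=> erefl) fs nE1 Ef l0.
    by rewrite modulus_real.
  have [g [gL Hg mg]] := real_limit mu_gt0 DS (@Re_le_normc R) (@cReB R)
    (@cReMr R) (@Re_sum R) fL lev bB C0 bC.
  have [h [hL Hh mh]] := real_limit mu_gt0 DS (@Im_le_normc R) (@cImB R)
    (@cImMr R) (@Im_sum R) fL lev bB C0 bC.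
  have ECf : E (fun x => C * f x).
    have := bfs_linear bE C Ef (bfs_0 bE).
    by congr E; apply/funext => x; rewrite addr0.
  have EM w : L1Loo mu w -> hlp_majorized mu (real_complex R) w (fun x => C * f x) -> E w.
    by move=> /(L1LinftyE mu_gt0) wL mw; have [] := fsE _ _ ECf wL mw.
  (* The limit of the imaginary parts is determined only almost everywhere. For real weights these
     parts vanish identically, so the zero function itself is taken. *)
  have [Im0|nIm0] := pselect (forall k, complex.Im (beta k) = 0).
    exists g, (fun=> 0); split => //; [exact: EM|exact: bfs_0 bE|].
    apply: filterS Hg => x Hg; apply: complex_cvg => //.
    apply: cvg_near_cst; apply: nearW => n.
    rewrite /weighted_average invnatCE mulrC cImMr Im_sum big1 ?mul0r // => k _.
    by rewrite cImMr Im0 mul0r.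
  exists g, h; split => //; [exact: EM|exact: EM|].
  by apply: filterS2 Hg Hh => x; exact: complex_cvg.
move=> TP f Ef beta bB; have [C C0 bC] := bound beta bB.
have [bE fsE] := fs.
have f1 := bfs_sub bE Ef.
have rDS := real_part_DS mu_gt0 DS.
have uL : L1Loo mu (@complex.Re R \o f) by apply/(L1LinftyE mu_gt0); exact: L1Linfty_Re.
have vL : L1Loo mu (@complex.Im R \o f) by apply/(L1LinftyE mu_gt0); exact: L1Linfty_Im.
have mf := measurable_modulus (L1Linfty_measurable f1).
have scalE r : (idfun : {rmorphism R[i] -> R[i]}) (real_complex R r) = real_complex R r.
  by [].
have lev := finite_level_sets mu_gt0 scalE fs nE1 Ef.
have lev' (u : Omega -> R) : measurable_fun setT u ->
    (forall x, `|u x| <= modulus idfun f x) ->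
    forall l : R, 0 < l -> (mu [set x | (l < `|u x|)%R] < +oo)%E.
  move=> mu' uf l l0; apply: le_lt_trans (lev l l0).
  have mn : measurable_fun setT (fun x => `|u x|) by exact: measurableT_comp.
  apply: ae_measure_le; first exact: measurable_gt.
    exact: measurable_gt.
  by apply: aeW => x /= /lt_le_trans; apply.
have [mu' mv'] : measurable_fun setT (@complex.Re R \o f) /\ measurable_fun setT (@complex.Im R \o f).
  by split; [exact: L1LooM uL|exact: L1LooM vL].
have levu := lev' _ mu' (fun x => Re_le_normc (f x)).
have levv := lev' _ mv' (fun x => Im_le_normc (f x)).
(* Four real limits: u1, u2 are the real and imaginary parts of the limit for Re f, and v1, v2 those
   for Im f. *)
have [u1 [u1L Hu1 mu1]] := real_limit mu_gt0 rDS (@Re_le_normc R) (@cReB R)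
  (@cReMr R) (@Re_sum R) uL levu bB C0 bC.
have [u2 [u2L Hu2 mu2]] := real_limit mu_gt0 rDS (@Im_le_normc R) (@cImB R)
  (@cImMr R) (@Im_sum R) uL levu bB C0 bC.
have [v1 [v1L Hv1 mv1]] := real_limit mu_gt0 rDS (@Re_le_normc R) (@cReB R)
  (@cReMr R) (@Re_sum R) vL levv bB C0 bC.
have [v2 [v2L Hv2 mv2]] := real_limit mu_gt0 rDS (@Im_le_normc R) (@cImB R)
  (@cImMr R) (@Im_sum R) vL levv bB C0 bC.
pose Cf x := real_complex R C * f x.
have ECf : E Cf.
  have := bfs_linear bE (real_complex R C) Ef (bfs_0 bE).
  by congr E; apply/funext => x; rewrite addr0.
have mCf := measurable_modulus (L1Linfty_measurable (bfs_sub bE ECf)).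
(* From |u| <= |f|, the rearrangement of C u is at most that of C f, so w is majorized by an element
   of E. *)
have EM (w u : Omega -> R) : L1Loo mu w -> measurable_fun setT u ->
    (forall x, `|u x| <= modulus idfun f x) ->
    hlp_majorized mu (real_complex R) w (fun x => C * u x) ->
    E (fun x => real_complex R (w x)).
  move=> wL mu0 uf mw; apply: (proj1 (fsE _ _ ECf _ _)).
    by apply: L1Linfty_toC; exact/(L1LinftyE mu_gt0).
  move=> s s0; have := mw s s0; rewrite !rearrangement_real /rearrangement modulus_toC.
  rewrite -/(rear mu (fun x => `|w x|%R)) -/(rear mu (modulus idfun Cf)).
  move=> /le_trans; apply.
  have mCu : measurable_fun setT (fun x => `|C * u x|).
    by apply: measurableT_comp => //; exact: measurable_funM.
  apply: ge0_le_integral => //.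
  - by move=> t _; exact: rear_ge0.
  - by apply: measurable_funTS; exact: measurable_rear.
  - by apply: measurable_funTS; exact: measurable_rear.
  move=> t _; apply: le_rear => //; apply: aeW => x.
  rewrite /Cf /modulus /= normcME normc_real normrM ler_wpM2l //; exact: uf.
have Eu1 := EM _ _ u1L mu' (fun x => Re_le_normc (f x)) mu1.
have Eu2 := EM _ _ u2L mu' (fun x => Re_le_normc (f x)) mu2.
have Ev1 := EM _ _ v1L mv' (fun x => Im_le_normc (f x)) mv1.
have Ev2 := EM _ _ v2L mv' (fun x => Im_le_normc (f x)) mv2.
(* The real and imaginary parts of (u1 + i u2) + i (v1 + i v2). *)
exists (fun x => Complex (u1 x - v2 x) (u2 x + v1 x)).
  have H1 := bfs_linear bE 1 Ev1 Eu2.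
  have H2 := bfs_linear bE (- 1) Ev2 Eu1.
  have := bfs_linear bE 'i%C H1 H2.
  congr E; apply/funext => x; apply: eqComplex.
    by rewrite mulN1r mul1r cReD cReM !cReD cImD cReN /=; ring.
  by rewrite mulN1r mul1r cImD cImM cReD !cImD cImN /=; ring.
apply: filterS3 (weighted_average_real mu_gt0 DS TP beta f1)
  (filterI Hu1 Hu2) (filterI Hv1 Hv2) => x HW [h1 h2] [k1 k2].
rewrite (_ : (fun n => _) = fun n =>
  'i%C * weighted_average (real_complex R) beta (real_part T) (@complex.Im R \o f) n x +
  weighted_average (real_complex R) beta (real_part T) (@complex.Re R \o f) n x); last first.
  by apply/funext => n; exact: HW.
apply: complex_cvg.
  under eq_fun do rewrite cReD cReM /= mul0r mul1r sub0r addrC.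
  exact: cvgB.
under eq_fun do rewrite cImD cImM /= mul0r mul1r add0r addrC.
exact: cvgD.
Qed.
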